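(* Every complete Willmore Legendrian surface in $\mathbb{S}^5$ is a minimal surface. That is, if $F:\Sigma\to\mathbb{S}^5$ is a smooth Legendrian immersion of a surface $\Sigma$ which is a Willmore immersion and whose induced metric is complete, then its mean curvature vector field $H$ vanishes identically.
   Context: $\mathbb{S}^5\subset\mathbb{C}^3$ is the unit sphere with its standard metric and $i=\sqrt{-1}$. An immersed surface $F:\Sigma\to\mathbb{S}^5$ is called Legendrian if $iF$ is a normal field along $\Sigma$ and multiplication by $i$ maps $T\Sigma$ into the normal bundle of $\Sigma$ (equivalently, $T\Sigma$ is contained in the kernel of the standard contact form of $\mathbb{S}^5$). $B$ is the second fundamental form of $\Sigma$ in $\mathbb{S}^5$ (with the induced metric) and $H=\mathrm{tr}\,B$ is the mean curvature vector field (no factor $1/2$). $\Sigma$ is minimal if $H\equiv 0$. The Willmore functional of an immersed surface in $\mathbb{S}^5$ is $W=\int_\Sigma\left(\frac14|H|^2+1\right)d\mu$, where $d\mu$ is the induced area element. An immersion is Willmore if it is a critical point of $W$ under all smooth compactly supported variations in $\mathbb{S}^5$; equivalently, for a local orthonormal frame $\{e_\alpha\}_{\alpha=3}^{5}$ of the normal bundle and a local orthonormal tangent frame, with $h^\alpha_{ij}$ the components of $B$ and $H^\alpha=\sum_i h^\alpha_{ii}$, $$\Delta H^\alpha+\sum_{i,j,\beta}h_{ij}^\alpha h_{ij}^\beta H^\beta-\tfrac12|H|^2H^\alpha=0,\qquad \alpha=3,4,5,$$ where $\Delta H^\alpha$ is the $\alpha$-component of the Laplacian of $H$ in the normal bundle.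 A Willmore Legendrian surface in $\mathbb{S}^5$ is an immersed surface that is both Willmore and Legendrian. *)

(* Defs.v *)
From HB Require Import structures.
From mathcomp Require Import all_boot all_order all_algebra.
From mathcomp Require Import all_classical all_reals all_analysis.

Set Implicit Arguments.
Unset Strict Implicit.
Unset Printing Implicit Defensive.

Import Order.TTheory GRing.Theory Num.Theory.
Import numFieldNormedType.Exports.

Local Open Scope classical_set_scope.
Local Open Scope ring_scope.

(* Meant for [A] open in a finite-dimensional space: all iterated directional *)
(* derivatives of [f] of order at most [k] exist and are continuous on [A].   *)
Fixpoint Ck (R : realType) (V W : normedModType R) (k : nat) (A : set V)
    (f : V -> W) : Prop :=
  (forall x, A x -> {for x, continuous f}) /\
  match k with
  | 0 => True
  | k'.+1 => forall v, (forall x, A x -> derivable f x v) /\ Ck k' A ('D_v f)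
  end.

Definition smooth_on (R : realType) (V W : normedModType R) (A : set V)
    (f : V -> W) : Prop :=
  forall k, Ck k A f.

(* A smooth 2-manifold without boundary, not assumed connected, given by a    *)
(* smooth (not necessarily maximal) atlas. [cinv i] is only meaningful on     *)
(* [cimg i].                                                                  *)
Record smooth_surface (R : realType) := SmoothSurface {
  points :> topologicalType;
  surface_hausdorff : hausdorff_space points;
  surface_second_countable : @second_countable points;
  chart : Type;
  cdom : chart -> set points;
  cmap : chart -> points -> R * R;
  cinv : chart -> R * R -> points;
  cimg : chart -> set (R * R) := fun i => cmap i @` cdom i;
  cdom_open : forall i, open (cdom i);
  cimg_open : forall i, open (cimg i);
  cmapK : forall i x, cdom i x -> cinv i (cmap i x) = x;
  cmap_continuous : forall i x, cdom i x -> {for x, continuous (cmap i)};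
  cinv_continuous : forall i u, cimg i u -> {for u, continuous (cinv i)};
  cdom_cover : forall x, exists i, cdom i x;
  transition_smooth : forall i j,
    smooth_on (cimg i `&` cinv i @^-1` cdom j) (cmap j \o cinv i)
}.

(* C^3 is represented by R^6, with [row_mx x y] standing for x + i y. *)

Definition dot (R : realType) (v w : 'rV[R]_(3 + 3)) : R :=
  \sum_k v 0 k * w 0 k.

Definition enorm (R : realType) (v : 'rV[R]_(3 + 3)) : R :=
  Num.sqrt (dot v v).

Definition muli (R : realType) (v : 'rV[R]_(3 + 3)) : 'rV[R]_(3 + 3) :=
  row_mx (- rsubmx v) (lsubmx v).

(* Geometry at [u] of a parametrized surface [f] in the unit sphere of C^3.   *)
Section Parametrized.
Context {R : realType}.
Implicit Types (f : R * R -> 'rV[R]_(3 + 3)) (u : R * R) (i j : 'I_2).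

Definition axis i : R * R := if i == ord0 then (1, 0) else (0, 1).

Definition partial i f : R * R -> 'rV[R]_(3 + 3) := 'D_(axis i) f.

Definition induced_metric f u : 'M[R]_2 :=
  \matrix_(i, j) dot (partial i f u) (partial j f u).

Definition area_density f u : R := Num.sqrt (\det (induced_metric f u)).

Definition tangent_part f u (w : 'rV[R]_(3 + 3)) : 'rV[R]_(3 + 3) :=
  \sum_i \sum_j (invmx (induced_metric f u) i j * dot w (partial i f u))
    *: partial j f u.

(* The position vector [f u] is the unit normal of the sphere, so this is the *)
(* component of the flat second derivative normal to the surface within the   *)
(* sphere.                                                                    *)
Definition second_form f i j u : 'rV[R]_(3 + 3) :=
  let w := partial i (partial j f) u in
  w - dot w (f u) *: f u - tangent_part f u w.

Definition mean_curvature f u : 'rV[R]_(3 + 3) :=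
  \sum_i \sum_j invmx (induced_metric f u) i j *: second_form f i j u.

Definition willmore_density f u : R :=
  (4^-1 * enorm (mean_curvature f u) ^+ 2 + 1) * area_density f u.

Definition sphere_normal f u (w : 'rV[R]_(3 + 3)) : Prop :=
  dot w (f u) = 0 /\ forall v, dot w ('D_v f u) = 0.

End Parametrized.

Section Immersions.
Context {R : realType} {S : smooth_surface R}.
Implicit Types (F : S -> 'rV[R]_(3 + 3)) (K : set S) (x y z : S).

Definition sphere_immersion F : Prop :=
  [/\ forall x, enorm (F x) = 1,
      forall c : chart S, smooth_on (cimg c) (F \o cinv c) &
      forall (c : chart S) u, cimg c u ->
        forall v, 'D_v (F \o cinv c) u = 0 -> v = 0].

Definition legendrian F : Prop :=
  forall (c : chart S) u, cimg c u ->
    sphere_normal (F \o cinv c) u (muli (F (cinv c u))) /\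
    forall v, sphere_normal (F \o cinv c) u (muli ('D_v (F \o cinv c) u)).

Definition minimal_surface F : Prop :=
  forall (c : chart S) x, cdom c x ->
    mean_curvature (F \o cinv c) (cmap c x) = 0.

(* Every compact set has such a decomposition, and the resulting value of an  *)
(* area integral does not depend on it.                                       *)
Record chart_partition K := ChartPartition {
  cp_size : nat;
  cp_chart : 'I_cp_size -> chart S;
  cp_piece : 'I_cp_size -> set S;
  cp_cover : \bigcup_k cp_piece k = K;
  cp_disjoint : trivIset setT cp_piece;
  cp_dom : forall k, cp_piece k `<=` cdom (cp_chart k);
  cp_measurable : forall k, measurable (cmap (cp_chart k) @` cp_piece k)
}.

Definition willmore_energy K (P : chart_partition K) F : R :=
  \sum_(k < cp_size P) \int[(@lebesgue_measure R \x @lebesgue_measure R)%E]_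
    (u in cmap (cp_chart k) @` cp_piece k)
      willmore_density (F \o cinv (cp_chart k)) u.

(* Variations of [F] in the unit sphere, supported in [K]. The nearby maps    *)
(* [G t] are not required to be immersions: for small [t] they are, [K] being *)
(* compact.                                                                   *)
Definition sphere_variation F K (e : R) (G : R -> S -> 'rV[R]_(3 + 3)) : Prop :=
  [/\ G 0 = F,
      forall t x, `|t| < e -> enorm (G t x) = 1,
      forall t x, `|t| < e -> ~ K x -> G t x = F x &
      forall c : chart S,
        smooth_on [set tu : R * (R * R) | `|tu.1| < e /\ cimg c tu.2]
          (fun tu => G tu.1 (cinv c tu.2))].

(* Outside the support the integrand does not vary, so criticality is that of *)
(* the energy over the support; the energy of the whole surface may be        *)
(* infinite.                                                                  *)
Definition willmore F : Prop :=
  forall K e G, compact K -> 0 < e -> sphere_variation F K e G ->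
    forall P : chart_partition K,
      is_derive (0 : R) (1 : R) (fun t => willmore_energy P (G t)) 0.

(* Of class C^1 on [0, 1] up to the endpoints, i.e. on a neighbourhood of it; *)
(* the velocity may vanish.                                                   *)
Definition C1_curve (g : R -> S) : Prop :=
  exists2 A : set R, open A /\ `[0, 1] `<=` A &
    (forall t, A t -> {for t, continuous g}) /\
    forall c : chart S, Ck 1 (A `&` g @^-1` cdom c) (cmap c \o g).

(* Length for the metric induced by [F]. *)
Definition curve_length F (g : R -> S) : R :=
  \int[lebesgue_measure]_(t in `[0, 1]) enorm ('D_1 (F \o g) t).

(* [joined F x y l]: a piecewise C^1 curve from [x] to [y] has length [l].    *)
Inductive joined F : S -> S -> R -> Prop :=
| joined_nil x : joined F x x 0
| joined_cons g y l : C1_curve g -> joined F (g 1) y l ->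
    joined F (g 0) y (curve_length F g + l).

(* [+oo] between points in different components. *)
Definition induced_dist F x y : \bar R :=
  ereal_inf [set l%:E | l in joined F x y].

(* The induced distance defines the topology of [S], so convergence may be    *)
(* taken in [S].                                                              *)
Definition complete_induced_metric F : Prop :=
  forall a : nat -> S,
    (forall e : R, 0 < e -> exists N, forall m n, (N <= m)%N -> (N <= n)%N ->
      (induced_dist F (a m) (a n) < e%:E)%E) ->
    exists x, a @ \oo --> x.

End Immersions.

(* Main.v *)
Require Import Defs.
From HB Require Import structures.
From mathcomp Require Import all_boot all_order all_algebra.
From mathcomp Require Import all_classical all_reals all_analysis.
From mathcomp Require Import ring lra.
Set Implicit Arguments.
Unset Strict Implicit.
Unset Printing Implicit Defensive.
Import Order.TTheory GRing.Theory Num.Theory.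
Import numFieldNormedType.Exports.
Local Open Scope classical_set_scope.
Local Open Scope ring_scope.

(** The idea is that, on a Willmore Legendrian surface, the function 1/|H| obeys
    an oscillator equation along a unit vector field, and a positive function on a
    complete surface cannot do that.

    Let f be the surface in a chart, and suppose that H is nonzero on an open set.
    As the surface is Legendrian, the vectors f, e1, e2, i f, i e1, i e2 form an
    orthonormal basis of C^3 for every orthonormal tangent frame (e1, e2), H has no
    component along i f, and the cubic form <B(x, y), i z> is symmetric.  Choose e1
    such that H = h i e1 with h = |H| ([adapted_moving_frame]).  The cubic form then
    has components a, b, c, d with a + c = h and b + d = 0, and together with the
    connection coefficients w1, w2 they satisfy the equations of Gauss and Codazzi
    ([gauss_codazzi]).

    Pushing the surface along a compactly supported field V changes the Willmore
    integrand by a divergence plus the pairing of V with a field E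
    ([density_var_divergence]).  Bump functions show that E has no component
    orthogonal to f ([euler_lagrange]).  The one along i f is of first order: it says
    that the derivative of h along e1 is - h w2.  Codazzi gives the derivative of h
    along e2, and then the components along i e1, i e2 and the equation of Gauss force
    a = h/2, b = 0 and w1 = 0.  For q = 1/h this means that X2 q = 0,
    X1 (X1 q) = - q and X2 (X1 q) = 0, where Xa is the derivative along ea
    ([inverse_mean_oscillates]).  Hence q^2 + |grad q|^2 is locally constant
    ([derive_chart_energy]), and grad q is not identically zero near any point
    ([slope_somewhere]).

    Both |H| and |grad q| do not depend on the chart, so they are functions on the
    surface.  Start at a point with grad q <> 0 and consider all points which have
    the same value of q^2 + |grad q|^2 and at which q is not larger.  On this set
    |grad q| is bounded below, so from each of its points a short segment in a chart
    leads to another point of the set, with a loss of q that is at least a constant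
    times the length.  As q > 0, a sequence of such steps has finite length.  By
    completeness it converges; the limit is again in the set, because h is bounded
    below there, and a further step from the limit contradicts a greedy choice of the
    sequence ([no_descent]). *)

(** * Calculus of functions of class C^k *)

Section CkCalculus.
Context {R : realType} {V : normedModType R}.
Implicit Types (W : normedModType R) (A B : set V) (k : nat).

(** Lets one-variable theorems act on directional derivatives. *)
Lemma derive_line W (f : V -> W) x v :
  'D_1 (fun h : R => f (h *: v + x)) 0 = 'D_v f x.
Proof.
rewrite /derive; set g1 := fun h => h^-1 *: _; set g2 := fun h => h^-1 *: _.
suff -> : g1 = g2 by [].
by rewrite funeqE /g1 /g2 => h /=; rewrite addr0 scale0r add0r [_%:A]mulr1.
Qed.

Lemma is_derive_line W (f : V -> W) x v d :
  is_derive (0 : R) (1 : R) (fun h : R => f (h *: v + x)) d -> is_derive x v f d.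
Proof.
by move=> [H <-]; apply: DeriveDef; [exact/derivable1P|rewrite derive_line].
Qed.

Lemma Ck_continuous W k A (f : V -> W) x :
  Ck k A f -> A x -> {for x, continuous f}.
Proof. by case: k => [|k] [+ _]; apply. Qed.

Lemma Ck_derivable W k A (f : V -> W) x v :
  Ck k.+1 A f -> A x -> derivable f x v.
Proof. by case=> _ /(_ v)[+ _]; apply. Qed.

Arguments Ck_continuous {W k A f x} _ _.
Arguments Ck_derivable {W k A f x} v _ _.

Lemma Ck_derive W k A (f : V -> W) v : Ck k.+1 A f -> Ck k A ('D_v f).
Proof. by case=> _ /(_ v)[]. Qed.

Lemma CkS W k A (f : V -> W) : Ck k.+1 A f -> Ck k A f.
Proof.
elim: k f => [|k IH] f; first by case.
move=> [cf df]; split => // v; have [dfv Cf] := df v; split => //.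
exact: IH.
Qed.

Lemma Ck_subset W k A B (f : V -> W) : A `<=` B -> Ck k B f -> Ck k A f.
Proof.
move=> AB; elim: k f => [|k IH] f [cf df].
  by split=> // x /AB; exact: cf.
split=> [x /AB|v]; first exact: cf.
by have [dfv /IH ?] := df v; split => // x /AB; exact: dfv.
Qed.

(** Being of class C^k is a condition at each point, so it passes to unions.
    *)
Lemma Ck_setU W k A B (f : V -> W) : Ck k A f -> Ck k B f -> Ck k (A `|` B) f.
Proof.
elim: k f => [|k IH] f [cf df] [cg dg]; split=> //.
- by move=> x [/cf|/cg].
- by move=> x [/cf|/cg].
- move=> v; have [d1 /IH D1] := df v; have [d2 /D1 D2] := dg v.
  by split => // x [/d1|/d2].
Qed.

Lemma Ck_eq W k A (f g : V -> W) :
  open A -> (forall x, A x -> f x = g x) -> Ck k A f -> Ck k A g.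
Proof.
move=> oA; elim: k f g => [|k IH] f g fg [cf df].
  split=> // x Ax; rewrite /prop_for /continuous_at -(fg x Ax).
  apply: cvg_trans (cf x Ax); apply: near_eq_cvg.
  by near=> y; apply: fg; near: y; exact: open_nbhs_nbhs.
have nfg x : A x -> \near x, f x = g x.
  by move=> Ax; near=> y; apply: fg; near: y; exact: open_nbhs_nbhs.
split.
  move=> x Ax; rewrite /prop_for /continuous_at -(fg x Ax).
  by apply: cvg_trans (cf x Ax); apply: near_eq_cvg; exact: nfg.
move=> v; have [dfv Cf] := df v; split.
  by move=> x Ax; apply: near_eq_derivable (dfv x Ax); exact: nfg.
by apply: IH Cf => x Ax; apply: near_eq_derive; exact: nfg.
Unshelve. all: by end_near. Qed.

Lemma Ck_cst W k A (w : W) : Ck k A (fun=> w).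
Proof.
elim: k w => [|k IH] w.
  by split=> // x _; exact: cst_continuous.
split=> [x _|v]; first exact: cst_continuous.
split; first by move=> x _; exact: derivable_cst.
by rewrite (_ : 'D_v _ = fun=> 0) //; apply/funext => x; exact: derive_cst.
Qed.

Lemma Ck_add W k A (f g : V -> W) : open A ->
  Ck k A f -> Ck k A g -> Ck k A (fun x => f x + g x).
Proof.
move=> oA; elim: k f g => [|k IH] f g [cf df] [cg dg]; split=> //.
- by move=> x Ax; apply: cvgD; [exact: cf|exact: cg].
- by move=> x Ax; apply: cvgD; [exact: cf|exact: cg].
- move=> v; have [dfv Df] := df v; have [dgv Dg] := dg v; split.
    by move=> x Ax; apply: derivableD; [exact: dfv|exact: dgv].
  apply: Ck_eq (IH _ _ Df Dg) => // x Ax.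
  by rewrite [RHS]deriveD//; [exact: dfv|exact: dgv].
Qed.

Lemma Ck_scale W k A (f : V -> R) (g : V -> W) : open A ->
  Ck k A f -> Ck k A g -> Ck k A (fun x => f x *: g x).
Proof.
move=> oA; elim: k f g => [|k IH] f g Cf Cg.
  by split=> // x Ax; apply: cvgZ; [exact: (Ck_continuous Cf Ax)|exact: (Ck_continuous Cg Ax)].
split.
  by move=> x Ax; apply: cvgZ; [exact: (Ck_continuous Cf Ax)|exact: (Ck_continuous Cg Ax)].
move=> v.
have dfg x : A x -> is_derive x v (fun x => f x *: g x)
    ('D_v f x *: g x + f x *: 'D_v g x).
  move=> Ax; have dfx := Ck_derivable v Cf Ax; have dgx := Ck_derivable v Cg Ax.
  suff H : (fun h => h^-1 *: (f (h *: v + x) *: g (h *: v + x) - f x *: g x))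
      @ 0^' --> 'D_v f x *: g x + f x *: 'D_v g x.
    by apply: DeriveDef; [apply/cvg_ex; eexists; exact: H|exact: cvg_lim H].
  have -> : (fun h => h^-1 *: (f (h *: v + x) *: g (h *: v + x) - f x *: g x)) =
    (fun h => (h^-1 *: (f (h *: v + x) - f x)) *: g x +
       f (h *: v + x) *: (h^-1 *: (g (h *: v + x) - g x))).
    apply/funext => h; rewrite -[X in _ = X + _]scalerA.
    rewrite [X in _ = _ + X]scalerA [f _ * _]mulrC -[X in _ = _ + X]scalerA.
    rewrite -scalerDr; congr (_ *: _).
    by rewrite scalerBl scalerBr [RHS]addrC addrA subrK.
  apply: cvgD; first by apply: cvgZ; [exact: dfx|exact: cvg_cst].
  apply: cvgZ; last exact: dgx.
  suff : {for 0, continuous (fun h : R => f (h *: v + x))}.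
    by move=> /continuous_withinNx; rewrite scale0r add0r.
  exact/differentiable_continuous/derivable1_diffP/(derivable1P _ _ _).1.
split; first by move=> x Ax; have [] := dfg x Ax.
apply: (@Ck_eq _ _ _ (fun x => 'D_v f x *: g x + f x *: 'D_v g x)) => //.
  by move=> x Ax; have [_ ->] := dfg x Ax.
apply: Ck_add => //; apply: IH; try exact: Ck_derive; exact: CkS.
Qed.

Lemma Ck_mul k A (f g : V -> R) : open A ->
  Ck k A f -> Ck k A g -> Ck k A (fun x => f x * g x).
Proof. exact: Ck_scale. Qed.

Lemma Ck_opp W k A (f : V -> W) : open A -> Ck k A f -> Ck k A (fun x => - f x).
Proof.
move=> oA Cf.
apply: (@Ck_eq _ _ _ (fun x => (-1 : R) *: f x)) => //.
  by move=> x _; rewrite scaleN1r.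
by apply: Ck_scale => //; exact: Ck_cst.
Qed.

Lemma Ck_sum W k A n (f : 'I_n -> V -> W) : open A ->
  (forall i, Ck k A (f i)) -> Ck k A (fun x => \sum_i f i x).
Proof.
move=> oA; elim: n f => [|n IH] f Cf.
  apply: (Ck_eq oA _ (Ck_cst k A (0 : W))) => x _.
  by rewrite big_ord0.
have Cs := Ck_add oA (IH _ (fun i => Cf (widen_ord (leqnSn n) i))) (Cf ord_max).
by apply: (Ck_eq oA _ Cs) => x _; rewrite big_ord_recr.
Qed.

Lemma Ck_inv k A (f : V -> R) : open A -> (forall x, A x -> f x != 0) ->
  Ck k A f -> Ck k A (fun x => (f x)^-1).
Proof.
move=> oA f0; elim: k => [|k IH] Cf.
  by split=> // x Ax; apply: cvgV; [exact: f0|exact: (Ck_continuous Cf Ax)].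
split.
  by move=> x Ax; apply: cvgV; [exact: f0|exact: (Ck_continuous Cf Ax)].
move=> v; split.
  by move=> x Ax; apply: derivableV; [exact: f0|exact: (Ck_derivable _ Cf Ax)].
have Ci := IH (CkS Cf).
apply: (Ck_eq oA _ (Ck_opp oA (Ck_mul oA (Ck_mul oA Ci Ci) (Ck_derive v Cf)))).
move=> x Ax; rewrite [RHS]deriveV; [|exact: f0|exact: (Ck_derivable _ Cf Ax)].
by rewrite -[_ *: _]/(_ * _) -exprVn expr2 mulNr.
Qed.

Lemma is_derive_sqrt (f : V -> R) x v : 0 < f x -> derivable f x v ->
  is_derive x v (fun x => Num.sqrt (f x)) ((2 * Num.sqrt (f x))^-1 * 'D_v f x).
Proof.
move=> fx0 /derivable1P dfx.
have H : is_derive (0 : R) (1 : R) (Num.sqrt \o (fun h : R => f (h *: v + x)))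
   ((2 * Num.sqrt (f x))^-1 * 'D_v f x).
  have fE : f (0 *: v + x) = f x by rewrite scale0r add0r.
  have ds := is_derive1_sqrt fx0.
  apply: DeriveDef.
    apply/derivable1_diffP/differentiable_comp; first exact/derivable1_diffP.
    by rewrite /= fE; apply/derivable1_diffP; case: ds.
  rewrite -derive1E (derive1_comp dfx); last by rewrite fE; case: ds.
  by rewrite /= fE !derive1E derive_line; case: ds => _ ->.
exact: is_derive_line H.
Qed.

Lemma Ck_sqrt k A (f : V -> R) : open A -> (forall x, A x -> 0 < f x) ->
  Ck k A f -> Ck k A (fun x => Num.sqrt (f x)).
Proof.
move=> oA f0; have s0 x : A x -> 2 * Num.sqrt (f x) != 0.
  by move=> Ax; rewrite mulf_neq0// ?pnatr_eq0// sqrtr_eq0 -ltNge f0.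
elim: k => [|k IH] Cf.
  split=> // x Ax; apply: (@continuous_comp _ _ _ f Num.sqrt).
    exact: (Ck_continuous Cf Ax).
  exact: sqrt_continuous.
split.
  move=> x Ax; apply: (@continuous_comp _ _ _ f Num.sqrt).
    exact: (Ck_continuous Cf Ax).
  exact: sqrt_continuous.
move=> v; split.
  by move=> x Ax; have [] := is_derive_sqrt (f0 x Ax) (Ck_derivable v Cf Ax).
have C2 := Ck_mul oA (Ck_cst k A (2 : R)) (IH (CkS Cf)).
apply: (Ck_eq oA _ (Ck_mul oA (Ck_inv oA s0 C2) (Ck_derive v Cf))).
by move=> x Ax; have [_ ->] := is_derive_sqrt (f0 x Ax) (Ck_derivable v Cf Ax).
Qed.

(** Vector-valued statements are reduced to real-valued ones through this. *)
Lemma Ck_row k A n (f : V -> 'rV[R]_n) : open A ->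
  Ck k A f <-> forall j, Ck k A (fun x => f x 0 j).
Proof.
move=> oA; elim: k f => [|k IH] f.
  split=> [[cf _] j|Cf]; split => // x Ax.
    apply: (@continuous_comp _ _ _ f (fun M : 'rV_n => M 0 j)); first exact: cf.
    exact: coord_continuous.
  apply/cvgrPdist_le => e e0; near=> y; rewrite [leLHS]mx_normrE.
  apply: (bigmax_le _ (ltW e0)) => /= -[i j] _; rewrite !mxE/= ord1.
  move: j; near: y; apply: filter_forall => j.
  by have [/(_ x Ax)/cvgrPdist_le/(_ e e0) + _] := Cf j.
have Dj v x j : derivable f x v -> 'D_v f x 0 j = 'D_v (fun x => f x 0 j) x.
  by move=> dfx; rewrite derive_mx// mxE.
split=> [[cf df] j|Cf].
  split.
    move=> x Ax; apply: (@continuous_comp _ _ _ f (fun M : 'rV_n => M 0 j)).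
      exact: cf.
    exact: coord_continuous.
  move=> v; have [dfv Df] := df v.
  split; first by move=> x Ax; exact: ((derivable_mxP _ _ _).1 (dfv x Ax)).
  apply: (Ck_eq oA _ ((IH _).1 Df j)) => x Ax.
  by rewrite Dj//; exact: dfv.
have df v x : A x -> derivable f x v.
  move=> Ax; apply: (derivable_mxP _ _ _).2 => i j; rewrite ord1.
  exact: (Ck_derivable _ (Cf j) Ax).
split.
  have C := (IH f).2 (fun j => CkS (Cf j)).
  by move=> x Ax; exact: (Ck_continuous C Ax).
move=> v; split; first by move=> x; exact: df.
apply/IH => j; apply: (Ck_eq oA _ (Ck_derive v (Cf j))) => x Ax.
by rewrite Dj//; exact: df.
Unshelve. all: by end_near. Qed.

End CkCalculus.
Arguments Ck_continuous {R V W k A f x} _ _.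
Arguments Ck_derivable {R V W k A f x} v _ _.

Lemma Ck_comp1 {R : realType} {V : normedModType R} (W : normedModType R) k (A : set V) (B : set R) (f : V -> R) (g : R -> W) : open A ->
  (forall x, A x -> B (f x)) -> Ck k A f -> Ck k B g -> Ck k A (g \o f).
Proof.
move=> oA AB; elim: k f g AB => [|k IH] f g AB Cf Cg.
  split=> // x Ax; apply: continuous_comp; first exact: (Ck_continuous Cf Ax).
  exact: (Ck_continuous Cg (AB _ Ax)).
have dgf v x : A x -> is_derive x v (g \o f) ('D_v f x *: 'D_1 g (f x)).
  move=> Ax; have /derivable1P dfx := Ck_derivable v Cf Ax.
  have dgx := Ck_derivable (1 : R) Cg (AB _ Ax).
  have fE : f (0 *: v + x) = f x by rewrite scale0r add0r.
  have /derivable1_diffP Df := dfx.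
  have Dg : differentiable g (f (0 *: v + x)) by rewrite fE; apply/derivable1_diffP.
  have H1 : differentiable (g \o (fun h : R => f (h *: v + x))) 0.
    exact: differentiable_comp.
  apply: is_derive_line; apply: DeriveDef; first exact/derivable1_diffP.
  rewrite -derive1E [LHS](derive1E' H1) (diff_comp Df Dg) /= (deriv1E dfx).
  by rewrite deriv1E ?fE// scale1r !derive1E derive_line.
split.
  move=> x Ax; apply: continuous_comp; first exact: (Ck_continuous Cf Ax).
  exact: (Ck_continuous Cg (AB _ Ax)).
move=> v; split; first by move=> x Ax; have [] := dgf v x Ax.
have C1 := IH _ _ AB (CkS Cf) (Ck_derive (1 : R) Cg).
apply: (Ck_eq oA _ (Ck_scale oA (Ck_derive v Cf) C1)).
by move=> x Ax; have [_ ->] := dgf v x Ax.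
Qed.

Section Lines.
Context {R : realType} {V : normedModType R}.
Implicit Types (A B : set V).

Lemma near_continuous (W : normedModType R) (f : V -> W) x (e : R) :
  {for x, continuous f} -> 0 < e -> \forall z \near x, `|f x - f z| <= e.
Proof. by move=> /cvgrPdist_le; apply. Qed.

Lemma is_derive_quotient (W : normedModType R) (f : V -> W) x v (l : W) :
  (fun h : R => h^-1 *: (f (h *: v + x) - f x)) @ 0^' --> l -> is_derive x v f l.
Proof.
by move=> H; apply: DeriveDef; [apply/cvg_ex; exists l; exact: H|exact: cvg_lim H].
Qed.

Lemma is_derive_cast (W : normedModType R) (f : V -> W) x v (d e : W) :
  is_derive x v f d -> d = e -> is_derive x v f e.
Proof. by move=> H <-. Qed.

Lemma is_derive_on_line (W : normedModType R) (f : V -> W) (x v : V) (s : R) :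
  derivable f (s *: v + x) v ->
  is_derive s (1 : R) (fun s : R => f (s *: v + x)) ('D_v f (s *: v + x)).
Proof.
move=> df.
have E : (fun h : R => f ((h *: 1%R + s) *: v + x)) =
    (fun h : R => f (h *: v + (s *: v + x))).
  by apply/funext => h; rewrite scalerDl addrA [_%:A]mulr1.
apply: is_derive_line; rewrite E; apply: DeriveDef; last exact: derive_line.
exact: (derivable1P _ _ _).1.
Qed.

(** The bound is on the absolute value of the parameter, so that negative
    steps are covered. *)
Lemma MVT_line A (f : V -> R) (x v : V) (k : R) : Ck 1 A f ->
  (forall s, `|s| <= `|k| -> A (s *: v + x)) ->
  exists2 c : R, `|c| <= `|k| & f (k *: v + x) - f x = k * 'D_v f (c *: v + x).
Proof.
move=> Cf Ak.
have D s : `|s| <= `|k| ->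
  is_derive s (1 : R) (fun s : R => f (s *: v + x)) ('D_v f (s *: v + x)).
  by move=> sk; apply: is_derive_on_line; exact: (Ck_derivable _ Cf (Ak _ sk)).
have C (i : interval R) : {in i, forall s, `|s| <= `|k|} ->
    {within [set` i], continuous (fun s : R => f (s *: v + x))}.
  move=> H; apply: derivable_within_continuous => s /H /D [] //.
have f0 : f x = f (0 *: v + x) by rewrite scale0r add0r.
have [k0|k0|k0] := ltgtP k 0.
- have H s : s \in `[k, 0] -> `|s| <= `|k|.
    rewrite in_itv/= => /andP[ks s0]; rewrite !ler0_norm ?lerN2//; exact: ltW.
  have [||c ck E] := @MVT _ (fun s : R => f (s *: v + x))
      (fun s => 'D_v f (s *: v + x)) _ _ k0; last 1 first.
  - exists c; first by apply: H; exact: subset_itv_oo_cc.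
    by rewrite f0 -opprB E sub0r mulrN opprK mulrC.
  - by move=> s sk; apply/D/H; exact: subset_itv_oo_cc.
  - exact: C.
- have H s : s \in `[0, k] -> `|s| <= `|k|.
    by rewrite in_itv/= => /andP[s0 ks]; rewrite !ger0_norm// ltW.
  have [||c ck E] := @MVT _ (fun s : R => f (s *: v + x))
      (fun s => 'D_v f (s *: v + x)) _ _ k0; last 1 first.
  - exists c; first by apply: H; exact: subset_itv_oo_cc.
    by rewrite f0 E subr0 mulrC.
  - by move=> s sk; apply/D/H; exact: subset_itv_oo_cc.
  - exact: C.
- by exists 0; rewrite ?k0 ?normr0 ?mul0r// -f0 subrr.
Qed.

(** The classical proof: two applications of the mean value theorem, in either
    order, to the second difference of f over a small parallelogram. *)
Lemma schwarz A (f : V -> R) (x v w : V) : open A -> A x -> Ck 2 A f ->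
  'D_v ('D_w f) x = 'D_w ('D_v f) x.
Proof.
move=> oA Ax Cf; apply/eqP; rewrite -subr_eq0 -normr_le0; apply/ler_addgt0Pl => e e0.
rewrite addr0.
have e2 : 0 < e / 2 by rewrite divr_gt0.
have tri (p q r : R) : `|p - r| <= e / 2 -> `|q - r| <= e / 2 -> `|p - q| <= e.
  move=> pr qr; have -> : p - q = p - r - (q - r) by rewrite opprB addrA subrK.
  by apply: le_trans (ler_normB _ _) _; rewrite (splitr e); exact: lerD pr qr.
have c1 := Ck_continuous (Ck_derive v (Ck_derive w Cf)) Ax.
have c2 := Ck_continuous (Ck_derive w (Ck_derive v Cf)) Ax.
have [d d0 Hd] : exists2 d : R, 0 < d & forall z : V, `|z - x| < d ->
   [/\ A z, `|'D_v ('D_w f) x - 'D_v ('D_w f) z| <= e / 2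
    & `|'D_w ('D_v f) x - 'D_w ('D_v f) z| <= e / 2].
  have : \forall z \near x, [/\ A z, `|'D_v ('D_w f) x - 'D_v ('D_w f) z| <= e / 2
    & `|'D_w ('D_v f) x - 'D_w ('D_v f) z| <= e / 2].
    have nA : \forall z \near x, A z by exact: open_nbhs_nbhs.
    apply: filterS3 nA (near_continuous c1 e2) (near_continuous c2 e2).
    move=> z Az z1 z2; exact: (And3 Az z1 z2).
  move=> /nbhs_ballP[d d0 H]; exists d => // z zx; apply: H.
  by rewrite -ball_normE /ball_/= distrC.
pose h := d / 2 / (`|v| + `|w| + 1).
have n0 : 0 < `|v| + `|w| + 1 by rewrite ltr_wpDl// addr_ge0.
have h0 : 0 < h by rewrite !divr_gt0.
have B (a b : R) : `|a| <= `|h| -> `|b| <= `|h| ->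
    `|b *: w + (a *: v + x) - x| < d.
  rewrite !(ger0_norm (ltW h0)) => ah bh; rewrite addrA addrK.
  rewrite (le_lt_trans (ler_normD _ _))// !normrZ.
  have : `|b| * `|w| + `|a| * `|v| <= h * (`|v| + `|w| + 1).
    rewrite !mulrDr mulr1 addrC; apply: ler_wpDr; first exact: ltW.
    by apply: lerD; apply: ler_wpM2r.
  move=> /le_lt_trans; apply; rewrite /h divfK ?gt_eqF// ltr_pdivrMr// mulr_natr.
  by rewrite mulr2n ltrDl.
have nh : `|h| <= `|h| by [].
have nz : `|0 : R| <= `|h| by rewrite normr0.
have Q (a b : V) (g := fun y => f (h *: b + y) - f y) :
   (forall s t : R, `|s| <= `|h| -> `|t| <= `|h| -> A (t *: b + (s *: a + x))) ->
   exists s t : R, [/\ `|s| <= `|h|, `|t| <= `|h| &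
   g (h *: a + x) - g x = h * (h * 'D_b ('D_a f) (t *: b + (s *: a + x)))].
  move=> AA.
  pose G := fun s : R => g (s *: a + x).
  have DG s : `|s| <= `|h| -> is_derive s (1 : R) G
      ('D_a f (h *: b + (s *: a + x)) - 'D_a f (s *: a + x)).
    move=> sh.
    have D1 : is_derive s (1 : R) (fun s : R => f (s *: a + (h *: b + x)))
        ('D_a f (s *: a + (h *: b + x))).
      apply/is_derive_on_line/(Ck_derivable _ Cf).
      by rewrite addrCA; exact: AA.
    have D2 : is_derive s (1 : R) (fun s : R => f (s *: a + x)) ('D_a f (s *: a + x)).
      apply/is_derive_on_line/(Ck_derivable _ Cf).
      by have := AA s 0 sh nz; rewrite scale0r add0r.
    rewrite addrCA (_ : G = (fun s : R => f (s *: a + (h *: b + x))) -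
       (fun s : R => f (s *: a + x))).
      exact: is_deriveB.
    by apply/funext => r; rewrite /G/g addrCA.
  have Ih s : s \in `[0, h] -> `|s| <= `|h|.
    by rewrite in_itv/= => /andP[s0 sh]; rewrite !ger0_norm// ltW.
  have DGo s (sh : s \in `]0, h[) := DG s (Ih _ (subset_itv_oo_cc sh)).
  have cG : {within `[0, h], continuous G}.
    by apply: derivable_within_continuous => s /Ih /DG [].
  have [s sh E] := MVT h0 DGo cG.
  have {}sh := Ih _ (subset_itv_oo_cc sh).
  have [|t th E'] := @MVT_line A ('D_a f) (s *: a + x) b h (Ck_derive a Cf).
    by move=> t th; exact: AA.
  exists s, t; split; [exact: sh|exact: th|].
  by rewrite -E' mulrC -[h in _ * h]subr0 -E /G scale0r add0r.
have [s1 [t1 [s1h t1h E1]]] := Q v w (fun s t sh th => let: And3 H _ _ := Hd _ (B s t sh th) in H).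
have [|s2 [t2 [s2h t2h E2]]] := Q w v.
  by move=> s t sh th; rewrite addrCA; have [] := Hd _ (B t s th sh).
have : h * (h * 'D_w ('D_v f) (t1 *: w + (s1 *: v + x))) =
       h * (h * 'D_v ('D_w f) (t2 *: v + (s2 *: w + x))).
  apply: etrans (esym E1) _; apply: etrans E2.
  rewrite (addrCA (h *: v) (h *: w) x).
  move: (f _) (f (h *: v + x)) (f (h *: w + x)) (f x) => p q r t; ring.
move=> /(mulfI (lt0r_neq0 h0)) /(mulfI (lt0r_neq0 h0)) E.
have [_ _ H1] := Hd _ (B _ _ s1h t1h).
have [_ H2 _] := Hd _ (B _ _ t2h s2h).
rewrite [t2 *: v + _]addrCA in E; rewrite E in H1.
exact: tri H2 H1.
Qed.
End Lines.

Section Plane.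
Context {R : realType}.
Implicit Types (A B : set (R * R)).

Lemma near_box (P : set (R * R)) (x : R * R) : (\forall z \near x, P z) ->
  exists2 d : R, 0 < d & forall z, `|z.1 - x.1| < d -> `|z.2 - x.2| < d -> P z.
Proof.
move=> /nbhs_ballP[d d0 H]; exists d => // z z1 z2; apply: H; split => /=.
  by rewrite -ball_normE /ball_/= distrC.
by rewrite -ball_normE /ball_/= distrC.
Qed.

Lemma box_near (P : set (R * R)) (x : R * R) (d : R) : 0 < d ->
  (forall z, `|z.1 - x.1| < d -> `|z.2 - x.2| < d -> P z) -> \forall z \near x, P z.
Proof.
move=> d0 H; apply/nbhs_ballP; exists d => // z [].
rewrite -!ball_normE /ball_/= => z1 z2.
by apply: H; rewrite distrC.
Qed.

(** Hadamard's form of differentiability: the coefficients are difference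
    quotients, given by the mean value theorem. The chain rule is deduced from
    it. *)
Lemma shift_quotient A (f : R * R -> R) (x : R * R) : open A -> A x -> Ck 1 A f ->
  exists a b : R * R -> R, [/\ {for x, continuous a}, {for x, continuous b},
   a x = 'D_(1, 0) f x, b x = 'D_(0, 1) f x &
   \forall y \near x, f y - f x = a y * (y.1 - x.1) + b y * (y.2 - x.2)].
Proof.
move=> oA Ax Cf.
have c1 := Ck_continuous (Ck_derive ((1, 0) : R * R) Cf) Ax.
have c2 := Ck_continuous (Ck_derive ((0, 1) : R * R) Cf) Ax.
have nA : \forall z \near x, A z by exact: open_nbhs_nbhs.
have [d0 d00 Ad0] := near_box nA.
pose a (y : R * R) : R := if y.1 == x.1 then 'D_(1, 0) f x else (f y - f (x.1, y.2)) / (y.1 - x.1).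
pose b (y : R * R) : R := if y.2 == x.2 then 'D_(0, 1) f x
  else (f (x.1, y.2) - f x) / (y.2 - x.2).
have aM (y : R * R) : `|y.1 - x.1| < d0 -> `|y.2 - x.2| < d0 -> y.1 != x.1 ->
    exists2 c, `|c| <= `|y.1 - x.1| & a y = 'D_(1, 0) f (c + x.1, y.2).
  move=> y1 y2 yx; have [|c cy E] := @MVT_line _ _ A f (x.1, y.2) (1, 0) (y.1 - x.1) Cf.
    move=> s sy; apply: Ad0; rewrite /=.
      by rewrite [s *: _]mulr1 addrK (le_lt_trans sy).
    by rewrite [s *: _]mulr0 add0r.
  have e1 t : t *: (1 : R, 0 : R) + (x.1, y.2) = (t + x.1, y.2).
    by congr (_, _); rewrite /= ?[_ *: _]mulr1// [_ *: _]mulr0 add0r.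
  exists c => //; rewrite /a (negbTE yx).
  have yE : (y.1 - x.1) *: (1 : R, 0 : R) + (x.1, y.2) = y.
    by rewrite e1 subrK; case: (y).
  rewrite -[X in f X - _]yE E e1 mulrC mulKf// subr_eq0//.
have bM (y : R * R) : `|y.2 - x.2| < d0 -> y.2 != x.2 ->
    exists2 c, `|c| <= `|y.2 - x.2| & b y = 'D_(0, 1) f (x.1, c + x.2).
  move=> y2 yx; have [|c cy E] := @MVT_line _ _ A f x (0, 1) (y.2 - x.2) Cf.
    move=> s sy; apply: Ad0; rewrite /=.
      by rewrite [s *: _]mulr0 add0r subrr normr0.
    by rewrite [s *: _]mulr1 addrK (le_lt_trans sy).
  have e1 t : t *: (0 : R, 1 : R) + x = (x.1, t + x.2).
    by congr (_, _); rewrite /= ?[_ *: _]mulr1// [_ *: _]mulr0 add0r.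
  exists c => //; rewrite /b (negbTE yx).
  have yE : (y.2 - x.2) *: (0 : R, 1 : R) + x = (x.1, y.2) by rewrite e1 subrK.
  rewrite -[X in f X - _]yE E e1 mulrC mulKf// subr_eq0//.
have aE : a x = 'D_(1, 0) f x by rewrite /a eqxx.
have bE : b x = 'D_(0, 1) f x by rewrite /b eqxx.
exists a, b; split; [| |exact: aE|exact: bE|].
- apply/cvgrPdist_le => e e0.
  have [d1 d10 H1] := near_box (near_continuous c1 e0).
  have dm : 0 < Num.min d0 d1 by rewrite lt_min d00.
  apply: (box_near dm) => z; rewrite !lt_min => /andP[z10 z11] /andP[z20 z21].
  rewrite aE; have [zx|zx] := eqVneq z.1 x.1.
    by rewrite /a zx eqxx subrr normr0 ltW.
  have [c cz ->] := aM z z10 z20 zx; apply: H1 => //=.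
  by rewrite addrK (le_lt_trans cz).
- apply/cvgrPdist_le => e e0.
  have [d1 d10 H1] := near_box (near_continuous c2 e0).
  have dm : 0 < Num.min d0 d1 by rewrite lt_min d00.
  apply: (box_near dm) => z; rewrite !lt_min => /andP[z10 z11] /andP[z20 z21].
  rewrite bE; have [zx|zx] := eqVneq z.2 x.2.
    by rewrite /b zx eqxx subrr normr0 ltW.
  have [c cz ->] := bM z z20 zx; apply: H1 => /=; first by rewrite subrr normr0.
  by rewrite addrK (le_lt_trans cz).
- apply: (box_near d00) => y y1 y2; rewrite /a /b.
  have [y1x|y1x] := eqVneq y.1 x.1; have [y2x|y2x] := eqVneq y.2 x.2.
  + by rewrite y1x y2x !subrr !mulr0 addr0 (_ : y = x) ?subrr// [y]surjective_pairing
      [x]surjective_pairing y1x y2x.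
  + by rewrite divfK ?subr_eq0// -[in X in _ = _ + (f X - _)]y1x y1x subrr mulr0 add0r
     -y1x -surjective_pairing.
  + rewrite y2x divfK ?subr_eq0// subrr mulr0 addr0.
    by rewrite -surjective_pairing.
  + by rewrite !divfK ?subr_eq0// addrA subrK.
Qed.

Lemma is_derive_comp2 A (U : normedModType R) (t : U -> R * R) (f : R * R -> R)
    (y v : U) (d1 d2 : R) : open A -> A (t y) -> Ck 1 A f ->
  is_derive y v (fun z => (t z).1) d1 -> is_derive y v (fun z => (t z).2) d2 ->
  is_derive y v (f \o t) (d1 * 'D_(1, 0) f (t y) + d2 * 'D_(0, 1) f (t y)).
Proof.
move=> oA At Cf [D1 E1] [D2 E2].
have [a [b [ca cb aE bE ab]]] := shift_quotient oA At Cf.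
pose q (g : U -> R) := fun h : R => h^-1 *: (g (h *: v + y) - g y).
have tc : (fun h : R => t (h *: v + y)) @ 0^' --> t y.
  have L (g : U -> R) : derivable g y v -> (fun h : R => g (h *: v + y)) @ 0^' --> g y.
    move=> dg; suff : {for 0, continuous (fun h : R => g (h *: v + y))}.
      by move=> /continuous_withinNx; rewrite scale0r add0r.
    exact/differentiable_continuous/derivable1_diffP/(derivable1P _ _ _).1.
  rewrite [t y]surjective_pairing.
  rewrite (_ : (fun h : R => t (h *: v + y)) =
    (fun h : R => ((t (h *: v + y)).1, (t (h *: v + y)).2))).
    exact: (cvg_pair (L _ D1) (L _ D2)).
  by apply/funext => h; rewrite -surjective_pairing.
have H : q (f \o t) @ 0^' --> d1 * 'D_(1, 0) f (t y) + d2 * 'D_(0, 1) f (t y).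
  have H' : (fun h : R => q (fun z => (t z).1) h * a (t (h *: v + y)) +
     q (fun z => (t z).2) h * b (t (h *: v + y))) @ 0^' -->
     d1 * 'D_(1, 0) f (t y) + d2 * 'D_(0, 1) f (t y).
    rewrite -aE -bE; apply: cvgD; apply: cvgM.
    - by rewrite -E1; exact: D1.
    - exact: (cvg_comp _ _ tc ca).
    - by rewrite -E2; exact: D2.
    - exact: (cvg_comp _ _ tc cb).
  apply: cvg_trans H'; apply: near_eq_cvg.
  have ab' : \forall h \near (0 : R)^', f (t (h *: v + y)) - f (t y) =
      a (t (h *: v + y)) * ((t (h *: v + y)).1 - (t y).1) +
      b (t (h *: v + y)) * ((t (h *: v + y)).2 - (t y).2) by exact: (tc _ ab).
  apply: filterS ab' => h hE.
  rewrite /q /= hE -![_ *: (_ : R)]/(_ * _); ring.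
exact: is_derive_quotient H.
Qed.

(** Linearity of the derivative in the direction is not part of the definition
    of class C^1, which asks for each directional derivative separately; it
    follows from the chain rule applied to a line. *)
Lemma derive_plane A (f : R * R -> R) (x v : R * R) : open A -> A x -> Ck 1 A f ->
  'D_v f x = v.1 * 'D_(1, 0) f x + v.2 * 'D_(0, 1) f x.
Proof.
move=> oA Ax Cf.
have D (g : R * R -> R) : (forall h, g (h *: v + x) - g x = h * g v) ->
    is_derive x v g (g v).
  move=> gl; apply: is_derive_quotient.
  apply: (@cvg_trans _ ((fun=> g v) @ (0 : R)^')); last exact: cvg_cst.
  apply: near_eq_cvg; near=> h.
  rewrite gl -[_ *: _]/(_ * _) mulKf//; near: h; exact: nbhs_dnbhs_neq.
have D1 : is_derive x v (fun z => (id z).1) v.1 by apply: (D fst) => h; rewrite addrK.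
have D2 : is_derive x v (fun z => (id z).2) v.2 by apply: (D snd) => h; rewrite addrK.
by have [_ ->] := is_derive_comp2 oA Ax Cf D1 D2.
Unshelve. all: by end_near. Qed.

Lemma derive_planeV A n (f : R * R -> 'rV[R]_n) (x v : R * R) :
  open A -> A x -> Ck 1 A f ->
  'D_v f x = v.1 *: 'D_(1, 0) f x + v.2 *: 'D_(0, 1) f x.
Proof.
move=> oA Ax Cf; have Cj j := (Ck_row _ _ oA).1 Cf j.
have df w : derivable f x w by exact: (Ck_derivable _ Cf Ax).
apply/rowP => j; rewrite (derive_mx (df v)) (derive_mx (df ((1, 0) : R * R))).
rewrite (derive_mx (df ((0, 1) : R * R))) !mxE; exact: derive_plane oA Ax (Cj j).
Qed.

Lemma derive_comp_plane A (U : normedModType R) n (t : U -> R * R)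
    (f : R * R -> 'rV[R]_n) (y v : U) : open A -> A (t y) -> Ck 1 A f ->
  derivable t y v ->
  derivable (f \o t) y v /\ 'D_v (f \o t) y = 'D_('D_v t y) f (t y).
Proof.
move=> oA At Cf dt; have Cj j := (Ck_row _ _ oA).1 Cf j.
have df w : derivable f (t y) w by exact: (Ck_derivable _ Cf At).
have D1 : is_derive y v (fun z => (t z).1) ('D_v t y).1.
  have H : (fun h : R => h^-1 *: ((t (h *: v + y)).1 - (t y).1)) @ 0^' --> ('D_v t y).1.
    exact: (cvg_comp _ _ dt (@cvg_fst _ _ _ _ _)).
  exact: is_derive_quotient H.
have D2 : is_derive y v (fun z => (t z).2) ('D_v t y).2.
  have H : (fun h : R => h^-1 *: ((t (h *: v + y)).2 - (t y).2)) @ 0^' --> ('D_v t y).2.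
    exact: (cvg_comp _ _ dt (@cvg_snd _ _ _ _ _)).
  exact: is_derive_quotient H.
have H j := is_derive_comp2 oA At (Cj j) D1 D2.
have dft : derivable (f \o t) y v.
  by apply: (derivable_mxP _ _ _).2 => i j; rewrite ord1; have [] := H j.
split => //; apply/rowP => j; rewrite (derive_mx dft) (derive_mx (df ('D_v t y))) !mxE.
have [_ E] := H j; rewrite [LHS]E; exact: esym (derive_plane _ oA At (Cj j)).
Qed.

End Plane.

(** * A flat function *)

Section Bump.
Context {R : realType}.

Lemma is_derive_R (g : R -> R) (x v d : R) :
  is_derive x (1 : R) g d -> is_derive x v g (v * d).
Proof.
move=> [dg E]; have Dg : differentiable g x by exact/derivable1_diffP.
apply: DeriveDef; first exact: diff_derivable.
by rewrite deriveE// deriv1E// derive1E E.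
Qed.

(** The factor x^-n makes the family stable under differentiation, so that
    smoothness is an induction on k for all n at once. *)
Definition flat_exp (n : nat) (x : R) : R :=
  if 0 < x then x^-1 ^+ n * expR (- x^-1) else 0.

(** From x^n / n! <= exp x at 1/x; it gives differentiability at 0. *)
Lemma flat_exp_le n (x : R) : `|flat_exp n x| <= n.+1`!%:R * `|x|.
Proof.
rewrite /flat_exp; case: ltP => [x0|_]; last by rewrite normr0 mulr_ge0.
have y0 : 0 < x^-1 by rewrite invr_gt0.
rewrite (ger0_norm (ltW x0)) ger0_norm; last first.
  by rewrite mulr_ge0 ?exprn_ge0 ?expR_ge0// ltW.
have H : x^-1 ^+ n.+1 / n.+1`!%:R <= expR x^-1.
  by have := expR_ge1Dxn n (ltW y0); apply: le_trans; rewrite lerDr.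
rewrite expRN ler_pdivrMr ?expR_gt0//.
rewrite ler_pdivrMr ?ltr0n ?fact_gt0// exprS in H.
rewrite -(ler_pM2l y0) (le_trans H)//.
by rewrite [_`!%:R * x]mulrC !mulrA mulVf ?gt_eqF// mul1r mulrC.
Qed.

Lemma flat_expS n x : flat_exp n x = x * flat_exp n.+1 x.
Proof.
rewrite /flat_exp; case: ltP => [x0|_]; last by rewrite mulr0.
by rewrite exprS !mulrA mulfV ?gt_eqF// mul1r.
Qed.

Lemma is_derive_flat_exp n (x : R) : is_derive x (1 : R) (flat_exp n)
  (- (n%:R) * flat_exp n.+1 x + flat_exp n.+2 x).
Proof.
have [x0|x0|->] := ltgtP x 0.
- have H : \near x, 0 = flat_exp n x.
    near=> y; rewrite /flat_exp ltNge ltW//; near: y; exact: lt_nbhsl.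
  apply: (near_eq_is_derive H).
  rewrite /flat_exp [0 < x]ltNge ltW// mulr0 addr0; exact: is_derive_cst.
- have H : \near x, x^-1 ^+ n * expR (- x^-1) = flat_exp n x.
    near=> y; rewrite /flat_exp ifT//; near: y; exact: lt_nbhsr.
  apply: (near_eq_is_derive H).
  have xn0 : x != 0 by rewrite gt_eqF.
  have Di : is_derive x (1 : R) (fun y : R => y^-1) (- (x ^- 2) *: 1).
    exact: is_deriveV.
  have De : is_derive x (1 : R) (fun y : R => expR (- y^-1))
      (x ^- 2 * expR (- x^-1)).
    have D1 : is_derive x (1 : R) (fun y : R => - y^-1) (x ^- 2).
      by apply: is_derive_eq; rewrite [_%:A]mulr1 opprK.
    apply: DeriveDef.
      apply/derivable1_diffP/(differentiable_comp (f := fun y : R => - y^-1)).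
        by apply/derivable1_diffP; case: D1.
      by apply/derivable1_diffP.
    rewrite -derive1E (derive1_comp (f := fun y : R => - y^-1)).
    - by rewrite !derive1E; case: D1 => _ ->; rewrite derive_val mulrC.
    - by case: D1.
    - exact: derivable_expR.
  have Dx : is_derive x (1 : R) (fun y : R => y^-1 ^+ n) (- (n%:R) * x^-1 ^+ n.+1).
    case: (n) => [|m]; first by rewrite oppr0 mul0r; exact: is_derive_cst.
    rewrite (_ : (fun y : R => _) = (fun y : R => y^-1) ^+ m.+1); last first.
      by apply/funext => y; rewrite exprfctE.
    have Dm := is_deriveX m.+1 Di; apply: (is_derive_cast Dm).
    rewrite [X in _ *: X = _]mulr1 -[_ *: _]/(_ * _) /= mulrN mulNr -mulrA.
    by rewrite -exprVn -exprD addnC.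
  have Dp := is_deriveM Dx De; apply: (is_derive_cast Dp).
  rewrite /flat_exp x0 -![_ *: _]/(_ * _) -exprVn !exprS expr0; ring.
- have H : (fun h : R => h^-1 *: (flat_exp n (h *: 1 + 0) - flat_exp n 0)) @ 0^' -->
      - (n%:R) * flat_exp n.+1 0 + flat_exp n.+2 0.
    have z m : flat_exp m 0 = 0 by rewrite /flat_exp ltxx.
    rewrite !z mulr0 addr0.
    apply: (@cvg_trans _ (flat_exp n.+1 @ 0^')).
      apply: near_eq_cvg; near=> h.
      rewrite [_%:A]mulr1 addr0 subr0 [in RHS]flat_expS -[_ *: _]/(_ * _) mulKf//.
      by near: h; exact: nbhs_dnbhs_neq.
    apply/cvgrPdist_le => e e0; near=> h.
    rewrite sub0r normrN (le_trans (flat_exp_le _ _))// -ler_pdivlMl ?ltr0n ?fact_gt0//.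
    near: h; apply: dnbhs0_le; rewrite mulr_gt0// invr_gt0 ltr0n fact_gt0//.
  exact: is_derive_quotient H.
Unshelve. all: by end_near. Qed.

Lemma Ck_flat_exp k n : Ck k setT (flat_exp n).
Proof.
have cf m : continuous (flat_exp m).
  move=> x; apply/differentiable_continuous/derivable1_diffP.
  by have [] := is_derive_flat_exp m x.
elim: k n => [|k IH] n; first by split=> // x _; exact: cf.
split=> [x _|v]; first exact: cf.
have D x := is_derive_R v (is_derive_flat_exp n x).
split; first by move=> x _; have [] := D x.
apply: (@Ck_eq _ _ _ _ _ (fun x => v * (- (n%:R) * flat_exp n.+1 x + flat_exp n.+2 x))).
- exact: openT.
- by move=> x _; have [_ ->] := D x.
- have C c := Ck_cst k [set: R] (c : R).
  apply: (Ck_mul openT (C v)); apply: (Ck_add openT); last exact: IH.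
  exact: (Ck_mul openT (C _) (IH _)).
Qed.

Lemma flat_exp_gt0 x : 0 < x -> 0 < flat_exp 0 x.
Proof. by move=> x0; rewrite /flat_exp x0 mulr_gt0 ?expR_gt0 ?expr0. Qed.

Lemma flat_exp_eq0 n x : x <= 0 -> flat_exp n x = 0.
Proof. by move=> x0; rewrite /flat_exp ltNge x0. Qed.

End Bump.

(** * Integration over rectangles *)

Notation leb2 R := ((@lebesgue_measure R \x @lebesgue_measure R)%E).

Section Rectangles.
Context {R : realType}.

Lemma compact_setX (X Y : topologicalType) (A : set X) (B : set Y) :
  compact A -> compact B -> compact (A `*` B).
Proof.
rewrite !compact_near_coveringP => cA cB I F P FF HP.
pose P' (i : I) (x : X) := forall y, B y -> P i (x, y).
suff : \forall i \near F, A `<=` P' i by apply: filterS => i H [x y] [/= Ax By]; exact: H.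
apply: cA => x Ax.
pose Q (j : X * I) (y : Y) := P j.2 (j.1, y).
have : \forall j \near filter_prod (nbhs x) F, B `<=` Q j.
  apply: cB => y By.
  have [[U W] /= [[[U1 U2] /= [u1 u2] Us] FW] UW] := HP (x, y) (conj Ax By).
  exists (U2, (U1 `*` W)) => //=.
    by split => //; exists (U1, W).
  by move=> [y' [x' i]] /= [U2y [U1x Wi]]; apply: (UW ((x', y'), i)); split => //; apply: Us.
move=> [[U W] [/= Ux FW] UW]; exists (U, W); first by split.
move=> [x' i] [/= Ux' Wi] y By; exact: (UW (x', i) (conj Ux' Wi) y By).
Qed.

Definition rect (a1 b1 a2 b2 : R) : set (R * R) :=
  [set u | a1 <= u.1 <= b1 /\ a2 <= u.2 <= b2].

Lemma rectE a1 b1 a2 b2 : rect a1 b1 a2 b2 = `[a1, b1] `*` `[a2, b2].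
Proof. by apply/seteqP; split => -[x y] []/=; rewrite !in_itv/=. Qed.

Lemma compact_rect a1 b1 a2 b2 : compact (rect a1 b1 a2 b2).
Proof. by rewrite rectE; apply: compact_setX; exact: segment_compact. Qed.

Lemma rect_inside (A : set (R * R)) (z : R * R) : open A -> A z ->
  exists2 d : R, 0 < d & rect (z.1 - d) (z.1 + d) (z.2 - d) (z.2 + d) `<=` A.
Proof.
move=> oA Az; have [d d0 H] := near_box (open_nbhs_nbhs (conj oA Az)).
exists (d / 2); first by rewrite divr_gt0.
have d2 : d / 2 < d by rewrite ltr_pdivrMr// mulr_natr mulr2n ltrDl.
move=> u [/andP[u1 u2] /andP[u3 u4]]; apply: H.
  by rewrite (le_lt_trans _ d2)// ler_distl u1.
by rewrite (le_lt_trans _ d2)// ler_distl u3.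
Qed.

Notation R2 := (measurableTypeR R * measurableTypeR R)%type.
Lemma measurable_rect a1 b1 a2 b2 : measurable (rect a1 b1 a2 b2 : set R2).
Proof. by rewrite rectE; apply: measurableX. Qed.

Lemma leb2_rect a1 b1 a2 b2 : a1 <= b1 -> a2 <= b2 ->
  leb2 R (rect a1 b1 a2 b2) = ((b1 - a1) * (b2 - a2))%:E.
Proof.
move=> ab1 ab2; rewrite rectE product_measure1E// EFinM.
have E (a b : R) : a <= b -> lebesgue_measure (`[a, b] : set R) = (b - a)%:E.
  rewrite lebesgue_measure_itv/= lte_fin.
  by case: ltgtP => // -> _; rewrite subrr.
by congr (_ * _)%E; exact: E.
Qed.

Lemma leb2_rect_fin a1 b1 a2 b2 : (leb2 R (rect a1 b1 a2 b2) < +oo)%E.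
Proof.
rewrite rectE product_measure1E//.
have E (a b : R) : (lebesgue_measure (`[a, b] : set R) < +oo)%E.
  by rewrite lebesgue_measure_itv/=; case: ifP => _; rewrite -?EFinB ltry.
apply: lte_mul_pinfty; [by []| |exact: E].
by rewrite ge0_fin_numE//; exact: E.
Qed.

(** An open set is a countable union of rectangles with rational corners; only
    rectangles are measurable by construction of the product. *)
Lemma open_measurable2 (U : set (R * R)) : open U -> measurable (U : set R2).
Proof.
move=> oU.
pose box (a b c d : rat) : set R2 := `]ratr a, ratr b[ `*` `]ratr c, ratr d[.
pose T (a b c d : rat) : set R2 := if `[< box a b c d `<=` U >] then box a b c d else set0.
have -> : U = \bigcup_a \bigcup_b \bigcup_c \bigcup_d T a b c d.
  apply/seteqP; split => [z Uz|z [a _ [b _ [c _ [d _]]]]]; last first.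
    by rewrite /T; case: asboolP => // + Tz; apply.
  have [e e0 H] := near_box (open_nbhs_nbhs (conj oU Uz)).
  have L (x : R) : x - e < x by rewrite gtrDl oppr_lt0.
  have G (x : R) : x < x + e by rewrite ltrDl.
  have [a /[!in_itv]/andP[a1 a2]] := rat_in_itvoo (L z.1).
  have [b /[!in_itv]/andP[b1 b2]] := rat_in_itvoo (G z.1).
  have [c /[!in_itv]/andP[c1 c2]] := rat_in_itvoo (L z.2).
  have [d /[!in_itv]/andP[d1 d2]] := rat_in_itvoo (G z.2).
  exists a => //; exists b => //; exists c => //; exists d => //.
  rewrite /T ifT; first by split; rewrite /= in_itv/=; apply/andP.
  apply/asboolP => y [/=]; rewrite !in_itv/= => /andP[y1 y2] /andP[y3 y4].
  apply: H; rewrite ltr_distl.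
    by rewrite (lt_trans a1 y1) (lt_trans y2 b2).
  by rewrite (lt_trans c1 y3) (lt_trans y4 d2).
do 4 (apply: bigcupT_measurable_rat => ?); rewrite /T; case: ifP => // _.
exact: measurableX.
Qed.

Lemma measurable_continuous2 (D : set (R * R)) (f : R * R -> R) :
  measurable (D : set R2) -> (forall x, D x -> {for x, continuous f}) ->
  measurable_fun (D : set R2) f.
Proof.
move=> mD cf; apply: (measurability _ (measurable_realfun.RGenOpens.measurableE R)).
move=> _ [_ [a [b ->] <-]].
have -> : D `&` f @^-1` `]a, b[ = D `&` (f @^-1` `]a, b[)^°.
  apply/seteqP; split => x [Dx fx]; split => //; last exact: interior_subset.
  by apply: (cf x Dx); apply: open_nbhs_nbhs; split => //; exact: interval_open.
by apply: measurableI => //; apply: open_measurable2; exact: open_interior.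
Qed.

Lemma bounded_rect a1 b1 a2 b2 (f : R * R -> R) :
  (forall x, rect a1 b1 a2 b2 x -> {for x, continuous f}) ->
  exists M : R, forall x, rect a1 b1 a2 b2 x -> `|f x| <= M.
Proof.
move=> cf.
have /compact_near_coveringP/(_ R (pinfty_nbhs R) (fun M x => `|f x| <= M) _) :=
  @compact_rect a1 b1 a2 b2.
case.
  move=> x /cf cfx.
  exists ([set y | `|f x - f y| <= 1], [set M | `|f x| + 1 < M]) => /=.
    split; first exact: near_continuous cfx ltr01.
    by exists (`|f x| + 1); split => //; exact: num_real.
  move=> [y M] [/= fxy xM]; rewrite (le_trans _ (ltW xM))//.
  rewrite -[f y](subrK (f x)) (le_trans (ler_normD _ _))// addrC lerD2l.
  by rewrite distrC.
move=> M [_ H]; exists (M + 1); apply: H; by rewrite ltrDl.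
Qed.

Lemma integrable_rect a1 b1 a2 b2 (f : R * R -> R) :
  (forall x, rect a1 b1 a2 b2 x -> {for x, continuous f}) ->
  (leb2 R).-integrable (rect a1 b1 a2 b2) (EFin \o f).
Proof.
move=> cf; apply: measurable_bounded_integrable.
- exact: measurable_rect.
- exact: leb2_rect_fin.
- exact: measurable_continuous2 (measurable_rect _ _ _ _) cf.
- have [M HM] := bounded_rect cf; exists M; split; first exact: num_real.
  by move=> N MN x Qx /=; rewrite (le_trans (HM x Qx))// ltW.
Qed.

End Rectangles.

Section Integrals.
Context {R : realType}.

(** Compactness of the rectangle gives one interval of parameters and one
    bound for the derivative that serve all its points. *)
Lemma is_derive_under_integral (O : set (R * (R * R))) (w : R * (R * R) -> R)
    a1 b1 a2 b2 : open O -> Ck 1 O w ->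
  (forall u, rect a1 b1 a2 b2 u -> O (0, u)) ->
  is_derive (0 : R) (1 : R)
    (fun t : R => \int[leb2 R]_(u in rect a1 b1 a2 b2) w (t, u))
    (\int[leb2 R]_(u in rect a1 b1 a2 b2) 'D_((1, 0) : R * (R * R)) w (0, u)).
Proof.
move=> oO Cw QO; set e := (1, 0) : R * (R * R); set Q := rect _ _ _ _.
have [d [M [d0 M0 H]]] : exists d M : R, [/\ 0 < d, 0 <= M & forall t u, `|t| < d -> Q u ->
    O (t, u) /\ `|'D_e w (t, u)| <= M].
  have /compact_near_coveringP/(_ _ (filter_prod (nbhs (0 : R)) (pinfty_nbhs R))
      (fun i u => O (i.1, u) /\ `|'D_e w (i.1, u)| <= i.2) _) := @compact_rect R a1 b1 a2 b2.
  case.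
    move=> u Qu; have c := Ck_continuous (Ck_derive e Cw) (QO _ Qu).
    have := filterI (open_nbhs_nbhs (conj oO (QO _ Qu))) (near_continuous c ltr01).
    move=> [[U1 U2] /= [n1 n2] UO].
    exists (U2, U1 `*` [set M | `|'D_e w (0, u)| + 1 < M]) => /=.
      split => //; exists (U1, [set M | `|'D_e w (0, u)| + 1 < M]) => //=; split => //.
      by exists (`|'D_e w (0, u)| + 1); split => //; exact: num_real.
    move=> [u' [t M]] /= [U2u [U1t uM]].
    have [Otu Dtu] := UO (t, u') (conj U1t U2u).
    split; first exact: Otu.
    rewrite (le_trans _ (ltW uM))//.
    move: Dtu => /=; move: ('D_e w (0, u)) ('D_e w (t, u')) => p q pq.
    by rewrite -[q](subrK p) (le_trans (ler_normD _ _))// addrC lerD2l distrC.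
  move=> [U W] /= [/nbhs_ballP[d d0 Ud] [M [_ WM]]] UW.
  exists d, (`|M| + 1); split; [exact: d0|exact: addr_ge0|].
  move=> t u td Qu; apply: (UW (t, `|M| + 1) _ u Qu); split => /=.
    by apply: Ud; rewrite -ball_normE /ball_/= sub0r normrN.
  by apply: WM; rewrite (le_lt_trans (ler_norm _))// ltrDl.
have D t u : `|t| < d -> Q u ->
    is_derive t (1 : R) (fun t : R => w (t, u)) ('D_e w (t, u)).
  move=> td Qu; have dw : derivable w (t, u) e := Ck_derivable e Cw (H _ _ td Qu).1.
  have eE (h : R) : h *: e + (t, u) = (h *: 1 + t, u).
    by congr (_, _); rewrite /= scaler0 add0r.
  apply: is_derive_quotient.
  rewrite (_ : (fun h : R => _) = fun h : R => h^-1 *: (w (h *: e + (t, u)) - w (t, u))).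
    exact: dw.
  by apply/funext => h; rewrite eE.
have Itv t : `]- d, d[%classic t -> `|t| < d.
  by rewrite /= in_itv/= => /andP[t1 t2]; rewrite ltr_norml t1.
have dd : `]- d, d[%classic 0 by rewrite /= in_itv/= d0 oppr_lt0 d0.
have cw t : `]- d, d[%classic t -> forall u, Q u -> {for u, continuous (fun u => w (t, u))}.
  move=> /Itv td u Qu; apply: (@continuous_comp _ _ _ (fun u => (t, u)) w).
    have c1 : (fun=> t) @ u --> t by exact: cvg_cst.
    have c2 : id @ u --> u by exact: cvg_id.
    exact: (cvg_pair c1 c2).
  exact: (Ck_continuous Cw (H _ _ td Qu).1).
have mQ : measurable (Q : set (measurableTypeR R * measurableTypeR R)).
  exact: measurable_rect.
have intf t : `]- d, d[%classic t -> (leb2 R).-integrable Q (EFin \o (fun u => w (t, u))).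
  by move=> td; apply: integrable_rect => u Qu; exact: cw td u Qu.
have der t u : `]- d, d[%classic t -> Q u -> derivable (fun t => w (t, u)) t 1.
  by move=> td Qu; have [] := D t u (Itv _ td) Qu.
have intM : (leb2 R).-integrable Q (EFin \o (cst M : R * R -> R)).
  by apply: integrable_rect => u _; exact: cst_continuous.
have pE t u : `]- d, d[%classic t -> Q u ->
    partial1of2 (fun t u => w (t, u)) t u = 'D_e w (t, u).
  move=> td Qu; rewrite /partial1of2 derive1E.
  by have [_ ->] := D t u (Itv _ td) Qu.
have bd t u : `]- d, d[%classic t -> Q u ->
    `|partial1of2 (fun t u => w (t, u)) t u| <= cst M u.
  by move=> td Qu; rewrite pE//; have [_] := H t u (Itv _ td) Qu.
have := @cvg_differentiation_under_integral R _ _ (leb2 R) (fun t u => w (t, u)) Q mQ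
  0 (- d) d dd intf der (cst M) (fun _ => M0) intM bd.
have -> : \int[leb2 R]_(y in Q) partial1of2 (fun t u => w (t, u)) 0 y =
   \int[leb2 R]_(u in Q) 'D_e w (0, u).
  by apply: eq_Rintegral => u; rewrite inE => Qu; rewrite pE.
move=> K; apply: is_derive_quotient.
rewrite (_ : (fun h : R => _) = fun h : R => h^-1 *:
  (\int[leb2 R]_(u in Q) w (h + 0, u) - \int[leb2 R]_(u in Q) w (0, u))).
  exact: K.
by apply/funext => h; rewrite [_%:A]mulr1.
Qed.

Lemma Rintegral_gt0 a1 b1 a2 b2 (m : R * R -> R) (z : R * R) :
  a1 < z.1 < b1 -> a2 < z.2 < b2 ->
  (forall u, rect a1 b1 a2 b2 u -> {for u, continuous m}) ->
  (forall u, rect a1 b1 a2 b2 u -> 0 <= m u) -> 0 < m z ->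
  0 < \int[leb2 R]_(u in rect a1 b1 a2 b2) m u.
Proof.
set Q := rect _ _ _ _ => /andP[z1 z2] /andP[z3 z4] cm m0 mz.
have Qz : Q z by split; rewrite !ltW.
have e0 : 0 < m z / 2 by rewrite divr_gt0.
have [d d0 H] := near_box (near_continuous (cm z Qz) e0).
pose r := Num.min (d / 2) (Num.min (Num.min (z.1 - a1) (b1 - z.1))
   (Num.min (z.2 - a2) (b2 - z.2))).
have r0 : 0 < r by rewrite !lt_min !subr_gt0 z1 z2 z3 z4 divr_gt0.
pose Q' := rect (z.1 - r) (z.1 + r) (z.2 - r) (z.2 + r).
have : r <= r by []; rewrite {2}/r !le_min => /andP[rd /andP[/andP[r1 r2] /andP[r3 r4]]].
have Q'Q : Q' `<=` Q.
  by move=> u [/andP[u1 u2] /andP[u3 u4]]; rewrite /Q /rect /=; split; lra.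
have Q'd u : Q' u -> m z / 2 <= m u.
  move=> Q'u; have : `|m z - m u| <= m z / 2.
    have d2 : d / 2 < d by rewrite ltr_pdivrMr// mulr_natr mulr2n ltrDl.
    by case: Q'u => u1 u2; apply: H; rewrite (le_lt_trans _ d2)// (le_trans _ rd)// ler_distl.
  by rewrite ler_norml => /andP[_]; lra.
have mQ := @measurable_rect R a1 b1 a2 b2.
have mQ' := @measurable_rect R (z.1 - r) (z.1 + r) (z.2 - r) (z.2 + r).
have ii : (leb2 R).-integrable Q (EFin \o m) by exact: integrable_rect.
have mm := measurable_int (leb2 R) ii.
have fi : (\int[leb2 R]_(u in Q) (m u)%:E \is a fin_num)%E by exact: integrable_fin_num.
rewrite -lte_fin /Rintegral fineK//.
apply: (@lt_le_trans _ _ (\int[leb2 R]_(u in Q') (m z / 2)%:E)%E).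
  rewrite integral_cst// -[X in (_ < _ * X)%E]/(leb2 R Q') leb2_rect; [|lra|lra].
  by rewrite -EFinM lte_fin mulr_gt0// mulr_gt0//; lra.
apply: (@le_trans _ _ (\int[leb2 R]_(u in Q') (m u)%:E)%E).
  apply: ge0_le_integral => //.
  - by move=> u _; rewrite lee_fin ltW.
  - exact: (measurable_funS mQ Q'Q mm).
apply: ge0_subset_integral => //.
Qed.

(** The divergence theorem for a flux that vanishes on the sides, by Fubini
    and the fundamental theorem of calculus. *)
Lemma integral_derive1 a1 b1 a2 b2 (A : set (R * R)) (X : R * R -> R) :
  a1 < b1 -> open A -> rect a1 b1 a2 b2 `<=` A -> Ck 1 A X ->
  (forall y, a2 <= y <= b2 -> X (a1, y) = 0) ->
  (forall y, a2 <= y <= b2 -> X (b1, y) = 0) ->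
  \int[leb2 R]_(u in rect a1 b1 a2 b2) 'D_((1, 0) : R * R) X u = 0.
Proof.
move=> ab1 oA QA CX Xa Xb; set e := (1, 0) : R * R; set Q := rect _ _ _ _.
have cD u : Q u -> {for u, continuous ('D_e X)}.
  by move=> /QA Au; exact: (Ck_continuous (Ck_derive e CX) Au).
have ii := integrable_rect cD.
have mQ := @measurable_rect R a1 b1 a2 b2.
have iT : (leb2 R).-integrable setT ((EFin \o 'D_e X) \_ Q).
  exact: (integrable_mkcond _ mQ).1.
rewrite /Rintegral integral_mkcond -(integral21_prod_meas1 iT).
rewrite integral0_eq// => y _.
rewrite /fubini_G.
have [y2|y2] := boolP (y \in `[a2, b2]); last first.
  apply: integral0_eq => x _; rewrite patchE ifF//; apply/negbTE/negP.
  rewrite inE => -[_ /= yab]; by rewrite in_itv/= yab in y2.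
have Qx x : x \in `[a1, b1] -> Q (x, y).
  by rewrite in_itv/= => xab; split => //; move: y2; rewrite in_itv.
rewrite (_ : (fun x => _) = (EFin \o (fun x => 'D_e X (x, y))) \_ `[a1, b1]); last first.
  apply/funext => x; rewrite !patchE; congr (if _ then _ else _).
  apply/idP/idP; rewrite !inE /=; last exact: Qx.
  by move=> -[/= x1 _]; rewrite in_itv.
rewrite -integral_mkcond.
have D x : x \in `[a1, b1] ->
    is_derive x (1 : R) (fun x => X (x, y)) ('D_e X (x, y)).
  move=> xab; have dX : derivable X (x, y) e := Ck_derivable e CX (QA _ (Qx x xab)).
  have eE (h : R) : h *: e + (x, y) = (h *: 1 + x, y).
    by congr (_, _); rewrite /= scaler0 add0r.
  apply: is_derive_quotient.
  rewrite (_ : (fun h : R => _) = fun h : R => h^-1 *: (X (h *: e + (x, y)) - X (x, y))).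
    exact: dX.
  by apply/funext => h; rewrite eE.
have cX x : x \in `[a1, b1] -> {for x, continuous (fun x => X (x, y))}.
  by move=> /D [dX _]; exact/differentiable_continuous/derivable1_diffP.
rewrite (@continuous_FTC2 _ _ (fun x => X (x, y)))//.
- by rewrite Xa ?Xb ?subee// -in_itv.
- apply: continuous_in_subspaceT => x; rewrite inE => xab.
  apply: (@continuous_comp _ _ _ (fun x => (x, y)) ('D_e X)).
    have c1 : id @ x --> x by exact: cvg_id.
    have c2 : (fun=> y) @ x --> y by exact: cvg_cst.
    exact: (cvg_pair c1 c2).
  exact/cD/Qx.
- split.
  + by move=> x /subset_itv_oo_cc /D [].
  + apply: cvg_at_right_filter; apply: cX; by rewrite in_itv/= lexx ltW.
  + apply: cvg_at_left_filter; apply: cX; by rewrite in_itv/= lexx ltW.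
- by move=> x /subset_itv_oo_cc /D [_ <-]; rewrite derive1E.
Qed.

Lemma integral_derive2 a1 b1 a2 b2 (A : set (R * R)) (X : R * R -> R) :
  a2 < b2 -> open A -> rect a1 b1 a2 b2 `<=` A -> Ck 1 A X ->
  (forall x, a1 <= x <= b1 -> X (x, a2) = 0) ->
  (forall x, a1 <= x <= b1 -> X (x, b2) = 0) ->
  \int[leb2 R]_(u in rect a1 b1 a2 b2) 'D_((0, 1) : R * R) X u = 0.
Proof.
move=> ab1 oA QA CX Xa Xb; set e := (0, 1) : R * R; set Q := rect _ _ _ _.
have cD u : Q u -> {for u, continuous ('D_e X)}.
  by move=> /QA Au; exact: (Ck_continuous (Ck_derive e CX) Au).
have ii := integrable_rect cD.
have mQ := @measurable_rect R a1 b1 a2 b2.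
have iT : (leb2 R).-integrable setT ((EFin \o 'D_e X) \_ Q).
  exact: (integrable_mkcond _ mQ).1.
rewrite /Rintegral integral_mkcond -(integral12_prod_meas1 iT).
rewrite integral0_eq// => x _.
rewrite /fubini_F.
have [x2|x2] := boolP (x \in `[a1, b1]); last first.
  apply: integral0_eq => y _; rewrite patchE ifF//; apply/negbTE/negP.
  rewrite inE => -[/= xab _]; by rewrite in_itv/= xab in x2.
have Qy y : y \in `[a2, b2] -> Q (x, y).
  by rewrite in_itv/= => yab; split => //; move: x2; rewrite in_itv.
rewrite (_ : (fun y => _) = (EFin \o (fun y => 'D_e X (x, y))) \_ `[a2, b2]); last first.
  apply/funext => y; rewrite !patchE; congr (if _ then _ else _).
  apply/idP/idP; rewrite !inE /=; last exact: Qy.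
  by move=> -[_ /= y1]; rewrite in_itv.
rewrite -integral_mkcond.
have D y : y \in `[a2, b2] ->
    is_derive y (1 : R) (fun y => X (x, y)) ('D_e X (x, y)).
  move=> yab; have dX : derivable X (x, y) e := Ck_derivable e CX (QA _ (Qy y yab)).
  have eE (h : R) : h *: e + (x, y) = (x, h *: 1 + y).
    by congr (_, _); rewrite /= scaler0 add0r.
  apply: is_derive_quotient.
  rewrite (_ : (fun h : R => _) = fun h : R => h^-1 *: (X (h *: e + (x, y)) - X (x, y))).
    exact: dX.
  by apply/funext => h; rewrite eE.
have cX y : y \in `[a2, b2] -> {for y, continuous (fun y => X (x, y))}.
  by move=> /D [dX _]; exact/differentiable_continuous/derivable1_diffP.
rewrite (@continuous_FTC2 _ _ (fun y => X (x, y)))//.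
- by rewrite Xa ?Xb ?subee// -in_itv.
- apply: continuous_in_subspaceT => y; rewrite inE => yab.
  apply: (@continuous_comp _ _ _ (fun y => (x, y)) ('D_e X)).
    have c1 : id @ y --> y by exact: cvg_id.
    have c2 : (fun=> x) @ y --> x by exact: cvg_cst.
    exact: (cvg_pair c2 c1).
  exact/cD/Qy.
- split.
  + by move=> y /subset_itv_oo_cc /D [].
  + apply: cvg_at_right_filter; apply: cX; by rewrite in_itv/= lexx ltW.
  + apply: cvg_at_left_filter; apply: cX; by rewrite in_itv/= lexx ltW.
- by move=> y /subset_itv_oo_cc /D [_ <-]; rewrite derive1E.
Qed.

End Integrals.

(** * The Hermitian structure of C^3 *)

Section Dot.
Context {R : realType}.
Notation V6 := 'rV[R]_(3 + 3).
Implicit Types (v w x y : V6) (a b : R).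

Lemma dotC v w : dot v w = dot w v.
Proof. by apply: eq_bigr => k _; rewrite mulrC. Qed.

Lemma dotDl v w x : dot (v + w) x = dot v x + dot w x.
Proof. by rewrite /dot -big_split; apply: eq_bigr => k _; rewrite mxE mulrDl. Qed.

Lemma dotZl a v x : dot (a *: v) x = a * dot v x.
Proof. by rewrite /dot mulr_sumr; apply: eq_bigr => k _; rewrite mxE mulrA. Qed.

Lemma dotDr v w x : dot x (v + w) = dot x v + dot x w.
Proof. by rewrite dotC dotDl !(dotC x). Qed.

Lemma dotZr a v x : dot x (a *: v) = a * dot x v.
Proof. by rewrite dotC dotZl dotC. Qed.

Lemma dotNl v x : dot (- v) x = - dot v x.
Proof. by rewrite -scaleN1r dotZl mulN1r. Qed.

Lemma dotNr v x : dot x (- v) = - dot x v.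
Proof. by rewrite dotC dotNl dotC. Qed.

Lemma dotBl v w x : dot (v - w) x = dot v x - dot w x.
Proof. by rewrite dotDl dotNl. Qed.

Lemma dotBr v w x : dot x (v - w) = dot x v - dot x w.
Proof. by rewrite dotDr dotNr. Qed.

Lemma dot0l x : dot 0 x = 0.
Proof. by rewrite -(scale0r 0) dotZl mul0r. Qed.

Lemma dot0r x : dot x 0 = 0.
Proof. by rewrite dotC dot0l. Qed.

Lemma dot_mx v w : dot v w = (v *m w^T) 0 0.
Proof. by rewrite !mxE; apply: eq_bigr => k _; rewrite !mxE. Qed.

Lemma muliD v w : muli (v + w) = muli v + muli w.
Proof.
rewrite /muli add_row_mx -opprD.
by congr (row_mx (- _) _); apply/matrixP => i j; rewrite !mxE.
Qed.

Lemma muliZ a v : muli (a *: v) = a *: muli v.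
Proof.
rewrite /muli scale_row_mx scalerN.
by congr (row_mx (- _) _); apply/matrixP => i j; rewrite !mxE.
Qed.

Lemma muliN v : muli (- v) = - muli v.
Proof. by rewrite -scaleN1r muliZ scaleN1r. Qed.

Lemma muliK v : muli (muli v) = - v.
Proof.
by rewrite /muli row_mxKl row_mxKr -[v in RHS]hsubmxK opp_row_mx.
Qed.

Lemma dot_row (a b c d : 'rV[R]_3) : dot (row_mx a b) (row_mx c d) =
  (\sum_k a 0 k * c 0 k) + \sum_k b 0 k * d 0 k.
Proof.
by rewrite /dot big_split_ord; congr (_ + _); apply: eq_bigr => k _;
  rewrite ?row_mxEl ?row_mxEr.
Qed.

Lemma dot_muli v w : dot (muli v) w = - dot v (muli w).
Proof.
rewrite /muli -[v in RHS]hsubmxK -[w in LHS]hsubmxK !dot_row opprD addrC -!sumrN.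
by congr (_ + _); apply: eq_bigr => k _; rewrite !mxE ?mulrN ?opprK ?mulNr.
Qed.

Lemma dot_muli2 v w : dot (muli v) (muli w) = dot v w.
Proof. by rewrite dot_muli muliK dotNr opprK. Qed.

Lemma dot_muliv v : dot v (muli v) = 0.
Proof.
have : dot v (muli v) = - dot v (muli v) by rewrite -dot_muli dotC.
by move=> /eqP; rewrite -subr_eq0 opprK -mulr2n mulrn_eq0 /= => /eqP.
Qed.

Lemma dot_ge0 v : 0 <= dot v v.
Proof. by apply: sumr_ge0 => k _; rewrite -expr2 sqr_ge0. Qed.

Lemma dot_eq0 v : dot v v = 0 -> v = 0.
Proof.
move=> /eqP; rewrite psumr_eq0; last by move=> k _; rewrite -expr2 sqr_ge0.
move=> /allP H; apply/rowP => k; rewrite mxE.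
by have /(_ (mem_index_enum k)) /= := H k; rewrite -expr2 sqrf_eq0 => /eqP.
Qed.

Lemma enorm_sq v : enorm v ^+ 2 = dot v v.
Proof. by rewrite sqr_sqrtr// dot_ge0. Qed.

(** Exactly the relations that make f, e1, e2, i f, i e1, i e2 orthonormal. *)
Definition legendrian_frame (f e1 e2 : V6) : Prop :=
  [/\ dot f f = 1, dot e1 e1 = 1 & dot e2 e2 = 1] /\
  [/\ dot f e1 = 0, dot f e2 = 0 & dot e1 e2 = 0] /\
  [/\ dot f (muli e1) = 0, dot f (muli e2) = 0 & dot e1 (muli e2) = 0].

Section Frame.
Variables f e1 e2 : V6.
Hypothesis fr : legendrian_frame f e1 e2.

Definition fbasis : seq V6 := [:: f; e1; e2; muli f; muli e1; muli e2].

(** The matrix with these six rows is orthogonal, hence so is its transpose.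
    *)
Lemma parseval v w : dot v w =
  dot v f * dot w f + dot v e1 * dot w e1 + dot v e2 * dot w e2 +
  dot v (muli f) * dot w (muli f) + dot v (muli e1) * dot w (muli e1) +
  dot v (muli e2) * dot w (muli e2).
Proof.
case: fr => -[ff e11 e22] [[fe1 fe2 e12] [fi1 fi2 ei12]].
pose M : 'M[R]_(3 + 3) := \matrix_(i, j) nth 0 fbasis i 0 j.
have ME i : row i M = nth 0 fbasis i by apply/rowP => j; rewrite !mxE.
have MM : M *m M^T = 1%:M.
  apply/matrixP => i j; rewrite !mxE.
  rewrite [LHS](_ : _ = dot (nth 0 fbasis i) (nth 0 fbasis j)); last first.
    by apply: eq_bigr => k _; rewrite !mxE.
  have i1 : dot e1 f = 0 by rewrite dotC.
  have i2 : dot e2 f = 0 by rewrite dotC.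
  have i3 : dot e2 e1 = 0 by rewrite dotC.
  have i4 : dot e1 (muli f) = 0 by rewrite dotC dot_muli fi1 oppr0.
  have i5 : dot e2 (muli f) = 0 by rewrite dotC dot_muli fi2 oppr0.
  have i6 : dot e2 (muli e1) = 0 by rewrite dotC dot_muli ei12 oppr0.
  have T := (ff, e11, e22, fe1, fe2, e12, fi1, fi2, ei12, i1, i2, i3, i4, i5, i6,
    dot_muliv, dot_muli2).
  case: i => [[|[|[|[|[|[|//]]]]]] Hi]; case: j => [[|[|[|[|[|[|//]]]]]] Hj] /=;
    by rewrite ?T // dotC ?T.
have /mulmx1C MM' := MM.
have -> : dot v w = dot (v *m M^T) (w *m M^T).
  by rewrite [RHS]dot_mx trmx_mul trmxK mulmxA -(mulmxA v) MM' mulmx1 -dot_mx.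
have E x k : (x *m M^T) 0 k = dot x (nth 0 fbasis k).
  by rewrite !mxE; apply: eq_bigr => l _; rewrite !mxE.
rewrite [LHS]/dot !big_ord_recl big_ord0 !E /= addr0 !addrA.
by [].
Qed.

Lemma frame_ext v w : dot v f = dot w f -> dot v e1 = dot w e1 -> dot v e2 = dot w e2 ->
  dot v (muli f) = dot w (muli f) -> dot v (muli e1) = dot w (muli e1) ->
  dot v (muli e2) = dot w (muli e2) -> v = w.
Proof.
move=> h1 h2 h3 h4 h5 h6; apply/eqP; rewrite -subr_eq0; apply/eqP/dot_eq0.
by rewrite parseval !dotBl h1 h2 h3 h4 h5 h6 !subrr !mul0r !addr0.
Qed.

End Frame.
End Dot.

Section Leibniz.
Context {R : realType} {V : normedModType R}.
Notation V6 := 'rV[R]_(3 + 3).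

Lemma is_derive_dot (f g : V -> V6) x v df dg :
  is_derive x v f df -> is_derive x v g dg ->
  is_derive x v (fun x => dot (f x) (g x)) (dot df (g x) + dot (f x) dg).
Proof.
move=> [Df Ef] [Dg Eg].
have cf k : derivable (fun x => f x 0 k) x v := (derivable_mxP _ _ _).1 Df 0 k.
have cg k : derivable (fun x => g x 0 k) x v := (derivable_mxP _ _ _).1 Dg 0 k.
have E : (fun x => dot (f x) (g x)) =
    \sum_k ((fun x => f x 0 k) * (fun x => g x 0 k) : V -> R).
  by apply/funext => y; rewrite fct_sumE.
have D k : is_derive x v ((fun x => f x 0 k) * (fun x => g x 0 k) : V -> R)
   (f x 0 k * dg 0 k + g x 0 k * df 0 k).
  have -> : dg 0 k = 'D_v (fun x => g x 0 k) x by rewrite -Eg (derive_mx Dg) mxE.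
  have -> : df 0 k = 'D_v (fun x => f x 0 k) x by rewrite -Ef (derive_mx Df) mxE.
  exact: is_deriveM.
rewrite E; apply: (is_derive_cast (is_derive_sum D)).
by rewrite /dot -big_split; apply: eq_bigr => k _; rewrite addrC [g x 0 k * _]mulrC.
Qed.

Lemma muli_coord (v : V6) k : exists c : R, exists l, forall v : V6, muli v 0 k = c * v 0 l.
Proof.
rewrite /muli; case: (splitP k) => j kE.
  exists (-1), (rshift 3 j) => w; rewrite (_ : k = lshift 3 j); last exact: val_inj.
  by rewrite row_mxEl !mxE mulN1r.
exists 1, (lshift 3 j) => w; rewrite (_ : k = rshift 3 j); last exact: val_inj.
by rewrite row_mxEr !mxE mul1r.
Qed.

Lemma is_derive_muli (f : V -> V6) x v df :
  is_derive x v f df -> is_derive x v (fun x => muli (f x)) (muli df).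
Proof.
move=> [Df Ef].
have cf k : derivable (fun x => f x 0 k) x v := (derivable_mxP _ _ _).1 Df 0 k.
have D k : is_derive x v (fun x => muli (f x) 0 k) (muli df 0 k).
  have [c [l E]] := muli_coord 0 k.
  rewrite (_ : (fun x => _) = c *: (fun x => f x 0 l)); last first.
    by apply/funext => y; rewrite E.
  rewrite E -Ef (derive_mx Df) mxE; exact: is_deriveZ.
have Dm : derivable (fun x => muli (f x)) x v.
  by apply: (derivable_mxP _ _ _).2 => i k; rewrite ord1; case: (D k).
apply: DeriveDef; first exact: Dm.
by apply/rowP => k; rewrite (derive_mx Dm) mxE; case: (D k).
Qed.

Lemma is_derive_scale (a : V -> R) (f : V -> V6) x v da df :
  is_derive x v a da -> is_derive x v f df ->
  is_derive x v (fun x => a x *: f x) (da *: f x + a x *: df).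
Proof.
move=> Da [Df Ef].
have cf k : derivable (fun x => f x 0 k) x v := (derivable_mxP _ _ _).1 Df 0 k.
have D k : is_derive x v (fun x => (a x *: f x) 0 k) ((da *: f x + a x *: df) 0 k).
  rewrite (_ : (fun x => _) = a * (fun x => f x 0 k)); last first.
    by apply/funext => y; rewrite mxE.
  have Dk : is_derive x v (fun x => f x 0 k) (df 0 k).
    by rewrite -Ef (derive_mx Df) mxE; exact: derivableP.
  by apply: (is_derive_cast (is_deriveM Da Dk)); rewrite !mxE addrC [_ *: da]mulrC.
have Dm : derivable (fun x => a x *: f x) x v.
  by apply: (derivable_mxP _ _ _).2 => i k; rewrite ord1; case: (D k).
apply: DeriveDef; first exact: Dm.
by apply/rowP => k; rewrite (derive_mx Dm) mxE; case: (D k).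
Qed.

Lemma Ck_dot k (A : set V) (f g : V -> V6) : open A ->
  Ck k A f -> Ck k A g -> Ck k A (fun x => dot (f x) (g x)).
Proof.
move=> oA Cf Cg; apply: Ck_sum => // i; apply: Ck_mul => //; exact: (Ck_row _ _ oA).1.
Qed.

Lemma Ck_muli k (A : set V) (f : V -> V6) : open A ->
  Ck k A f -> Ck k A (fun x => muli (f x)).
Proof.
move=> oA Cf; apply/(Ck_row _ _ oA) => j; have [c [l E]] := muli_coord 0 j.
have Cl := Ck_mul oA (Ck_cst k A c) ((Ck_row _ _ oA).1 Cf l).
by apply: (Ck_eq oA _ Cl) => x _; rewrite E.
Qed.

End Leibniz.

(** * Derivatives along vector fields *)

#[local] Opaque derive.

Section Smooth.
Context {R : realType} {V : normedModType R} (A : set V) (oA : open A).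
Notation V6 := 'rV[R]_(3 + 3).
Implicit Types (W : normedModType R).
Notation sm := (smooth_on A).

Lemma sm_eq W (f g : V -> W) : (forall x, A x -> f x = g x) -> sm f -> sm g.
Proof. by move=> fg sf k; apply: Ck_eq (sf k). Qed.
Lemma sm_cst W (w : W) : sm (fun=> w).
Proof. by move=> k; exact: Ck_cst. Qed.
Lemma sm_add W (f g : V -> W) : sm f -> sm g -> sm (fun x => f x + g x).
Proof. by move=> sf sg k; exact: Ck_add. Qed.
Lemma sm_opp W (f : V -> W) : sm f -> sm (fun x => - f x).
Proof. by move=> sf k; exact: Ck_opp. Qed.
Lemma sm_scale W (f : V -> R) (g : V -> W) : sm f -> sm g -> sm (fun x => f x *: g x).
Proof. by move=> sf sg k; exact: Ck_scale. Qed.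
Lemma sm_mul (f g : V -> R) : sm f -> sm g -> sm (fun x => f x * g x).
Proof. by move=> sf sg k; exact: Ck_mul. Qed.
Lemma sm_inv (f : V -> R) : (forall x, A x -> f x != 0) -> sm f -> sm (fun x => (f x)^-1).
Proof. by move=> f0 sf k; exact: Ck_inv. Qed.
Lemma sm_sqrt (f : V -> R) : (forall x, A x -> 0 < f x) -> sm f ->
  sm (fun x => Num.sqrt (f x)).
Proof. by move=> f0 sf k; exact: Ck_sqrt. Qed.
Lemma sm_dot (f g : V -> V6) : sm f -> sm g -> sm (fun x => dot (f x) (g x)).
Proof. by move=> sf sg k; exact: Ck_dot. Qed.
Lemma sm_muli (f : V -> V6) : sm f -> sm (fun x => muli (f x)).
Proof. by move=> sf k; exact: Ck_muli. Qed.
Lemma sm_derive W (f : V -> W) v : sm f -> sm ('D_v f).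
Proof. by move=> sf k; exact: Ck_derive (sf k.+1). Qed.
Lemma sm_coord (f : V -> V6) j : sm f -> sm (fun x => f x 0 j).
Proof. by move=> sf k; exact: (Ck_row _ _ oA).1 (sf k) j. Qed.
Lemma sm_derivable W (f : V -> W) x v : sm f -> A x -> derivable f x v.
Proof. by move=> sf Ax; exact: (Ck_derivable v (sf 1) Ax). Qed.
Arguments sm_derivable {W f x} v _ _.
Lemma sm_is_derive W (f : V -> W) x v : sm f -> A x -> is_derive x v f ('D_v f x).
Proof. by move=> sf Ax; apply: derivableP; exact: sm_derivable. Qed.
Lemma sm_continuous W (f : V -> W) x : sm f -> A x -> {for x, continuous f}.
Proof. by move=> sf Ax; exact: (Ck_continuous (sf 0) Ax). Qed.

Arguments sm_continuous {W f x} _ _.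

Definition along W (p : V -> V) (f : V -> W) : V -> W := fun x => 'D_(p x) f x.

Lemma along_def W p (f : V -> W) x : along p f x = 'D_(p x) f x.
Proof. by []. Qed.

Lemma along_eq W p (f g : V -> W) x : (forall x, A x -> f x = g x) -> A x ->
  along p f x = along p g x.
Proof.
move=> fg Ax; apply: near_eq_derive.
by apply: filterS (open_nbhs_nbhs (conj oA Ax)) => y; exact: fg.
Qed.

Lemma alongD W p (f g : V -> W) x : sm f -> sm g -> A x ->
  along p (fun x => f x + g x) x = along p f x + along p g x.
Proof.
move=> sf sg Ax; exact: (deriveD (sm_derivable _ sf Ax) (sm_derivable _ sg Ax)).
Qed.

Lemma alongM p (f g : V -> R) x : sm f -> sm g -> A x ->
  along p (fun x => f x * g x) x = along p f x * g x + f x * along p g x.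
Proof.
move=> sf sg Ax.
have E := deriveM (sm_derivable (p x) sf Ax) (sm_derivable (p x) sg Ax).
by apply: etrans E _; rewrite addrC [X in X + _ = _]mulrC.
Qed.

Lemma along_opp W p (f : V -> W) x : sm f -> A x ->
  along p (fun x => - f x) x = - along p f x.
Proof. by move=> sf Ax; exact: (deriveN (sm_derivable _ sf Ax)). Qed.

Lemma along_cst W p (w : W) x : along p (fun=> w) x = 0.
Proof. exact: derive_cst. Qed.

Lemma alongV p (f : V -> R) x : sm f -> A x -> f x != 0 ->
  along p (fun x => (f x)^-1) x = - (f x)^-1 ^+ 2 * along p f x.
Proof.
move=> sf Ax f0; rewrite exprVn; exact: (deriveV f0 (sm_derivable _ sf Ax)).
Qed.

Lemma along_dot p (f g : V -> V6) x : sm f -> sm g -> A x ->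
  along p (fun x => dot (f x) (g x)) x =
  dot (along p f x) (g x) + dot (f x) (along p g x).
Proof.
move=> sf sg Ax.
by have [_ E] := is_derive_dot (sm_is_derive (p x) sf Ax) (sm_is_derive (p x) sg Ax).
Qed.

Lemma along_scale p (a : V -> R) (f : V -> V6) x : sm a -> sm f -> A x ->
  along p (fun x => a x *: f x) x = along p a x *: f x + a x *: along p f x.
Proof.
move=> sa sf Ax.
by have [_ E] := is_derive_scale (sm_is_derive (p x) sa Ax) (sm_is_derive (p x) sf Ax).
Qed.

Lemma along_muli p (f : V -> V6) x : sm f -> A x ->
  along p (fun x => muli (f x)) x = muli (along p f x).
Proof.
by move=> sf Ax; have [_ E] := is_derive_muli (sm_is_derive (p x) sf Ax).
Qed.

Lemma along_coord p (f : V -> V6) x j : sm f -> A x ->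
  along p f x 0 j = along p (fun x => f x 0 j) x.
Proof. by move=> sf Ax; rewrite /along (derive_mx (sm_derivable _ sf Ax)) mxE. Qed.

Lemma schwarzV (g : V -> V6) x v w : sm g -> A x ->
  'D_v ('D_w g) x = 'D_w ('D_v g) x.
Proof.
move=> sg Ax; apply/rowP => j; have sj := sm_coord j sg.
have C p q : along (fun=> p) ('D_q g) x 0 j = 'D_p ('D_q (fun x => g x 0 j)) x.
  apply: etrans (along_coord (fun=> p) j (sm_derive q sg) Ax) _.
  exact: (along_eq (fun=> p) (fun x Ax => along_coord (fun=> q) j sg Ax) Ax).
apply: etrans (C v w) _; apply: etrans (schwarz v w oA Ax (sj 2)) _; exact: esym (C w v).
Qed.

End Smooth.
Arguments sm_derivable {R V A W f x} v _ _.
Arguments sm_continuous {R V A W f x} _ _.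

Section Fields.
Context {R : realType} (A : set (R * R)) (oA : open A).
Notation V6 := 'rV[R]_(3 + 3).
Notation sm := (smooth_on A).
Implicit Types p q : R * R -> R * R.
Let ex : R * R := (1, 0).
Let ey : R * R := (0, 1).

Definition smooth_field p := sm (fun u => (p u).1) /\ sm (fun u => (p u).2).

Lemma alongE p (f : R * R -> R) u : sm f -> A u ->
  along p f u = (p u).1 * 'D_ex f u + (p u).2 * 'D_ey f u.
Proof. by move=> sf Au; exact: (derive_plane (p u) oA Au (sf 1)). Qed.

Lemma alongVE p (f : R * R -> V6) u : sm f -> A u ->
  along p f u = (p u).1 *: 'D_ex f u + (p u).2 *: 'D_ey f u.
Proof. by move=> sf Au; exact: (derive_planeV (p u) oA Au (sf 1)). Qed.

#[local] Opaque along.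

Lemma sm_along p (f : R * R -> R) : smooth_field p -> sm f -> sm (along p f).
Proof.
move=> [p1 p2] sf; apply: (sm_eq oA (f := fun u => (p u).1 * 'D_ex f u + (p u).2 * 'D_ey f u)).
  by move=> u Au; exact: esym (alongE _ sf Au).
by apply: (sm_add oA); apply: (sm_mul oA) => //; exact: sm_derive.
Qed.

Lemma sm_alongV p (f : R * R -> V6) : smooth_field p -> sm f -> sm (along p f).
Proof.
move=> [p1 p2] sf.
apply: (sm_eq oA (f := fun u => (p u).1 *: 'D_ex f u + (p u).2 *: 'D_ey f u)).
  by move=> u Au; exact: esym (alongVE _ sf Au).
by apply: (sm_add oA); apply: (sm_scale oA) => //; exact: sm_derive.
Qed.

Definition lie p q : R * R -> R * R := fun u =>
  (along p (fun u => (q u).1) u - along q (fun u => (p u).1) u,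
   along p (fun u => (q u).2) u - along q (fun u => (p u).2) u).

Lemma along_combination r (a b fx fy g : R * R -> R) u : sm a -> sm b -> sm fx -> sm fy ->
  (forall x, A x -> g x = a x * fx x + b x * fy x) -> A u ->
  along r g u = along r a u * fx u + a u * along r fx u +
    (along r b u * fy u + b u * along r fy u).
Proof.
move=> sa sb sx sy gE Au; rewrite (along_eq oA r gE Au).
by rewrite (alongD r (sm_mul oA sa sx) (sm_mul oA sb sy) Au) (alongM r sa sx Au)
  (alongM r sb sy Au).
Qed.

(** The cancellation in coordinates; x and y are the partial derivatives of
    the function. *)
Lemma lie_identity (pq qp l a b c d x y xx xy yx yy kxp kyp kxq kyq p1 p2 q1 q2 : R) :
  pq = a * x + q1 * kxp + (b * y + q2 * kyp) ->
  qp = c * x + p1 * kxq + (d * y + p2 * kyq) ->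
  kxp = p1 * xx + p2 * yx -> kyp = p1 * xy + p2 * yy ->
  kxq = q1 * xx + q2 * yx -> kyq = q1 * xy + q2 * yy ->
  xy = yx -> l = (a - c) * x + (b - d) * y -> pq - qp = l.
Proof. by move=> -> -> -> -> -> -> -> ->; ring. Qed.

(** The second derivatives cancel by symmetry and the first-order terms that
    remain are the bracket. *)
Lemma along_lie p q (f : R * R -> R) u : smooth_field p -> smooth_field q ->
  sm f -> A u ->
  along p (along q f) u - along q (along p f) u = along (lie p q) f u.
Proof.
move=> [sp1 sp2] [sq1 sq2] sf Au.
have sx := sm_derive ex sf; have sy := sm_derive ey sf.
have Kx r := alongE r sx Au; have Ky r := alongE r sy Au.
have S : 'D_ex ('D_ey f) u = 'D_ey ('D_ex f) u by exact: (schwarz _ _ oA Au (sf 2)).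
have F r x := @alongE r f x sf.
have Kl : along (lie p q) f u =
    (along p (fun u => (q u).1) u - along q (fun u => (p u).1) u) * 'D_ex f u +
    (along p (fun u => (q u).2) u - along q (fun u => (p u).2) u) * 'D_ey f u.
  exact: (F (lie p q) u Au).
have Epq := along_combination p sq1 sq2 sx sy (F q) Au.
have Eqp := along_combination q sp1 sp2 sx sy (F p) Au.
exact: (lie_identity Epq Eqp (Kx p) (Ky p) (Kx q) (Ky q) S Kl).
Qed.

Lemma along_lieV p q (f : R * R -> V6) u : smooth_field p -> smooth_field q ->
  sm f -> A u ->
  along p (along q f) u - along q (along p f) u = along (lie p q) f u.
Proof.
move=> sp sq sf Au; apply/rowP => j; rewrite !mxE.
have sj := sm_coord oA j sf.
have E r s (ss : smooth_field s) :
    along r (along s f) u 0 j = along r (along s (fun x => f x 0 j)) u.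
  apply: etrans (along_coord r j (sm_alongV ss sf) Au) _.
  exact: (along_eq oA r (fun x Ax => along_coord s j sf Ax) Au).
apply: etrans (congr2 (fun a b => a - b) (E p q sq) (E q p sp)) _.
exact: (etrans (along_lie sp sq sj Au) (esym (along_coord (lie p q) j sf Au))).
Qed.

End Fields.

#[local] Transparent derive along.

(** * Structure equations of a Legendrian frame *)

#[local] Opaque derive along.
Lemma commutator_pairing {R : realType} (x12 x21 y1 y2 k k1 k2 : 'rV[R]_(3 + 3))
    (v1 v2 c1 c2 p q : R) :
  x12 - x21 = - (v1 *: y1 + v2 *: y2) -> dot y1 k = c1 -> dot y2 k = c2 ->
  p = dot x12 k + dot y2 k1 -> q = dot x21 k + dot y1 k2 ->
  p - q = - (v1 * c1 + v2 * c2) + dot y2 k1 - dot y1 k2.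
Proof.
move=> L <- <- -> ->; have := congr1 (fun x => dot x k) L.
rewrite /= dotBl dotNl dotDl !dotZl => <-; ring.
Qed.

Section Structure.
Context {R : realType} (A : set (R * R)) (oA : open A).
Notation V6 := 'rV[R]_(3 + 3).
Notation sm := (smooth_on A).
Variables (f e1 e2 : R * R -> V6) (p1 p2 : R * R -> R * R).
Variables (w1 w2 a b c d : R * R -> R).
Hypotheses (sf : sm f) (sp1 : smooth_field A p1) (sp2 : smooth_field A p2).
Hypothesis imm : forall u v, A u -> 'D_v f u = 0 -> v = 0.
Hypothesis leg : forall u v w, A u -> dot ('D_v f u) (muli ('D_w f u)) = 0.
Hypothesis legf : forall u v, A u -> dot (f u) (muli ('D_v f u)) = 0.
Hypothesis fr : forall u, A u -> legendrian_frame (f u) (e1 u) (e2 u).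
Hypothesis e1E : e1 = along p1 f.
Hypothesis e2E : e2 = along p2 f.
Hypothesis w1E : w1 = fun u => dot (along p1 e1 u) (e2 u).
Hypothesis w2E : w2 = fun u => dot (along p2 e1 u) (e2 u).
Hypothesis aE : a = fun u => dot (along p1 e1 u) (muli (e1 u)).
Hypothesis bE : b = fun u => dot (along p1 e1 u) (muli (e2 u)).
Hypothesis cE : c = fun u => dot (along p2 e1 u) (muli (e2 u)).
Hypothesis dE : d = fun u => dot (along p2 e2 u) (muli (e2 u)).

Lemma se1 : sm e1. Proof. by rewrite e1E; exact: (sm_alongV oA). Qed.
Lemma se2 : sm e2. Proof. by rewrite e2E; exact: (sm_alongV oA). Qed.

Let e1u' u : along p1 f u = e1 u. Proof. rewrite e1E; reflexivity. Qed.
Let e2u' u : along p2 f u = e2 u. Proof. rewrite e2E; reflexivity. Qed.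
Let w1u' u : dot (along p1 e1 u) (e2 u) = w1 u. Proof. rewrite w1E; reflexivity. Qed.
Let w2u' u : dot (along p2 e1 u) (e2 u) = w2 u. Proof. rewrite w2E; reflexivity. Qed.
Let au' u : dot (along p1 e1 u) (muli (e1 u)) = a u. Proof. rewrite aE; reflexivity. Qed.
Let bu' u : dot (along p1 e1 u) (muli (e2 u)) = b u. Proof. rewrite bE; reflexivity. Qed.
Let cu' u : dot (along p2 e1 u) (muli (e2 u)) = c u. Proof. rewrite cE; reflexivity. Qed.
Let du' u : dot (along p2 e2 u) (muli (e2 u)) = d u. Proof. rewrite dE; reflexivity. Qed.

Lemma along_dot_cst p (g k : R * R -> V6) (r : R) u : sm g -> sm k ->
  (forall x, A x -> dot (g x) (k x) = r) -> A u ->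
  dot (along p g u) (k u) = - dot (g u) (along p k u).
Proof.
move=> sg sk gk Au; have E := along_dot p sg sk Au.
have Z := along_eq oA p gk Au; rewrite E along_cst in Z.
by apply/eqP; rewrite -addr_eq0 Z.
Qed.

(** One multirule, because products of frame vectors are simplified many times
    below. *)
Lemma frame_rules u : A u ->
  (dot (f u) (f u) = 1) * (dot (e1 u) (e1 u) = 1) * (dot (e2 u) (e2 u) = 1) *
  (dot (f u) (e1 u) = 0) * (dot (f u) (e2 u) = 0) * (dot (e1 u) (e2 u) = 0) *
  (dot (e1 u) (f u) = 0) * (dot (e2 u) (f u) = 0) * (dot (e2 u) (e1 u) = 0) *
  (dot (f u) (muli (e1 u)) = 0) * (dot (f u) (muli (e2 u)) = 0) *
  (dot (e1 u) (muli (e2 u)) = 0) * (dot (e1 u) (muli (f u)) = 0) *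
  (dot (e2 u) (muli (f u)) = 0) * (dot (e2 u) (muli (e1 u)) = 0) *
  (dot (f u) (muli (f u)) = 0) * (dot (e1 u) (muli (e1 u)) = 0) *
  (dot (e2 u) (muli (e2 u)) = 0).
Proof.
move=> Au; have [[r1 r2 r3] [[r4 r5 r6] [r7 r8 r9]]] := fr Au.
have N v w : dot v (muli w) = - dot w (muli v) by rewrite dotC dot_muli.
have j1 : dot (e1 u) (f u) = 0 by rewrite dotC.
have j2 : dot (e2 u) (f u) = 0 by rewrite dotC.
have j3 : dot (e2 u) (e1 u) = 0 by rewrite dotC.
have j4 : dot (e1 u) (muli (f u)) = 0 by rewrite N r7 oppr0.
have j5 : dot (e2 u) (muli (f u)) = 0 by rewrite N r8 oppr0.
have j6 : dot (e2 u) (muli (e1 u)) = 0 by rewrite N r9 oppr0.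
exact: (r1, r2, r3, r4, r5, r6, j1, j2, j3, r7, r8, r9, j4, j5, j6,
  dot_muliv _, dot_muliv _, dot_muliv _).
Qed.

Let N v w : dot (R := R) v (muli w) = - dot w (muli v).
Proof. by rewrite dotC dot_muli. Qed.

Ltac frame_simp T := rewrite ?(muliD, muliZ, muliN, muliK, dotDl, dotDr, dotZl, dotZr, dotNl,
  dotNr, dot_muli2, dot_muli); rewrite ?T.

Lemma along_frame p e u : sm e -> (forall x, A x -> dot (e x) (f x) = 0) ->
   (forall x, A x -> dot (e x) (muli (f x)) = 0) -> A u ->
  dot (along p e u) (f u) = - dot (e u) (along p f u) /\
  dot (along p e u) (muli (f u)) = - dot (e u) (muli (along p f u)).
Proof.
move=> se ef eif Au; split; first exact: (along_dot_cst p se sf ef Au).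
rewrite (along_dot_cst p se (sm_muli oA sf) eif Au).
by rewrite (along_muli p sf Au).
Qed.

Lemma lie_p12E u : A u -> along p1 e2 u - along p2 e1 u = along (lie p1 p2) f u.
Proof.
move=> Au; rewrite e2E e1E; exact: (along_lieV oA sp1 sp2 sf Au).
Qed.

(** Differentiating the orthonormality relations gives all components but
    those of the connection and of the second fundamental form. The latter are
    symmetric in three indices: <X_a e_b, i e_c> is symmetric in b and c since
    <e_b, i e_c> = 0, and in a and b since the bracket of the fields is
    tangent. *)
Lemma structure_dots u : A u -> [/\
  [/\ dot (along p1 e1 u) (f u) = -1, dot (along p2 e1 u) (f u) = 0,
      dot (along p1 e2 u) (f u) = 0 & dot (along p2 e2 u) (f u) = -1],
  [/\ dot (along p1 e1 u) (muli (f u)) = 0, dot (along p2 e1 u) (muli (f u)) = 0,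
      dot (along p1 e2 u) (muli (f u)) = 0 & dot (along p2 e2 u) (muli (f u)) = 0],
  [/\ dot (along p1 e1 u) (e1 u) = 0, dot (along p2 e1 u) (e1 u) = 0,
      dot (along p1 e2 u) (e2 u) = 0 & dot (along p2 e2 u) (e2 u) = 0],
  [/\ dot (along p1 e2 u) (e1 u) = - w1 u & dot (along p2 e2 u) (e1 u) = - w2 u] &
  [/\ dot (along p1 e2 u) (muli (e1 u)) = b u, dot (along p2 e1 u) (muli (e1 u)) = b u,
      dot (along p1 e2 u) (muli (e2 u)) = c u & dot (along p2 e2 u) (muli (e1 u)) = c u]].
Proof.
move=> Au; have T := frame_rules Au.
have T1 x (Ax : A x) : dot (e1 x) (f x) = 0 by rewrite (frame_rules Ax).
have T2 x (Ax : A x) : dot (e2 x) (f x) = 0 by rewrite (frame_rules Ax).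
have T3 x (Ax : A x) : dot (e1 x) (muli (f x)) = 0 by rewrite (frame_rules Ax).
have T4 x (Ax : A x) : dot (e2 x) (muli (f x)) = 0 by rewrite (frame_rules Ax).
have T5 x (Ax : A x) : dot (e1 x) (e1 x) = 1 by rewrite (frame_rules Ax).
have T6 x (Ax : A x) : dot (e2 x) (e2 x) = 1 by rewrite (frame_rules Ax).
have T7 x (Ax : A x) : dot (e2 x) (e1 x) = 0 by rewrite (frame_rules Ax).
have T8 x (Ax : A x) : dot (e2 x) (muli (e1 x)) = 0 by rewrite (frame_rules Ax).
have E1 := e1u' u; have E2 := e2u' u.
have [F11 G11] := along_frame p1 se1 T1 T3 Au.
have [F21 G21] := along_frame p2 se1 T1 T3 Au.
have [F12 G12] := along_frame p1 se2 T2 T4 Au.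
have [F22 G22] := along_frame p2 se2 T2 T4 Au.
rewrite E1 ?T ?oppr0 in F11 G11 F12 G12.
rewrite E2 ?T ?oppr0 in F21 G21 F22 G22.
have half (x : R) : x = - x -> x = 0.
  by move=> /eqP; rewrite -subr_eq0 opprK -mulr2n mulrn_eq0 /= => /eqP.
have Z p (e : R * R -> V6) : sm e -> (forall x, A x -> dot (e x) (e x) = 1) ->
    dot (along p e u) (e u) = 0.
  by move=> se ee; apply: half; rewrite {1}(along_dot_cst p se se ee Au) dotC.
have O1 := along_dot_cst p1 se2 se1 T7 Au.
have O2 := along_dot_cst p2 se2 se1 T7 Au.
have I1 := along_dot_cst p1 se2 (sm_muli oA se1) T8 Au.
have I2 := along_dot_cst p2 se2 (sm_muli oA se1) T8 Au.
rewrite (along_muli p1 se1 Au) -N in I1.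
rewrite (along_muli p2 se1 Au) -N in I2.
have L q : dot (along p1 e2 u) (muli (along q f u)) = dot (along p2 e1 u) (muli (along q f u)).
  apply/eqP; rewrite -subr_eq0 -dotBl (lie_p12E Au) !along_def; apply/eqP; exact: leg.
have L1 := L p1; have L2 := L p2; rewrite E1 in L1; rewrite E2 in L2.
have w1u := w1u' u.
have w2u := w2u' u.
have bu := bu' u.
have cu := cu' u.
have B := etrans I1 bu; have C := etrans I2 cu.
have B' := etrans (esym L1) B; have C' := etrans L2 cu.
have O1' := etrans O1 (congr1 -%R (etrans (dotC _ _) w1u)).
have O2' := etrans O2 (congr1 -%R (etrans (dotC _ _) w2u)).
split; split; [exact: F11|exact: F21|exact: F12|exact: F22|exact: G11|exact: G21
  |exact: G12|exact: G22|exact: Z se1 T5|exact: Z se1 T5|exact: Z se2 T6|exact: Z se2 T6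
  |exact: O1'|exact: O2'|exact: B|exact: B'|exact: C'|exact: C].
Qed.

Lemma structure_eqs u : A u -> [/\
  along p1 e1 u = - f u + w1 u *: e2 u + a u *: muli (e1 u) + b u *: muli (e2 u),
  along p2 e1 u = w2 u *: e2 u + b u *: muli (e1 u) + c u *: muli (e2 u),
  along p1 e2 u = - w1 u *: e1 u + b u *: muli (e1 u) + c u *: muli (e2 u) &
  along p2 e2 u = - f u - w2 u *: e1 u + c u *: muli (e1 u) + d u *: muli (e2 u)].
Proof.
move=> Au; have T := frame_rules Au; have Fr := fr Au.
have w1u := w1u' u.
have w2u := w2u' u.
have au := au' u.
have bu := bu' u.
have cu := cu' u.
have du := du' u.
have [[F11 F21 F12 F22] [G11 G21 G12 G22] [Z1 Z2 Z3 Z4] [K1 K2] [B B2 C2 C]] :=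
  structure_dots Au.
move: w1u w2u au bu cu du F11 F21 F12 F22 G11 G21 G12 G22 Z1 Z2 Z3 Z4 K1 K2 B B2 C2 C.
move: (along p1 e1 u) (along p2 e1 u) (along p1 e2 u) (along p2 e2 u).
move: (w1 u) (w2 u) (a u) (b u) (c u) (d u) (f u) (e1 u) (e2 u) T Fr.
move=> v1 v2 ra rb rc rd g k1 k2 T Fr x11 x21 x12 x22.
move=> h1 h2 h3 h4 h5 h6 h7 h8 h9 h10 h11 h12 h13 h14 h15 h16 h17 h18 h19 h20 h21 h22 h23 h24.
split; apply: (frame_ext Fr); rewrite ?(h1, h2, h3, h4, h5, h6, h7, h8, h9, h10, h11, h12,
  h13, h14, h15, h16, h17, h18, h19, h20, h21, h22, h23, h24);
  rewrite ?(dotDl, dotZl, dotNl, dot_muli2, dot_muli) ?T; ring.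
Qed.

(** The bracket is identified by its image under the differential of f, which
    is injective. *)
Lemma lie_frame u : A u ->
  lie p1 p2 u = (- (w1 u * (p1 u).1 + w2 u * (p2 u).1), - (w1 u * (p1 u).2 + w2 u * (p2 u).2)).
Proof.
move=> Au; have L := lie_p12E Au; have [_ S2 S3 _] := structure_eqs Au.
set v := (- _, - _).
have D q := alongVE oA q sf Au.
have E1 := e1u' u; have E2 := e2u' u.
have D1 := etrans (esym (D p1)) E1; have D2 := etrans (esym (D p2)) E2.
have Dv : along (fun=> v) f u = - (w1 u *: e1 u + w2 u *: e2 u).
  apply: etrans (D (fun=> v)) _; rewrite -D1 -D2.
  move: ('D_ _ f u) ('D_ _ f u) => x y; rewrite /v /=.
  by apply/rowP => j; rewrite !mxE; ring.
have Dl : along (lie p1 p2) f u = - (w1 u *: e1 u + w2 u *: e2 u).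
  apply: etrans (esym L) _; apply: etrans (congr2 (fun x y => x - y) S3 S2) _.
  by apply/rowP => j; rewrite !mxE; ring.
have Z : along (fun=> lie p1 p2 u - v) f u = 0.
  apply: etrans (D (fun=> lie p1 p2 u - v)) _.
  have := congr2 (fun x y => x - y) (etrans (esym (D (lie p1 p2))) Dl)
     (etrans (esym (D (fun=> v))) Dv).
  move: ('D_ _ f u) ('D_ _ f u) => x y /=.
  by rewrite subrr => <-; apply/rowP => j; rewrite !mxE; ring.
have /eqP := imm Au (etrans (esym (along_def (fun=> lie p1 p2 u - v) f u)) Z).
by rewrite subr_eq0 => /eqP.
Qed.

Lemma along_lie_frame g u : sm g -> A u ->
  along p1 (along p2 g) u - along p2 (along p1 g) u =
  - (w1 u * along p1 g u + w2 u * along p2 g u).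
Proof.
move=> sg Au; apply: etrans (along_lie oA sp1 sp2 sg Au) _.
have D q := alongE oA q sg Au.
apply: etrans (D (lie p1 p2)) _; rewrite (lie_frame Au) /=.
rewrite (D p1) (D p2); move: ('D_ _ g u) ('D_ _ g u) => x y; ring.
Qed.

Lemma along_lie_frameV (g : R * R -> V6) u : sm g -> A u ->
  along p1 (along p2 g) u - along p2 (along p1 g) u =
  - (w1 u *: along p1 g u + w2 u *: along p2 g u).
Proof.
move=> sg Au; apply: etrans (along_lieV oA sp1 sp2 sg Au) _.
have D q := alongVE oA q sg Au.
apply: etrans (D (lie p1 p2)) _; rewrite (lie_frame Au) /=.
rewrite (D p1) (D p2); move: ('D_ _ g u) ('D_ _ g u) => x y.
by apply/rowP => j; rewrite !mxE; ring.
Qed.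

(** Apply the commutator of the frame fields to g and pair with k: the two
    sides of the equations of Gauss and Codazzi are instances. *)
Lemma curvature_identity (g k : R * R -> V6) (c1 c2 : R * R -> R) u : sm g -> sm k -> A u ->
  (forall x, A x -> dot (along p1 g x) (k x) = c1 x) ->
  (forall x, A x -> dot (along p2 g x) (k x) = c2 x) ->
  along p1 c2 u - along p2 c1 u = - (w1 u * c1 u + w2 u * c2 u) +
    dot (along p2 g u) (along p1 k u) - dot (along p1 g u) (along p2 k u).
Proof.
move=> sg sk Au E1 E2.
have G1 : along p2 c1 u = _ := etrans (along_eq oA p2 (fun x Ax => esym (E1 x Ax)) Au)
   (along_dot p2 (sm_alongV oA sp1 sg) sk Au).
have G2 : along p1 c2 u = _ := etrans (along_eq oA p1 (fun x Ax => esym (E2 x Ax)) Au)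
   (along_dot p1 (sm_alongV oA sp2 sg) sk Au).
exact: (commutator_pairing (along_lie_frameV sg Au) (E1 u Au) (E2 u Au) G2 G1).
Qed.

Lemma curvature_identity_muli (g k : R * R -> V6) (c1 c2 : R * R -> R) u :
  sm g -> sm k -> A u ->
  (forall x, A x -> dot (along p1 g x) (muli (k x)) = c1 x) ->
  (forall x, A x -> dot (along p2 g x) (muli (k x)) = c2 x) ->
  along p1 c2 u - along p2 c1 u = - (w1 u * c1 u + w2 u * c2 u) +
    dot (along p2 g u) (muli (along p1 k u)) - dot (along p1 g u) (muli (along p2 k u)).
Proof.
move=> sg sk Au E1 E2.
apply: etrans (curvature_identity sg (sm_muli oA sk) Au E1 E2) _.
exact: (congr2 (fun x y => _ + dot _ x - dot _ y) (along_muli p1 sk Au) (along_muli p2 sk Au)).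
Qed.

(** Gauss is the commutator on e1 paired with e2, Codazzi the commutators on
    e1, e2 paired with i e1, i e2. *)
Lemma gauss_codazzi u : A u -> [/\
  along p1 w2 u - along p2 w1 u =
    - (w1 u ^+ 2 + w2 u ^+ 2) + b u ^+ 2 + c u ^+ 2 - 1 - a u * c u - b u * d u,
  along p1 b u - along p2 a u = - w1 u * a u - 3 * w2 u * b u + 2 * w1 u * c u,
  along p1 c u - along p2 b u =
    - 2 * w1 u * b u - 2 * w2 u * c u + w2 u * a u + w1 u * d u &
  along p1 d u - along p2 c u = - 3 * w1 u * c u - w2 u * d u + 2 * w2 u * b u].
Proof.
move=> Au; have T := frame_rules Au; have [S11 S21 S12 S22] := structure_eqs Au.
have se1 := se1; have se2 := se2.
have D21 x : A x -> dot (along p2 e1 x) (muli (e1 x)) = b x.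
  by move=> Ax; have [_ _ _ _ [_ B _ _]] := structure_dots Ax; exact: B.
have D12 x : A x -> dot (along p1 e2 x) (muli (e2 x)) = c x.
  by move=> Ax; have [_ _ _ _ [_ _ B _]] := structure_dots Ax; exact: B.
have K0 := curvature_identity se1 se2 Au (fun x _ => w1u' x) (fun x _ => w2u' x).
have K1 := curvature_identity_muli se1 se1 Au (fun x _ => au' x) D21.
have K2 := curvature_identity_muli se1 se2 Au (fun x _ => bu' x) (fun x _ => cu' x).
have K3 := curvature_identity_muli se2 se2 Au D12 (fun x _ => du' x).
move: K0 K1 K2 K3 S11 S21 S12 S22.
move: (along p1 e1 u) (along p2 e1 u) (along p1 e2 u) (along p2 e2 u).
move=> x11 x21 x12 x22 K0 K1 K2 K3 S11 S21 S12 S22.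
move: K0 K1 K2 K3; rewrite {}S11 {}S21 {}S12 {}S22.
rewrite ?(muliD, muliZ, muliN, dotDl, dotDr, dotZl, dotZr, dotNl, dotNr,
  dot_muli2, dot_muli, muliK) !T => K0 K1 K2 K3.
split; [apply: etrans K0 _|apply: etrans K1 _|apply: etrans K2 _|apply: etrans K3 _]; ring.
Qed.

End Structure.

#[local] Transparent derive along.

#[local] Opaque derive along.

(** Here w1, w2 are the connection coefficients <X1 e1, e2> and <X2 e1, e2>,
    and a, b, c, d are the components 111, 112, 122, 222 of the cubic form
    <B(x, y), i z>. *)
Record moving_frame {R : realType} (A : set (R * R)) (f e1 e2 : R * R -> 'rV[R]_(3 + 3))
    (p1 p2 : R * R -> R * R) (w1 w2 a b c d : R * R -> R) : Prop := MovingFrame {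
  mf_open : open A;
  mf_f : smooth_on A f;
  mf_p1 : smooth_field A p1;
  mf_p2 : smooth_field A p2;
  mf_e1 : smooth_on A e1;
  mf_e2 : smooth_on A e2;
  mf_w1 : smooth_on A w1;
  mf_w2 : smooth_on A w2;
  mf_a : smooth_on A a;
  mf_b : smooth_on A b;
  mf_c : smooth_on A c;
  mf_d : smooth_on A d;
  mf_frame : forall u, A u -> legendrian_frame (f u) (e1 u) (e2 u);
  mf_along1 : forall u, along p1 f u = e1 u;
  mf_along2 : forall u, along p2 f u = e2 u;
  mf_structure : forall u, A u -> [/\
    along p1 e1 u = - f u + w1 u *: e2 u + a u *: muli (e1 u) + b u *: muli (e2 u),
    along p2 e1 u = w2 u *: e2 u + b u *: muli (e1 u) + c u *: muli (e2 u),
    along p1 e2 u = - w1 u *: e1 u + b u *: muli (e1 u) + c u *: muli (e2 u) &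
    along p2 e2 u = - f u - w2 u *: e1 u + c u *: muli (e1 u) + d u *: muli (e2 u)];
  mf_lie : forall u, A u -> lie p1 p2 u =
    (- (w1 u * (p1 u).1 + w2 u * (p2 u).1), - (w1 u * (p1 u).2 + w2 u * (p2 u).2));
  mf_commutator : forall g u, smooth_on A g -> A u ->
    along p1 (along p2 g) u - along p2 (along p1 g) u =
    - (w1 u * along p1 g u + w2 u * along p2 g u);
  mf_gauss_codazzi : forall u, A u -> [/\
    along p1 w2 u - along p2 w1 u =
      - (w1 u ^+ 2 + w2 u ^+ 2) + b u ^+ 2 + c u ^+ 2 - 1 - a u * c u - b u * d u,
    along p1 b u - along p2 a u = - w1 u * a u - 3 * w2 u * b u + 2 * w1 u * c u,
    along p1 c u - along p2 b u =
      - 2 * w1 u * b u - 2 * w2 u * c u + w2 u * a u + w1 u * d u &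
    along p1 d u - along p2 c u = - 3 * w1 u * c u - w2 u * d u + 2 * w2 u * b u] }.

Section Construction.
Context {R : realType} (A : set (R * R)) (oA : open A).
Notation V6 := 'rV[R]_(3 + 3).
Notation sm := (smooth_on A).
Variables (f : R * R -> V6) (p1 p2 : R * R -> R * R).
Hypotheses (sf : sm f) (sp1 : smooth_field A p1) (sp2 : smooth_field A p2).
Hypothesis imm : forall u v, A u -> 'D_v f u = 0 -> v = 0.
Hypothesis leg : forall u v w, A u -> dot ('D_v f u) (muli ('D_w f u)) = 0.
Let e1 := along p1 f.
Let e2 := along p2 f.
Hypothesis fr : forall u, A u -> legendrian_frame (f u) (e1 u) (e2 u).

Lemma moving_frame_of_fields : moving_frame A f e1 e2 p1 p2
  (fun u => dot (along p1 e1 u) (e2 u)) (fun u => dot (along p2 e1 u) (e2 u))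
  (fun u => dot (along p1 e1 u) (muli (e1 u))) (fun u => dot (along p1 e1 u) (muli (e2 u)))
  (fun u => dot (along p2 e1 u) (muli (e2 u))) (fun u => dot (along p2 e2 u) (muli (e2 u))).
Proof.
have s1 : sm e1 by exact: (sm_alongV oA).
have s2 : sm e2 by exact: (sm_alongV oA).
have s11 : sm (along p1 e1) := sm_alongV oA sp1 s1.
have s21 : sm (along p2 e1) := sm_alongV oA sp2 s1.
have s22 : sm (along p2 e2) := sm_alongV oA sp2 s2.
have i1 := sm_muli oA s1; have i2 := sm_muli oA s2.
have E (T : Type) (x : T) := erefl x.
split.
- exact: oA.
- exact: sf.
- exact: sp1.
- exact: sp2.
- exact: s1.
- exact: s2.
- exact: (sm_dot oA s11 s2).
- exact: (sm_dot oA s21 s2).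
- exact: (sm_dot oA s11 i1).
- exact: (sm_dot oA s11 i2).
- exact: (sm_dot oA s21 i2).
- exact: (sm_dot oA s22 i2).
- exact: fr.
- by move=> u.
- by move=> u.
- exact: (structure_eqs oA sf sp1 sp2 leg fr (E _ _) (E _ _) (E _ _) (E _ _) (E _ _)
    (E _ _) (E _ _) (E _ _)).
- exact: (lie_frame oA sf sp1 sp2 imm leg fr (E _ _) (E _ _) (E _ _) (E _ _) (E _ _) (E _ _)
    (E _ _) (E _ _)).
- exact: (along_lie_frame oA sf sp1 sp2 imm leg fr (E _ _) (E _ _) (E _ _) (E _ _) (E _ _)
    (E _ _) (E _ _) (E _ _)).
- exact: (gauss_codazzi oA sf sp1 sp2 imm leg fr (E _ _) (E _ _) (E _ _) (E _ _) (E _ _)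
    (E _ _) (E _ _) (E _ _)).
Qed.
End Construction.

#[local] Transparent derive along.

(** * The Euler-Lagrange field in a moving frame *)

#[local] Opaque derive along.

Section EulerLagrange.
Context {R : realType}.
Variables (A : set (R * R)) (f e1 e2 : R * R -> 'rV[R]_(3 + 3)).
Variables (p1 p2 : R * R -> R * R) (w1 w2 a b c d : R * R -> R).
Hypothesis M : moving_frame A f e1 e2 p1 p2 w1 w2 a b c d.
Variable h : R * R -> R.
Notation V6 := 'rV[R]_(3 + 3).
Notation sm := (smooth_on A).

Definition mean_vector : R * R -> V6 := fun u => h u *: muli (e1 u).
(** Up to a sign, the two stress fields are the coefficients of the first
    derivatives of V in the first variation, after one integration by parts in
    its second-order term. *)
Definition stress1 : R * R -> V6 := fun u => 2^-1 *: along p1 mean_vector u +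
  (h u * a u - (4^-1 * h u ^+ 2 + 1)) *: e1 u + (h u * b u) *: e2 u.
Definition stress2 : R * R -> V6 := fun u => 2^-1 *: along p2 mean_vector u +
  (h u * b u) *: e1 u + (h u * c u - (4^-1 * h u ^+ 2 + 1)) *: e2 u.
(** The divergence of the two stress fields, plus H. In coordinates this is
    the Euler-Lagrange field of the Willmore functional; it is kept in
    divergence form because the first variation produces it so. *)
Definition willmore_field : R * R -> V6 := fun u =>
  along p1 stress1 u + along p2 stress2 u + (w2 u *: stress1 u - w1 u *: stress2 u) +
  mean_vector u.

Hypothesis sh : sm h.

Let oA := mf_open M.
Let sf := mf_f M.
Let se1 := mf_e1 M.
Let se2 := mf_e2 M.
Let i1 := sm_muli oA se1.
Let i2 := sm_muli oA se2.

Lemma sm_mean_vector : sm mean_vector.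
Proof. exact: (sm_scale oA sh i1). Qed.

Let smH p : smooth_field A p -> sm (along p mean_vector).
Proof. by move=> sp; exact: (sm_alongV oA sp sm_mean_vector). Qed.

Let sk : sm (fun u => 4^-1 * h u ^+ 2 + 1).
Proof.
apply: (sm_eq oA (f := fun u => 4^-1 * (h u * h u) + 1)); first by move=> x _; rewrite expr2.
exact: (sm_add oA (sm_mul oA (sm_cst A _) (sm_mul oA sh sh)) (sm_cst A _)).
Qed.

Lemma sm_stress1 : sm stress1.
Proof.
apply: (sm_add oA); last exact: (sm_scale oA (sm_mul oA sh (mf_b M)) se2).
apply: (sm_add oA); first exact: (sm_scale oA (sm_cst A _) (smH (mf_p1 M))).
exact: (sm_scale oA (sm_add oA (sm_mul oA sh (mf_a M)) (sm_opp oA sk)) se1).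
Qed.

Lemma sm_stress2 : sm stress2.
Proof.
apply: (sm_add oA); last first.
  exact: (sm_scale oA (sm_add oA (sm_mul oA sh (mf_c M)) (sm_opp oA sk)) se2).
apply: (sm_add oA); first exact: (sm_scale oA (sm_cst A _) (smH (mf_p2 M))).
exact: (sm_scale oA (sm_mul oA sh (mf_b M)) se1).
Qed.

Lemma along_mean_vector p u : A u ->
  along p mean_vector u = along p h u *: muli (e1 u) + h u *: muli (along p e1 u).
Proof.
move=> Au; apply: etrans (along_scale p sh i1 Au) _.
exact: (congr1 (fun x => _ + _ *: x) (along_muli p se1 Au)).
Qed.

Lemma stress_expansion u : A u ->
  stress1 u = (2^-1 * along p1 h u) *: muli (e1 u) - (2^-1 * h u) *: muli (f u) +
     (2^-1 * h u * w1 u) *: muli (e2 u) +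
     (2^-1 * h u * a u - (4^-1 * h u ^+ 2 + 1)) *: e1 u + (2^-1 * h u * b u) *: e2 u /\
  stress2 u = (2^-1 * along p2 h u) *: muli (e1 u) + (2^-1 * h u * w2 u) *: muli (e2 u) +
     (2^-1 * h u * b u) *: e1 u + (2^-1 * h u * c u - (4^-1 * h u ^+ 2 + 1)) *: e2 u.
Proof.
move=> Au; have [S11 S21 _ _] := mf_structure M Au.
have H1 := etrans (along_mean_vector p1 Au) (congr1 (fun x => _ + _ *: muli x) S11).
have H2 := etrans (along_mean_vector p2 Au) (congr1 (fun x => _ + _ *: muli x) S21).
split; [rewrite /stress1 H1|rewrite /stress2 H2]; move: (along _ h u) => dh;
  rewrite !(muliD, muliN, muliZ, muliK); apply/rowP => j; rewrite !mxE; by field.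
Qed.

Lemma along_dotl p (g k : R * R -> V6) (c0 : R * R -> R) u : sm g -> sm k -> A u ->
  (forall x, A x -> dot (g x) (muli (k x)) = c0 x) ->
  dot (along p g u) (muli (k u)) = along p c0 u - dot (g u) (muli (along p k u)).
Proof.
move=> sg sk0 Au gk.
have E := etrans (esym (along_eq oA p gk Au)) (along_dot p sg (sm_muli oA sk0) Au).
have F := congr1 (fun x => dot (g u) x) (along_muli p sk0 Au).
have key (x y z w : R) : w = x + y -> y = z -> x = w - z by move=> -> ->; rewrite addrK.
exact: (key _ _ _ _ E F).
Qed.

Lemma along_half p (g : R * R -> R) u : sm g -> A u ->
  along p (fun x => 2^-1 * g x) u = 2^-1 * along p g u.
Proof.
move=> sg Au; apply: etrans (alongM p (sm_cst A _) sg Au) _.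
rewrite along_cst mul0r add0r; reflexivity.
Qed.

Let frame_zero u (Au : A u) := frame_rules (mf_frame M) Au.

Lemma stress_dots u : A u -> [/\
  [/\ dot (stress1 u) (muli (f u)) = - (2^-1 * h u),
      dot (stress1 u) (muli (e1 u)) = 2^-1 * along p1 h u &
      dot (stress1 u) (muli (e2 u)) = 2^-1 * (h u * w1 u)],
  [/\ dot (stress2 u) (muli (f u)) = 0,
      dot (stress2 u) (muli (e1 u)) = 2^-1 * along p2 h u &
      dot (stress2 u) (muli (e2 u)) = 2^-1 * (h u * w2 u)],
  [/\ dot (stress1 u) (muli (e1 u)) = 2^-1 * along p1 h u,
      dot (stress1 u) (e1 u) = 2^-1 * h u * a u - (4^-1 * h u ^+ 2 + 1) &
      dot (stress1 u) (e2 u) = 2^-1 * h u * b u],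
  [/\ dot (stress2 u) (e1 u) = 2^-1 * h u * b u &
      dot (stress2 u) (e2 u) = 2^-1 * h u * c u - (4^-1 * h u ^+ 2 + 1)] &
  dot (stress1 u) (f u) = 0 /\ dot (stress2 u) (f u) = 0].
Proof.
move=> Au; have [-> ->] := stress_expansion Au; have T := frame_zero Au.
move: (along p1 h u) (along p2 h u) => dh1 dh2.
split; split; rewrite ?(dotDl, dotZl, dotNl, dot_muli2, dot_muli) ?T; by ring.
Qed.

(** Integrates by parts pointwise: the field is only differentiated through
    scalar products with i k, for which the structure equations apply. *)
Lemma willmore_pairing (k : R * R -> V6) (c1 c2 : R * R -> R) u : sm k -> A u ->
  (forall x, A x -> dot (stress1 x) (muli (k x)) = c1 x) ->
  (forall x, A x -> dot (stress2 x) (muli (k x)) = c2 x) ->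
  dot (willmore_field u) (muli (k u)) =
    along p1 c1 u - dot (stress1 u) (muli (along p1 k u)) +
    (along p2 c2 u - dot (stress2 u) (muli (along p2 k u))) +
    (w2 u * c1 u - w1 u * c2 u) + h u * dot (e1 u) (k u).
Proof.
move=> sk0 Au E1 E2.
have D1 := along_dotl p1 sm_stress1 sk0 Au E1.
have D2 := along_dotl p2 sm_stress2 sk0 Au E2.
have D3 := E1 u Au; have D4 := E2 u Au.
have key (x1 x2 y1 y2 z l m : V6) (q1 q2 r1 r2 s1 s2 v1 v2 t : R) :
    dot x1 l = q1 - r1 -> dot x2 l = q2 - r2 -> dot y1 l = s1 -> dot y2 l = s2 ->
    dot z l = t ->
    dot (x1 + x2 + (v2 *: y1 - v1 *: y2) + z) l =
      q1 - r1 + (q2 - r2) + (v2 * s1 - v1 * s2) + t.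
  by move=> h1 h2 h3 h4 h5; rewrite !(dotDl, dotNl, dotZl) h1 h2 h3 h4 h5.
apply: (key _ _ _ _ _ _ 0 _ _ _ _ _ _ _ _ _ D1 D2 D3 D4).
by rewrite dotZl dot_muli2.
Qed.

Hypothesis EL : forall u, A u -> [/\ dot (willmore_field u) (muli (f u)) = 0,
  dot (willmore_field u) (muli (e1 u)) = 0 & dot (willmore_field u) (muli (e2 u)) = 0].

(** The first equation has no second derivative, since H is orthogonal to i f:
    this is where the Legendrian condition makes the Willmore equation
    overdetermined. *)
Lemma euler_lagrange_scalar u : A u -> [/\ along p1 h u = - (h u * w2 u),
  along p1 (along p1 h) u + along p2 (along p2 h) u
  - (h u + h u * w1 u ^+ 2 - a u * (h u * a u - (2^-1 * h u ^+ 2 + 2)) - h u * b u ^+ 2)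
  - (h u * w2 u ^+ 2 - h u * b u ^+ 2 - c u * (h u * c u - (2^-1 * h u ^+ 2 + 2)))
  + w2 u * along p1 h u - w1 u * along p2 h u + 2 * h u = 0 &
  along p1 (fun x => h x * w1 x) u + along p2 (fun x => h x * w2 x) u
  + (w1 u * along p1 h u + b u * (h u * a u - (2^-1 * h u ^+ 2 + 2)) + h u * b u * c u)
  + (w2 u * along p2 h u + c u * h u * b u + d u * (h u * c u - (2^-1 * h u ^+ 2 + 2))) = 0].
Proof.
move=> Au; have T := frame_zero Au.
have [S11 S21 S12 S22] := mf_structure M Au.
have [[z1f z1i1 z1i2] [z2f z2i1 z2i2] [_ z11 z12] [z21 z22] [z1 z2]] := stress_dots Au.
have [E0 E1 E2] := EL Au.
have s1 := sm_along oA (mf_p1 M) sh; have s2 := sm_along oA (mf_p2 M) sh.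
have sw1 := sm_mul oA sh (mf_w1 M); have sw2 := sm_mul oA sh (mf_w2 M).
have q1f x (Ax : A x) : dot (stress1 x) (muli (f x)) = (fun x => - (2^-1 * h x)) x.
  by have := stress_dots Ax => -[[q _ _] _ _ _ _]; exact: q.
have q2f x (Ax : A x) : dot (stress2 x) (muli (f x)) = (fun x => 0) x.
  by have := stress_dots Ax => -[_ [q _ _] _ _ _]; exact: q.
have q11 x (Ax : A x) : dot (stress1 x) (muli (e1 x)) = (fun x => 2^-1 * along p1 h x) x.
  by have := stress_dots Ax => -[[_ q _] _ _ _ _]; exact: q.
have q21 x (Ax : A x) : dot (stress2 x) (muli (e1 x)) = (fun x => 2^-1 * along p2 h x) x.
  by have := stress_dots Ax => -[_ [_ q _] _ _ _]; exact: q.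
have q12 x (Ax : A x) : dot (stress1 x) (muli (e2 x)) = (fun x => 2^-1 * (h x * w1 x)) x.
  by have := stress_dots Ax => -[[_ _ q] _ _ _ _]; exact: q.
have q22 x (Ax : A x) : dot (stress2 x) (muli (e2 x)) = (fun x => 2^-1 * (h x * w2 x)) x.
  by have := stress_dots Ax => -[_ [_ _ q] _ _ _]; exact: q.
have W0 := willmore_pairing sf Au q1f q2f.
have W1 := willmore_pairing se1 Au q11 q21.
have W2 := willmore_pairing se2 Au q12 q22.
have {}W0 := etrans (esym W0) E0.
have {}W1 := etrans (esym W1) E1.
have {}W2 := etrans (esym W2) E2.
have A0 : along p1 (fun x => - (2^-1 * h x)) u = - (2^-1 * along p1 h u).
  have K := @along_opp _ _ A _ p1 (fun x => 2^-1 * h x) u (sm_mul oA (sm_cst A _) sh) Au.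
  exact: (etrans K (congr1 -%R (along_half p1 sh Au))).
have A0' : along p2 (fun=> (0 : R)) u = 0 by exact: along_cst.
have A1 := along_half p1 s1 Au; have A2 := along_half p2 s2 Au.
have A3 := along_half p1 sw1 Au; have A4 := along_half p2 sw2 Au.
have F1 := mf_along1 M u; have F2 := mf_along2 M u.
have e0 (x y z t t' x' y' : R) (l l' k k' : V6) (m1 m2 : V6) :
    x - dot l (muli k) + (y - dot l' (muli k')) + z + t = 0 ->
    x = x' -> y = y' -> k = m1 -> k' = m2 -> t = t' ->
    x' - dot l (muli m1) + (y' - dot l' (muli m2)) + z + t' = 0.
  by move=> + <- <- <- <- <-.
have t0 : h u * dot (e1 u) (f u) = 0 by rewrite T mulr0.
have t1 : h u * dot (e1 u) (e1 u) = h u by rewrite T mulr1.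
have t2 : h u * dot (e1 u) (e2 u) = 0 by rewrite T mulr0.
have {}W0 := e0 _ _ _ _ _ _ _ _ _ _ _ _ _ W0 A0 A0' F1 F2 t0.
have {}W1 := e0 _ _ _ _ _ _ _ _ _ _ _ _ _ W1 A1 A2 S11 S21 t1.
have {}W2 := e0 _ _ _ _ _ _ _ _ _ _ _ _ _ W2 A3 A4 S12 S22 t2.
move: W0 W1 W2 {S11 S21 S12 S22 F1 F2 q1f q2f q11 q21 q12 q22}.
move: (stress1 u) (stress2 u) z1f z1i1 z1i2 z2f z2i1 z2i2 z11 z12 z21 z22 z1 z2.
move=> x1 x2 z1f z1i1 z1i2 z2f z2i1 z2i2 z11 z12 z21 z22 z1 z2 /=.
rewrite !(muliD, muliN, muliZ, muliK, dotDr, dotNr, dotZr).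
rewrite z1f z1i1 z1i2 z2f z2i1 z2i2 z11 z12 z21 z22.
move: (along p1 h u) (along p2 h u) (along p1 (along p1 h) u) (along p2 (along p2 h) u)
  (along p1 _ u) (along p2 _ u) => h1 h2 h11 h22 hw1 hw2 E0' E1' E2'.
have two0 : 2%:R != 0 :> R by [].
split.
- by apply/eqP; rewrite -subr_eq0 -oppr_eq0; apply/eqP; rewrite -[RHS]E0'; field.
- by apply: (mulfI (x := 2^-1)); [rewrite invr_eq0|rewrite mulr0 -[RHS]E1'; field].
- by apply: (mulfI (x := 2^-1)); [rewrite invr_eq0|rewrite mulr0 -[RHS]E2'; field].
Qed.


End EulerLagrange.

#[local] Transparent derive along.

(** * Rigidity: the inverse mean curvature oscillates *)

#[local] Opaque derive along.

Section Rigidity.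
Context {R : realType}.
Variables (A : set (R * R)) (f e1 e2 : R * R -> 'rV[R]_(3 + 3)).
Variables (p1 p2 : R * R -> R * R) (w1 w2 a b c d : R * R -> R).
Hypothesis M : moving_frame A f e1 e2 p1 p2 w1 w2 a b c d.
Variable h : R * R -> R.
Notation sm := (smooth_on A).
Hypothesis sh : sm h.
Hypothesis h_gt0 : forall u, A u -> 0 < h u.
Hypothesis ach : forall u, A u -> a u + c u = h u.
Hypothesis bd0 : forall u, A u -> b u + d u = 0.
Hypothesis EL : forall u, A u ->
  [/\ dot (willmore_field e1 e2 p1 p2 w1 w2 a b c h u) (muli (f u)) = 0,
      dot (willmore_field e1 e2 p1 p2 w1 w2 a b c h u) (muli (e1 u)) = 0 &
      dot (willmore_field e1 e2 p1 p2 w1 w2 a b c h u) (muli (e2 u)) = 0].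

Let oA := mf_open M.
Let s1 := sm_along oA (mf_p1 M) sh.
Let s2 := sm_along oA (mf_p2 M) sh.

Lemma along1_mean u : A u -> along p1 h u = - (h u * w2 u).
Proof. by move=> Au; have [E _ _] := euler_lagrange_scalar M sh EL Au; exact: E. Qed.

(** The sum of two Codazzi equations, with a + c = h and b + d = 0. *)
Lemma along2_mean u : A u -> along p2 h u = h u * w1 u.
Proof.
move=> Au; have [_ C1 _ C3] := mf_gauss_codazzi M Au.
have E1 : along p2 h u = along p2 a u + along p2 c u.
  apply: etrans (esym (along_eq oA p2 ach Au)) _.
  exact: (alongD p2 (mf_a M) (mf_c M) Au).
have E2 : along p1 b u + along p1 d u = 0.
  apply: etrans (esym (alongD p1 (mf_b M) (mf_d M) Au)) _.
  apply: etrans (along_eq oA p1 bd0 Au) _; exact: along_cst.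
have key (x1 x2 x3 x4 y ra rb rc rd v1 v2 rh : R) : y = x2 + x4 -> x1 + x3 = 0 ->
    x1 - x2 = - v1 * ra - 3 * v2 * rb + 2 * v1 * rc ->
    x3 - x4 = - 3 * v1 * rc - v2 * rd + 2 * v2 * rb ->
    ra + rc = rh -> rb + rd = 0 -> y = rh * v1.
  move=> -> H1 H2 H3 <- H4.
  have -> : x2 = x1 - (- v1 * ra - 3 * v2 * rb + 2 * v1 * rc) by rewrite -H2; ring.
  have -> : x4 = x3 - (- 3 * v1 * rc - v2 * rd + 2 * v2 * rb) by rewrite -H3; ring.
  have -> : x3 = - x1 by apply/eqP; rewrite -addr_eq0 addrC H1.
  have -> : rd = - rb by apply/eqP; rewrite -addr_eq0 addrC H4.
  ring.
exact: (key _ _ _ _ _ _ _ _ _ _ _ _ E1 E2 C1 C3 (ach Au) (bd0 Au)).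
Qed.

(** Substituting the first-order equations for h in the two second-order ones
    leaves, after the equation of Gauss, an algebraic system for a and b. *)
Lemma shape_at u : A u -> a u = 2^-1 * h u /\ b u = 0.
Proof.
move=> Au; have [_ E2 E3] := euler_lagrange_scalar M sh EL Au.
have [G _ _ _] := mf_gauss_codazzi M Au.
have H1 := along1_mean Au; have H2 := along2_mean Au.
have H11 : along p1 (along p1 h) u = - (along p1 h u * w2 u + h u * along p1 w2 u).
  apply: etrans (along_eq oA p1 along1_mean Au) _.
  apply: etrans (along_opp p1 (sm_mul oA sh (mf_w2 M)) Au) _.
  exact: (congr1 -%R (alongM p1 sh (mf_w2 M) Au)).
have H22 : along p2 (along p2 h) u = along p2 h u * w1 u + h u * along p2 w1 u.
  apply: etrans (along_eq oA p2 along2_mean Au) _.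
  exact: (alongM p2 sh (mf_w1 M) Au).
have H12 : along p1 (fun x => h x * w1 x) u = along p1 (along p2 h) u.
  exact: (along_eq oA p1 (fun x Ax => esym (along2_mean Ax)) Au).
have H21 : along p2 (fun x => h x * w2 x) u = - along p2 (along p1 h) u.
  apply: etrans (along_opp p2 s1 Au).
  apply: (along_eq oA p2 _ Au) => x Ax.
  exact: (esym (etrans (congr1 -%R (along1_mean Ax)) (opprK _))).
have C := mf_commutator M sh Au.
have key (h1 h2 h11 h22 h12 h21 x1 x2 k12 k21 ra rb rc rd v1 v2 rh : R) :
  rh != 0 -> ra + rc = rh -> rb + rd = 0 ->
  h1 = - (rh * v2) -> h2 = rh * v1 -> h11 = - (h1 * v2 + rh * x1) ->
  h22 = h2 * v1 + rh * x2 -> h12 = k12 -> h21 = - k21 -> k12 - k21 = - (v1 * h1 + v2 * h2) ->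
  x1 - x2 = - (v1 ^+ 2 + v2 ^+ 2) + rb ^+ 2 + rc ^+ 2 - 1 - ra * rc - rb * rd ->
  h11 + h22 - (rh + rh * v1 ^+ 2 - ra * (rh * ra - (2^-1 * rh ^+ 2 + 2)) - rh * rb ^+ 2)
  - (rh * v2 ^+ 2 - rh * rb ^+ 2 - rc * (rh * rc - (2^-1 * rh ^+ 2 + 2)))
  + v2 * h1 - v1 * h2 + 2 * rh = 0 ->
  h12 + h21 + (v1 * h1 + rb * (rh * ra - (2^-1 * rh ^+ 2 + 2)) + rh * rb * rc)
  + (v2 * h2 + rc * rh * rb + rd * (rh * rc - (2^-1 * rh ^+ 2 + 2))) = 0 ->
  ra = 2^-1 * rh /\ rb = 0.
  move=> rh0 ac bd -> -> -> -> -> -> K G' F2 F3.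
  have cE : rc = rh - ra by rewrite -ac addrAC subrr add0r.
  have dE : rd = - rb by apply/eqP; rewrite -addr_eq0 addrC bd.
  have xE : x1 = x2 + (- (v1 ^+ 2 + v2 ^+ 2) + rb ^+ 2 + rc ^+ 2 - 1 - ra * rc - rb * rd).
    by rewrite -G'; ring.
  have kE : k12 = k21 - (v1 * - (rh * v2) + v2 * (rh * v1)) by rewrite -K; ring.
  move: F2 F3; rewrite {}kE {}xE {}dE {}cE => F2 F3.
  split.
    apply: (mulfI rh0); apply: (mulfI rh0); apply/eqP; rewrite -subr_eq0; apply/eqP.
    by rewrite -[RHS]F2; field.
  apply: (mulfI rh0); apply: (mulfI rh0); rewrite !mulr0.
  by rewrite -[RHS]F3; field.
exact: (key _ _ _ _ _ _ _ _ _ _ _ _ _ _ _ _ _ (lt0r_neq0 (h_gt0 Au)) (ach Au) (bd0 Au)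
  H1 H2 H11 H22 H12 H21 C G E2 E3).
Qed.

(** Codazzi for the constant component b = 0. *)
Lemma connection1_eq0 u : A u -> w1 u = 0.
Proof.
move=> Au; have [_ C1 _ _] := mf_gauss_codazzi M Au.
have B : along p1 b u = 0.
  apply: etrans (along_eq oA p1 (fun x Ax => (shape_at Ax).2) Au) _; exact: along_cst.
have A2 : along p2 a u = 2^-1 * along p2 h u.
  apply: etrans (along_eq oA p2 (fun x Ax => (shape_at Ax).1) Au) _.
  exact: along_half.
have [aE b0] := shape_at Au; have H2 := along2_mean Au.
have key (x1 x2 h2 ra rb rc v1 v2 rh : R) : rh != 0 -> x1 - x2 = - v1 * ra - 3 * v2 * rb + 2 * v1 * rc ->
   x1 = 0 -> x2 = 2^-1 * h2 -> h2 = rh * v1 -> ra = 2^-1 * rh -> rb = 0 -> ra + rc = rh -> v1 = 0.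
  move=> rh0 E x10 x2E h2E aE' b0' ac; have cE : rc = rh - ra by rewrite -ac addrAC subrr add0r.
  rewrite x10 x2E h2E b0' cE aE' in E; apply: (mulfI rh0); rewrite mulr0.
  have -> : rh * v1 = - v1 * (2^-1 * rh) - 3 * v2 * 0 + 2 * v1 * (rh - 2^-1 * rh) -
     (0 - 2^-1 * (rh * v1)) by field.
  by rewrite -E subrr.
exact: (key _ _ _ _ _ _ _ _ _ (lt0r_neq0 (h_gt0 Au)) C1 B A2 H2 aE b0 (ach Au)).
Qed.

Lemma along_inverse_mean p u : A u ->
  along p (fun x => (h x)^-1) u = - (h u)^-1 ^+ 2 * along p h u.
Proof. by move=> Au; exact: (alongV p sh Au (lt0r_neq0 (h_gt0 Au))). Qed.

Let q u := (h u)^-1.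
Let sq : sm q.
Proof. by apply: (sm_inv oA _ sh) => x Ax; exact: (lt0r_neq0 (h_gt0 Ax)). Qed.

Lemma along1_inverse_mean u : A u -> along p1 q u = w2 u * q u.
Proof.
move=> Au; have h0 := lt0r_neq0 (h_gt0 Au).
apply: etrans (along_inverse_mean p1 Au) _.
apply: etrans (congr1 (fun x => _ * x) (along1_mean Au)) _.
by rewrite /q; field.
Qed.

Lemma along2_inverse_mean u : A u -> along p2 q u = 0.
Proof.
move=> Au; apply: etrans (along_inverse_mean p2 Au) _.
apply: etrans (congr1 (fun x => _ * x) (along2_mean Au)) _.
by rewrite (connection1_eq0 Au) !mulr0.
Qed.

(** The equation of Gauss is now X1 w2 = - 1 - w2^2, and X1 q = w2 q. *)
Theorem inverse_mean_oscillates u : A u ->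
  along p1 (along p1 q) u = - q u /\ along p2 (along p1 q) u = 0.
Proof.
move=> Au; have h0 := lt0r_neq0 (h_gt0 Au).
have [G _ _ _] := mf_gauss_codazzi M Au.
have W : along p2 w1 u = 0.
  by apply: etrans (along_eq oA p2 connection1_eq0 Au) _; exact: along_cst.
have [aE bE] := shape_at Au; have w10 := connection1_eq0 Au.
have W2 : along p1 w2 u = - (1 + w2 u ^+ 2).
  have key (x y ra rb rc rd v1 v2 rh : R) : x - y = - (v1 ^+ 2 + v2 ^+ 2) + rb ^+ 2
      + rc ^+ 2 - 1 - ra * rc - rb * rd -> y = 0 -> ra = 2^-1 * rh -> rb = 0 ->
      ra + rc = rh -> v1 = 0 -> x = - (1 + v2 ^+ 2).
    move=> E y0 aE' b0' ac v10; have cE : rc = rh - ra by rewrite -ac addrAC subrr add0r.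
    by rewrite y0 subr0 b0' v10 cE aE' in E; rewrite E; field.
  exact: (key _ _ _ _ _ _ _ _ _ G W aE bE (ach Au) w10).
split.
  apply: etrans (along_eq oA p1 along1_inverse_mean Au) _.
  apply: etrans (alongM p1 (mf_w2 M) sq Au) _.
  apply: etrans (congr2 (fun x y => x * q u + w2 u * y) W2 (along1_inverse_mean Au)) _.
  ring.
have C := mf_commutator M sq Au.
have Z : along p1 (along p2 q) u = 0.
  by apply: etrans (along_eq oA p1 along2_inverse_mean Au) _; exact: along_cst.
have key (x y v1 v2 y1 y2 : R) : x - y = - (v1 * y1 + v2 * y2) -> x = 0 -> v1 = 0 -> y2 = 0 -> y = 0.
  move=> E x0 v10 y20; rewrite x0 v10 y20 mul0r mulr0 addr0 oppr0 sub0r in E.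
  by apply/eqP; rewrite -oppr_eq0 E.
exact: (key _ _ _ _ _ _ C Z w10 (along2_inverse_mean Au)).
Qed.

End Rigidity.

#[local] Transparent derive along.

(** * Coordinate formulas for the mean curvature *)

Section Coordinates.
Context {R : realType}.
Notation V6 := 'rV[R]_(3 + 3).

Lemma invmx2 (M : 'M[R]_2) (x y z : R) :
  M 0 0 = x -> M 0 1 = y -> M 1 0 = y -> M 1 1 = z -> x * z - y ^+ 2 != 0 ->
  [/\ \det M = x * z - y ^+ 2, invmx M 0 0 = z / (x * z - y ^+ 2),
   invmx M 0 1 = - y / (x * z - y ^+ 2), invmx M 1 0 = - y / (x * z - y ^+ 2) &
   invmx M 1 1 = x / (x * z - y ^+ 2)].
Proof.
move=> Mx My My' Mz; set D := x * z - y ^+ 2 => D0.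
pose B : 'M[R]_2 := \matrix_(i, j)
  (if i == 0 then if j == 0 then z / D else - y / D else if j == 0 then - y / D else x / D).
have o1 : lift ord0 (ord0 : 'I_1) = 1 :> 'I_2 by apply: val_inj.
have c2 (i : 'I_2) : i = 0 \/ i = 1.
  by case: i => [[|[|//]] Hi]; [left|right]; apply: val_inj.
have MB : M *m B = 1%:M.
  apply/matrixP => i j; rewrite !mxE !big_ord_recl big_ord0 addr0 !mxE o1.
  by case: (c2 i) => ->; case: (c2 j) => -> /=; rewrite ?Mx ?My ?My' ?Mz /D ?mulr1n ?mulr0n; field; exact: D0.
have uM : M \in unitmx by case: (mulmx1_unit MB).
have -> : invmx M = B by rewrite -[RHS](mulKmx uM) MB mulmx1.
split; rewrite ?mxE//=.
rewrite (expand_det_row _ 0) !big_ord_recl big_ord0 addr0 /cofactor !det_mx11 !mxE /= o1.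
rewrite (_ : lift 1 0 = 0); last exact: val_inj.
by rewrite Mx My My' Mz /D /bump /= expr0 expr1; ring.
Qed.

Lemma big_ord2 (W : nmodType) (F : 'I_2 -> W) : \sum_i F i = F 0 + F 1.
Proof.
by rewrite big_ord_recl big_ord_recl big_ord0 addr0; congr (_ + F _); apply: val_inj.
Qed.

Definition gram (f1 f2 : V6) := dot f1 f1 * dot f2 f2 - dot f1 f2 ^+ 2.

(** The trace of the flat Hessian for the induced metric; its component normal
    to the surface in the sphere is H. *)
Definition raw_trace (f1 f2 f11 f12 f21 f22 : V6) : V6 :=
  (gram f1 f2)^-1 *: (dot f2 f2 *: f11 - dot f1 f2 *: (f12 + f21) + dot f1 f1 *: f22).

Definition normal_part (f f1 f2 N : V6) : V6 :=
  N - dot N f *: f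
  - ((gram f1 f2)^-1 * (dot f2 f2 * dot N f1 - dot f1 f2 * dot N f2)) *: f1
  - ((gram f1 f2)^-1 * (dot f1 f1 * dot N f2 - dot f1 f2 * dot N f1)) *: f2.

Lemma normal_partD f f1 f2 v w :
  normal_part f f1 f2 (v + w) = normal_part f f1 f2 v + normal_part f f1 f2 w.
Proof. by rewrite /normal_part !dotDl; apply/rowP => j; rewrite !mxE; ring. Qed.

Lemma normal_partZ f f1 f2 k v :
  normal_part f f1 f2 (k *: v) = k *: normal_part f f1 f2 v.
Proof. by rewrite /normal_part !dotZl; apply/rowP => j; rewrite !mxE; ring. Qed.

Definition mean_formula (f f1 f2 f11 f12 f21 f22 : V6) : V6 :=
  normal_part f f1 f2 (raw_trace f1 f2 f11 f12 f21 f22).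

#[local] Opaque partial derive.

(** The determinant and the inverse of the induced metric are written out, as
    the variation of the density differentiates them. *)
Lemma mean_curvatureE (f : R * R -> V6) u (f1 f2 f11 f12 f21 f22 : V6) :
  partial 0 f u = f1 -> partial 1 f u = f2 ->
  partial 0 (partial 0 f) u = f11 -> partial 0 (partial 1 f) u = f12 ->
  partial 1 (partial 0 f) u = f21 -> partial 1 (partial 1 f) u = f22 ->
  gram f1 f2 != 0 ->
  mean_curvature f u = mean_formula (f u) f1 f2 f11 f12 f21 f22 /\
  \det (induced_metric f u) = gram f1 f2.
Proof.
move=> D1 D2 D11 D12 D21 D22 G0.
have o1 : lift ord0 (ord0 : 'I_1) = 1 :> 'I_2 by apply: val_inj.
have M00 : induced_metric f u 0 0 = dot f1 f1 by rewrite mxE D1.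
have M01 : induced_metric f u 0 1 = dot f1 f2 by rewrite mxE D1 D2.
have M10 : induced_metric f u 1 0 = dot f1 f2 by rewrite mxE D1 D2 dotC.
have M11 : induced_metric f u 1 1 = dot f2 f2 by rewrite mxE D2.
have [dE I00 I01 I10 I11] := invmx2 M00 M01 M10 M11 G0.
split; last exact: dE.
have Tw w : tangent_part f u w =
    ((gram f1 f2)^-1 * (dot f2 f2 * dot w f1 - dot f1 f2 * dot w f2)) *: f1 +
    ((gram f1 f2)^-1 * (dot f1 f1 * dot w f2 - dot f1 f2 * dot w f1)) *: f2.
  apply: etrans (big_ord2 _) _.
  apply: etrans (congr2 +%R (big_ord2 _) (big_ord2 _)) _.
  rewrite I00 I01 I10 I11 D1 D2.
  rewrite -/(gram f1 f2).
  move: (gram f1 f2)^-1 (dot f1 f1) (dot f1 f2) (dot f2 f2) (dot w f1) (dot w f2).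
  move=> *; apply/rowP => l; rewrite !mxE.
  ring.
have S (i j : 'I_2) (w : V6) : partial i (partial j f) u = w ->
    second_form f i j u = normal_part (f u) f1 f2 w.
  move=> <-; rewrite /second_form Tw /normal_part.
  by rewrite opprD addrA.
apply: etrans (big_ord2 _) _.
apply: etrans (congr2 +%R (big_ord2 _) (big_ord2 _)) _.
rewrite (S 0 0 f11 D11) (S 0 1 f12 D12) (S 1 0 f21 D21) (S 1 1 f22 D22).
rewrite I00 I01 I10 I11.
have L (k1 k2 k3 k4 : R) : k1 *: normal_part (f u) f1 f2 f11 + k2 *: normal_part (f u) f1 f2 f12 +
    (k3 *: normal_part (f u) f1 f2 f21 + k4 *: normal_part (f u) f1 f2 f22) =
    normal_part (f u) f1 f2 (k1 *: f11 + k2 *: f12 + (k3 *: f21 + k4 *: f22)).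
  by rewrite !normal_partD !normal_partZ.
apply: etrans (L _ _ _ _) _; rewrite /mean_formula; congr normal_part.
rewrite /raw_trace -/(gram f1 f2).
move: (gram f1 f2)^-1 (dot f1 f1) (dot f1 f2) (dot f2 f2) => D x y z.
by apply/rowP => l; rewrite !mxE; ring.
Qed.

#[local] Transparent partial derive.

Lemma slice_derive (W : normedModType R) (K : R * (R * R) -> W) (t : R) (v : R * R) :
  'D_v (fun u => K (t, u)) = (fun u => 'D_((0, v) : R * (R * R)) K (t, u)).
Proof.
apply/funext => u; rewrite /derive.
suff -> : (fun h : R => h^-1 *: (((fun u => K (t, u)) \o shift u) (h *: v) - K (t, u))) =
  (fun h : R => h^-1 *: ((K \o shift (t, u)) (h *: ((0, v) : R * (R * R))) - K (t, u))).
  by [].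
apply/funext => h /=; rewrite (_ : h *: (0, v) + (t, u) = (t, h *: v + u))//.
by congr (_, _); rewrite /= scaler0 add0r.
Qed.

End Coordinates.

(** * First variation of the Willmore density *)

#[local] Opaque derive.

Section Values.
Context {R : realType}.
Notation V6 := 'rV[R]_(3 + 3).

(** The four definitions below are the derivatives, in this order, of the Gram
    determinant, of the trace of the Hessian, of |H|^2 / 2 and of the Willmore
    density, when the jet of the surface varies. *)
Definition gram_var (f1 f2 d1 d2 : V6) : R :=
  2 * dot d1 f1 * dot f2 f2 + 2 * dot f1 f1 * dot d2 f2
  - 2 * dot f1 f2 * (dot d1 f2 + dot f1 d2).

Definition trace_var (f1 f2 f11 f12 f21 f22 d1 d2 d11 d12 d21 d22 : V6) : V6 :=
  (gram f1 f2)^-1 *: (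
    (2 * dot d2 f2) *: f11 + dot f2 f2 *: d11
    - (dot d1 f2 + dot f1 d2) *: (f12 + f21) - dot f1 f2 *: (d12 + d21)
    + (2 * dot d1 f1) *: f22 + dot f1 f1 *: d22)
  - ((gram f1 f2)^-1 * gram_var f1 f2 d1 d2) *: raw_trace f1 f2 f11 f12 f21 f22.

Definition mean_var (f f1 f2 f11 f12 f21 f22 df d1 d2 d11 d12 d21 d22 H : V6) : R :=
  let N := raw_trace f1 f2 f11 f12 f21 f22 in
  dot (trace_var f1 f2 f11 f12 f21 f22 d1 d2 d11 d12 d21 d22) H - dot N f * dot df H
  - ((gram f1 f2)^-1 * (dot f2 f2 * dot N f1 - dot f1 f2 * dot N f2)) * dot d1 H
  - ((gram f1 f2)^-1 * (dot f1 f1 * dot N f2 - dot f1 f2 * dot N f1)) * dot d2 H.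

Definition density_var (f f1 f2 f11 f12 f21 f22 df d1 d2 d11 d12 d21 d22 H : V6) : R :=
  2^-1 * mean_var f f1 f2 f11 f12 f21 f22 df d1 d2 d11 d12 d21 d22 H * Num.sqrt (gram f1 f2) +
  (4^-1 * dot H H + 1) * ((2 * Num.sqrt (gram f1 f2))^-1 * gram_var f1 f2 d1 d2).

End Values.

Section DensityDerivative.
Context {R : realType} {V : normedModType R}.
Notation V6 := 'rV[R]_(3 + 3).
Variables (x v : V).

Lemma is_derive_addW (W : normedModType R) (f g : V -> W) df dg :
  is_derive x v f df -> is_derive x v g dg ->
  is_derive x v (fun y => f y + g y) (df + dg).
Proof. by move=> Df Dg; exact: is_deriveD. Qed.

Lemma is_derive_oppW (W : normedModType R) (f : V -> W) df :
  is_derive x v f df -> is_derive x v (fun y => - f y) (- df).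
Proof. by move=> Df; exact: is_deriveN. Qed.

Lemma is_derive_mulR (f g : V -> R) df dg :
  is_derive x v f df -> is_derive x v g dg ->
  is_derive x v (fun y => f y * g y) (df * g x + f x * dg).
Proof.
move=> Df Dg; apply: (is_derive_cast (is_deriveM Df Dg)).
by rewrite addrC; congr (_ + _); rewrite -[LHS]/(_ * _) mulrC.
Qed.

Lemma is_derive_invR (f : V -> R) df : f x != 0 -> is_derive x v f df ->
  is_derive x v (fun y => (f y)^-1) (- (f x)^-1 ^+ 2 * df).
Proof.
move=> f0 [D E]; apply: DeriveDef; first exact: derivableV.
by rewrite (deriveV f0 D) E exprVn.
Qed.

Lemma is_derive_sqrtR (f : V -> R) df : 0 < f x -> is_derive x v f df ->
  is_derive x v (fun y => Num.sqrt (f y)) ((2 * Num.sqrt (f x))^-1 * df).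
Proof. by move=> f0 [D E]; rewrite -E; exact: is_derive_sqrt. Qed.

Lemma is_derive_cstR (k : R) : is_derive x v (fun=> k) 0.
Proof. exact: is_derive_cst. Qed.

Variables (f f1 f2 f11 f12 f21 f22 : V -> V6) (df d1 d2 d11 d12 d21 d22 : V6).
Hypotheses (Df : is_derive x v f df) (D1 : is_derive x v f1 d1) (D2 : is_derive x v f2 d2).
Hypotheses (D11 : is_derive x v f11 d11) (D12 : is_derive x v f12 d12).
Hypotheses (D21 : is_derive x v f21 d21) (D22 : is_derive x v f22 d22).
Hypothesis G0 : 0 < gram (f1 x) (f2 x).

Definition mean_along y := mean_formula (f y) (f1 y) (f2 y) (f11 y) (f12 y) (f21 y) (f22 y).
Definition density_along y :=
  (4^-1 * dot (mean_along y) (mean_along y) + 1) * Num.sqrt (gram (f1 y) (f2 y)).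

Notation gram_variation := (gram_var (f1 x) (f2 x) d1 d2).
Notation trace_variation :=
  (trace_var (f1 x) (f2 x) (f11 x) (f12 x) (f21 x) (f22 x) d1 d2 d11 d12 d21 d22).

Lemma is_derive_gram : is_derive x v (fun y => gram (f1 y) (f2 y)) gram_variation.
Proof.
have E11 := is_derive_dot D1 D1; have E12 := is_derive_dot D1 D2.
have E22 := is_derive_dot D2 D2.
have E := is_derive_addW (is_derive_mulR E11 E22) (is_derive_oppW (is_derive_mulR E12 E12)).
rewrite /gram (_ : (fun y => _) = (fun y => dot (f1 y) (f1 y) * dot (f2 y) (f2 y) -
  dot (f1 y) (f2 y) * dot (f1 y) (f2 y))); last by apply/funext => y; rewrite expr2.
apply: (is_derive_cast E); rewrite /gram_var (dotC (f1 x) d1) (dotC (f2 x) d2); ring.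
Qed.

Lemma is_derive_raw_trace : is_derive x v
  (fun y => raw_trace (f1 y) (f2 y) (f11 y) (f12 y) (f21 y) (f22 y)) trace_variation.
Proof.
have E11 := is_derive_dot D1 D1; have E12 := is_derive_dot D1 D2.
have E22 := is_derive_dot D2 D2.
have g0 : gram (f1 x) (f2 x) != 0 by rewrite gt_eqF.
have Ei := is_derive_invR g0 is_derive_gram.
have Q := is_derive_addW (is_derive_addW (is_derive_scale E22 D11)
  (is_derive_oppW (is_derive_scale E12 (is_derive_addW D12 D21)))) (is_derive_scale E11 D22).
apply: (is_derive_cast (is_derive_scale Ei Q)).
rewrite /trace_var /raw_trace (dotC (f1 x) d1) (dotC (f2 x) d2).
move: (gram _ _)^-1 gram_variation => i g.
move: (dot _ _) (dot _ _) (dot _ _) (dot _ _) (dot _ _) (dot _ _) (dot _ _) => *.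
by apply/rowP => l; rewrite !mxE; ring.
Qed.

Let H := mean_along x.
Let N := raw_trace (f1 x) (f2 x) (f11 x) (f12 x) (f21 x) (f22 x).
Hypotheses (fH : dot (f x) H = 0) (f1H : dot (f1 x) H = 0) (f2H : dot (f2 x) H = 0).

Notation mean_variation := (mean_var (f x) (f1 x) (f2 x) (f11 x) (f12 x) (f21 x) (f22 x)
  df d1 d2 d11 d12 d21 d22 H).

(** The density depends on H through |H|^2, so that the variation of H enters
    by its product with H; in it the variations of the coefficients of the
    tangential projection disappear, since H is normal. *)
Lemma is_derive_mean_along : exists2 dH : V6, is_derive x v mean_along dH &
  dot dH H = mean_variation.
Proof.
have E11 := is_derive_dot D1 D1; have E12 := is_derive_dot D1 D2.
have E22 := is_derive_dot D2 D2.
have g0 : gram (f1 x) (f2 x) != 0 by rewrite gt_eqF.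
have Ei := is_derive_invR g0 is_derive_gram.
have EN := is_derive_raw_trace.
have C0 := is_derive_dot EN Df.
have C1 := is_derive_mulR Ei (is_derive_addW (is_derive_mulR E22 (is_derive_dot EN D1))
  (is_derive_oppW (is_derive_mulR E12 (is_derive_dot EN D2)))).
have C2 := is_derive_mulR Ei (is_derive_addW (is_derive_mulR E11 (is_derive_dot EN D2))
  (is_derive_oppW (is_derive_mulR E12 (is_derive_dot EN D1)))).
have E := is_derive_addW (is_derive_addW (is_derive_addW EN (is_derive_oppW (is_derive_scale C0 Df)))
  (is_derive_oppW (is_derive_scale C1 D1))) (is_derive_oppW (is_derive_scale C2 D2)).
eexists; first exact: E.
have key (tv b0 b1 b2 y0 y1 y2 : V6) (c0 c1 c2 k0 k1 k2 : R) :
    dot b0 H = 0 -> dot b1 H = 0 -> dot b2 H = 0 ->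
    dot (tv - (k0 *: b0 + c0 *: y0) - (k1 *: b1 + c1 *: y1) - (k2 *: b2 + c2 *: y2)) H =
    dot tv H - c0 * dot y0 H - c1 * dot y1 H - c2 * dot y2 H.
  by move=> h0 h1 h2; rewrite !(dotDl, dotNl, dotZl) h0 h1 h2; ring.
exact: (key _ _ _ _ _ _ _ _ _ _ _ _ _ fH f1H f2H).
Qed.

Lemma is_derive_density : is_derive x v density_along
  (density_var (f x) (f1 x) (f2 x) (f11 x) (f12 x) (f21 x) (f22 x)
    df d1 d2 d11 d12 d21 d22 H).
Proof.
have [dH DH E] := is_derive_mean_along.
have K := is_derive_mulR (is_derive_addW (is_derive_mulR (is_derive_cstR 4^-1)
  (is_derive_dot DH DH)) (is_derive_cstR 1)) (is_derive_sqrtR G0 is_derive_gram).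
apply: (is_derive_cast K); rewrite /density_var; congr (_ * _ + _).
rewrite mul0r add0r addr0 (dotC (mean_along x) dH) -/H E.
by move: mean_variation => m; field.
Qed.

End DensityDerivative.

#[local] Transparent derive.

#[local] Opaque derive along.

Section VariationAlgebra.
Context {R : realType}.
Notation V6 := 'rV[R]_(3 + 3).

(** The comparison of the coordinate expression of the variation with the one
    in the frame, once all vectors have been replaced by their scalar
    products. *)
Lemma variation_scalars (P11 P12 P21 P22 v11 v12 v21 v22 B11 B12 B22 : R)
   (k m1 m2 VH V1H V2H V11H V12H V21H V22H : R) :
  let J := P11 * P22 - P12 * P21 in
  let g11 := (P12 ^+ 2 + P22 ^+ 2) / J ^+ 2 in
  let g12 := - (P11 * P12 + P21 * P22) / J ^+ 2 in
  let g22 := (P11 ^+ 2 + P21 ^+ 2) / J ^+ 2 in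
  let G := (J ^+ 2)^-1 in
  let gv := 2 * v11 * g22 + 2 * g11 * v22 - 2 * g12 * (v12 + v21) in
  let A := P11 ^+ 2 * B11 + 2 * P11 * P12 * B12 + P12 ^+ 2 * B22 in
  let B := P11 * P21 * B11 + (P11 * P22 + P12 * P21) * B12 + P12 * P22 * B22 in
  let C := P21 ^+ 2 * B11 + 2 * P21 * P22 * B12 + P22 ^+ 2 * B22 in
  let y11 := P11 ^+ 2 * v11 + P11 * P12 * (v12 + v21) + P12 ^+ 2 * v22 in
  let y12 := P11 * P21 * v11 + P11 * P22 * v12 + P12 * P21 * v21 + P12 * P22 * v22 in
  let y21 := P21 * P11 * v11 + P21 * P12 * v12 + P22 * P11 * v21 + P22 * P12 * v22 in
  let y22 := P21 ^+ 2 * v11 + P21 * P22 * (v12 + v21) + P22 ^+ 2 * v22 in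
  0 < J ->
  2^-1 * (G^-1 * (2 * v22 * B11 + g22 * V11H - (v12 + v21) * (B12 + B12)
        - g12 * (V12H + V21H) + 2 * v11 * B22 + g11 * V22H)
      - G^-1 * gv * (A + C) + 2 * VH + m1 * V1H + m2 * V2H) * J^-1
   + k * ((2 * J^-1)^-1 * gv) =
  J^-1 * (2^-1 * ((P11 ^+ 2 + P21 ^+ 2) * V11H + (P11 * P12 + P21 * P22) * (V12H + V21H)
        + (P12 ^+ 2 + P22 ^+ 2) * V22H + m1 * V1H + m2 * V2H) + VH
     - (y11 * (A - k) + y12 * B + y21 * B + y22 * (C - k))).
Proof.
move=> J g11 g12 g22 G gv A B C y11 y12 y21 y22 J0.
have Jn : J != 0 by rewrite gt_eqF.
rewrite /y11 /y12 /y21 /y22 /A /B /C /gv /G /g11 /g12 /g22.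
move: Jn; rewrite /J => Jn; field; exact: Jn.
Qed.

Section FramePoint.
Variables (f e1 e2 f1 f2 f11 f12 f22 : V6).
Variables (P11 P12 P21 P22 w1 w2 a b c d h x1 x2 y1 y2 z1 z2 : R).
Hypothesis Fr : legendrian_frame f e1 e2.
Let J := P11 * P22 - P12 * P21.
Hypothesis J0 : 0 < J.
Hypothesis E1 : e1 = P11 *: f1 + P12 *: f2.
Hypothesis E2 : e2 = P21 *: f1 + P22 *: f2.
Hypothesis X11 : x1 *: f1 + x2 *: f2 + P11 ^+ 2 *: f11 + (2 * P11 * P12) *: f12 + P12 ^+ 2 *: f22 =
  - f + w1 *: e2 + a *: muli e1 + b *: muli e2.
Hypothesis X12 : y1 *: f1 + y2 *: f2 + (P11 * P21) *: f11 + (P11 * P22 + P12 * P21) *: f12 +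
  (P12 * P22) *: f22 = - w1 *: e1 + b *: muli e1 + c *: muli e2.
Hypothesis X22 : z1 *: f1 + z2 *: f2 + P21 ^+ 2 *: f11 + (2 * P21 * P22) *: f12 + P22 ^+ 2 *: f22 =
  - f - w2 *: e1 + c *: muli e1 + d *: muli e2.
Hypothesis ac : a + c = h.
Hypothesis bd : b + d = 0.

Let Jn : J != 0. Proof. by rewrite gt_eqF. Qed.
Let T := frame_rules (A := setT) (f := fun=> f) (e1 := fun=> e1) (e2 := fun=> e2)
  (fun _ _ => Fr) (u := (0, 0)) I.

Let f1E : f1 = (P22 / J) *: e1 - (P12 / J) *: e2.
Proof.
rewrite E1 E2; apply/rowP => j; rewrite !mxE.
by move: Jn; rewrite /J => n; field.
Qed.

Let f2E : f2 = (P11 / J) *: e2 - (P21 / J) *: e1.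
Proof.
rewrite E1 E2; apply/rowP => j; rewrite !mxE.
by move: Jn; rewrite /J => n; field.
Qed.

Lemma first_form : [/\ dot f1 f1 = (P12 ^+ 2 + P22 ^+ 2) / J ^+ 2,
  dot f1 f2 = - (P11 * P12 + P21 * P22) / J ^+ 2,
  dot f2 f2 = (P11 ^+ 2 + P21 ^+ 2) / J ^+ 2 & gram f1 f2 = (J ^+ 2)^-1].
Proof.
have g11 : dot f1 f1 = (P12 ^+ 2 + P22 ^+ 2) / J ^+ 2.
  by rewrite f1E !(dotDl, dotDr, dotNl, dotNr, dotZl, dotZr) !T; field.
have g12 : dot f1 f2 = - (P11 * P12 + P21 * P22) / J ^+ 2.
  by rewrite f1E f2E !(dotDl, dotDr, dotNl, dotNr, dotZl, dotZr) !T; field.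
have g22 : dot f2 f2 = (P11 ^+ 2 + P21 ^+ 2) / J ^+ 2.
  by rewrite f2E !(dotDl, dotDr, dotNl, dotNr, dotZl, dotZr) !T; field.
split => //; rewrite /gram g11 g12 g22.
by move: Jn; rewrite /J => n; field.
Qed.

Let m1 := x1 + z1 + w2 * P11 - w1 * P21.
Let m2 := x2 + z2 + w2 * P12 - w1 * P22.

Lemma raw_traceE : raw_trace f1 f2 f11 f12 f12 f22 =
  h *: muli e1 - (2 *: f + m1 *: f1 + m2 *: f2).
Proof.
have [g11 g12 g22 g] := first_form.
have -> : raw_trace f1 f2 f11 f12 f12 f22 =
    (P11 ^+ 2 + P21 ^+ 2) *: f11 + (2 * (P11 * P12 + P21 * P22)) *: f12 +
    (P12 ^+ 2 + P22 ^+ 2) *: f22.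
  rewrite /raw_trace g g11 g12 g22; apply/rowP => j; rewrite !mxE.
  by move: J Jn => K Kn; field.
have S := congr2 +%R X11 X22.
have -> : (P11 ^+ 2 + P21 ^+ 2) *: f11 + (2 * (P11 * P12 + P21 * P22)) *: f12 +
    (P12 ^+ 2 + P22 ^+ 2) *: f22 =
    (x1 *: f1 + x2 *: f2 + P11 ^+ 2 *: f11 + (2 * P11 * P12) *: f12 + P12 ^+ 2 *: f22) +
    (z1 *: f1 + z2 *: f2 + P21 ^+ 2 *: f11 + (2 * P21 * P22) *: f12 + P22 ^+ 2 *: f22) -
    ((x1 + z1) *: f1 + (x2 + z2) *: f2).
  by apply/rowP => j; rewrite !mxE; ring.
rewrite S /m1 /m2 -ac (_ : d = - b); last by apply/eqP; rewrite -addr_eq0 addrC bd.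
move: (muli e1) (muli e2) => i1 i2; rewrite E1 E2.
by apply/rowP => j; rewrite !mxE; ring.
Qed.

Let H : V6 := h *: muli e1.

Lemma normal_to_mean : [/\ dot f H = 0, dot f1 H = 0, dot f2 H = 0, dot H H = h ^+ 2 &
  [/\ dot f f1 = 0 & dot f f2 = 0]].
Proof.
rewrite /H !dotZr dotZl dot_muli2 f1E f2E !(dotDl, dotDr, dotNl, dotNr, dotZl, dotZr) !T.
by split; [ring..|split; ring].
Qed.

Lemma raw_trace_dots : let N := raw_trace f1 f2 f11 f12 f12 f22 in [/\ dot N f = - 2,
  dot N H = h ^+ 2,
  (gram f1 f2)^-1 * (dot f2 f2 * dot N f1 - dot f1 f2 * dot N f2) = - m1 &
  (gram f1 f2)^-1 * (dot f1 f1 * dot N f2 - dot f1 f2 * dot N f1) = - m2].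
Proof.
move=> N; have [fH f1H f2H HH [ff1 ff2]] := normal_to_mean.
have [g11 g12 g22 g] := first_form.
have gn : gram f1 f2 != 0 by rewrite g invr_eq0 expf_neq0.
rewrite /N raw_traceE -/H; move: gn {g11 g12 g22 g}.
have hf1 : dot H f1 = 0 by rewrite dotC.
have hf2 : dot H f2 = 0 by rewrite dotC.
have hf : dot H f = 0 by rewrite dotC.
have f1f : dot f1 f = 0 by rewrite dotC.
have f2f : dot f2 f = 0 by rewrite dotC.
move: H fH f1H f2H HH hf1 hf2 hf => K fK f1K f2K KK kf1 kf2 kf.
rewrite !(dotDl, dotNl, dotZl) kf1 kf2 kf f1f f2f KK f1K f2K fK ff1 ff2 !T (dotC f2 f1).
rewrite /gram; move: (dot f1 f1) (dot f1 f2) (dot f2 f2) => g11 g12 g22 gn.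
split; [ring|ring| |]; by field.
Qed.

Lemma mean_formulaE : mean_formula f f1 f2 f11 f12 f12 f22 = H.
Proof.
have [N0 _ N1 N2] := raw_trace_dots.
rewrite /mean_formula /normal_part N0 N1 N2 raw_traceE -/H.
by apply/rowP => j; rewrite !mxE; ring.
Qed.

Variables (V V1 V2 V11 V12 V21 V22 : V6).

Let D a1 a2 := a1 *: V1 + a2 *: V2.

Lemma density_var_frame :
  density_var f f1 f2 f11 f12 f12 f22 V V1 V2 V11 V12 V21 V22 H =
  J^-1 * (2^-1 * dot ((P11 ^+ 2 + P21 ^+ 2) *: V11 + (P11 * P12 + P21 * P22) *: (V12 + V21) +
     (P12 ^+ 2 + P22 ^+ 2) *: V22 + m1 *: V1 + m2 *: V2) H + dot V H
   - (dot (P11 *: V1 + P12 *: V2) e1 * (h * a - (4^-1 * h ^+ 2 + 1)) +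
      dot (P11 *: V1 + P12 *: V2) e2 * (h * b) +
      dot (P21 *: V1 + P22 *: V2) e1 * (h * b) +
      dot (P21 *: V1 + P22 *: V2) e2 * (h * c - (4^-1 * h ^+ 2 + 1)))).
Proof.
have [fH f1H f2H HH [ff1 ff2]] := normal_to_mean.
have [g11 g12 g22 g] := first_form.
have [N0 NH N1 N2] := raw_trace_dots.
have sg : Num.sqrt (gram f1 f2) = J^-1.
  by rewrite g -exprVn sqrtr_sqr ger0_norm// invr_ge0 ltW.
have key (v : V6) : dot v H = h * dot v (muli e1) by rewrite /H dotZr.
have ii : dot (muli e1) (muli e1) = 1 by rewrite dot_muli2 T.
have ij : dot (muli e2) (muli e1) = 0 by rewrite dot_muli2 T.
have S11 := congr1 (fun x => dot x H) X11.
have S12 := congr1 (fun x => dot x H) X12.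
have S22 := congr1 (fun x => dot x H) X22.
have R11 : dot (- f + w1 *: e2 + a *: muli e1 + b *: muli e2) H = h * a.
  by rewrite key !(dotDl, dotNl, dotZl) ii ij !T; ring.
have R12 : dot (- w1 *: e1 + b *: muli e1 + c *: muli e2) H = h * b.
  by rewrite key !(dotDl, dotNl, dotZl) ii ij !T; ring.
have R22 : dot (- f - w2 *: e1 + c *: muli e1 + d *: muli e2) H = h * c.
  by rewrite key !(dotDl, dotNl, dotZl) ii ij !T; ring.
move: S11 S12 S22; rewrite /= R11 R12 R22 {R11 R12 R22 key}.
move: H fH f1H f2H HH N0 NH N1 N2 => K fK f1K f2K KK N0 NK N1 N2.
rewrite /density_var /mean_var N0 N1 N2 KK sg /trace_var.
move: (raw_trace f1 f2 f11 f12 f12 f22) NK {N0 N1 N2} => N NK.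
rewrite !(dotDl, dotNl, dotZl) NK ?(f1K, f2K, fK) ?mulr0 ?add0r.
rewrite E1 E2 !(dotDr, dotZr) (dotC f1 V2).
rewrite /gram_var (dotC f1 V2) g g11 g12 g22 => S11 S12 S22.
have A := variation_scalars (dot V1 f1) (dot V1 f2) (dot V2 f1) (dot V2 f2)
  (dot f11 K) (dot f12 K) (dot f22 K) (4^-1 * h ^+ 2 + 1) m1 m2 (dot V K) (dot V1 K) (dot V2 K)
  (dot V11 K) (dot V12 K) (dot V21 K) (dot V22 K) J0.
move: A; cbv zeta; rewrite S11 S12 S22 -/J => A.
have hE : h ^+ 2 = h * a + h * c by rewrite -mulrDr ac expr2.
rewrite {1}hE; apply: etrans (etrans _ A) _.
  by congr (2^-1 * _ / J + _); rewrite !mulNr !opprK.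
congr (J^-1 * _).
move: (4^-1 * h ^+ 2 + 1) => k; ring.
Qed.

End FramePoint.
(** Expresses the variation in the moving frame, where P11, P12 and P21, P22
    are the coordinates of the frame fields. *)
Lemma density_var_moving (f e1 e2 fx fy fxx fxy fyx fyy V Vx Vy Vxx Vxy Vyx Vyy V11 V22 V1 V2 : V6)
    (P11 P12 P21 P22 w1 w2 a b c d h x1 x2 y1 y2 z1 z2 : R) :
  let J := P11 * P22 - P12 * P21 in
  legendrian_frame f e1 e2 -> 0 < J -> a + c = h -> b + d = 0 ->
  e1 = P11 *: fx + P12 *: fy -> e2 = P21 *: fx + P22 *: fy -> fyx = fxy ->
  x1 *: fx + P11 *: (P11 *: fxx + P12 *: fyx) + (x2 *: fy + P12 *: (P11 *: fxy + P12 *: fyy)) =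
    - f + w1 *: e2 + a *: muli e1 + b *: muli e2 ->
  y1 *: fx + P21 *: (P11 *: fxx + P12 *: fyx) + (y2 *: fy + P22 *: (P11 *: fxy + P12 *: fyy)) =
    - w1 *: e1 + b *: muli e1 + c *: muli e2 ->
  z1 *: fx + P21 *: (P21 *: fxx + P22 *: fyx) + (z2 *: fy + P22 *: (P21 *: fxy + P22 *: fyy)) =
    - f - w2 *: e1 + c *: muli e1 + d *: muli e2 ->
  V11 = x1 *: Vx + P11 *: (P11 *: Vxx + P12 *: Vyx) +
    (x2 *: Vy + P12 *: (P11 *: Vxy + P12 *: Vyy)) ->
  V22 = z1 *: Vx + P21 *: (P21 *: Vxx + P22 *: Vyx) +
    (z2 *: Vy + P22 *: (P21 *: Vxy + P22 *: Vyy)) ->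
  V1 = P11 *: Vx + P12 *: Vy -> V2 = P21 *: Vx + P22 *: Vy ->
  [/\ 0 < gram fx fy, Num.sqrt (gram fx fy) = J^-1,
    mean_formula f fx fy fxx fxy fyx fyy = h *: muli e1,
    [/\ dot f (h *: muli e1) = 0, dot fx (h *: muli e1) = 0 & dot fy (h *: muli e1) = 0] &
  density_var f fx fy fxx fxy fyx fyy V Vx Vy Vxx Vxy Vyx Vyy (h *: muli e1) =
  J^-1 * (2^-1 * dot (V11 + V22 + w2 *: V1 - w1 *: V2) (h *: muli e1) + dot V (h *: muli e1)
   - (dot V1 e1 * (h * a - (4^-1 * h ^+ 2 + 1)) + dot V1 e2 * (h * b) +
      dot V2 e1 * (h * b) + dot V2 e2 * (h * c - (4^-1 * h ^+ 2 + 1))))].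
Proof.
move=> J Fr J0 ac bd E1 E2 sw S11 S12 S22 U11 U22 W1 W2; subst fyx.
have X11 : x1 *: fx + x2 *: fy + P11 ^+ 2 *: fxx + (2 * P11 * P12) *: fxy + P12 ^+ 2 *: fyy =
    - f + w1 *: e2 + a *: muli e1 + b *: muli e2.
  by rewrite -S11; apply/rowP => j; rewrite !mxE; ring.
have X12 : y1 *: fx + y2 *: fy + (P11 * P21) *: fxx + (P11 * P22 + P12 * P21) *: fxy +
    (P12 * P22) *: fyy = - w1 *: e1 + b *: muli e1 + c *: muli e2.
  by rewrite -S12; apply/rowP => j; rewrite !mxE; ring.
have X22 : z1 *: fx + z2 *: fy + P21 ^+ 2 *: fxx + (2 * P21 * P22) *: fxy + P22 ^+ 2 *: fyy =
    - f - w2 *: e1 + c *: muli e1 + d *: muli e2.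
  by rewrite -S22; apply/rowP => j; rewrite !mxE; ring.
have [_ _ _ g] := first_form Fr J0 E1 E2.
have [fH f1H f2H _ _] := normal_to_mean h Fr J0 E1 E2.
split.
- by rewrite g invr_gt0 exprn_gt0.
- by rewrite g -exprVn sqrtr_sqr ger0_norm// invr_ge0 ltW.
- exact: (mean_formulaE Fr J0 E1 E2 X11 X22 ac bd).
- by [].
- apply: etrans (density_var_frame Fr J0 E1 E2 X11 X12 X22 ac bd _ _ _ _ _ _ _) _.
  rewrite -W1 -W2; congr (J^-1 * (2^-1 * dot _ _ + _ - _)).
  by rewrite U11 U22 W1 W2; apply/rowP => j; rewrite !mxE; ring.
Qed.

End VariationAlgebra.

#[local] Transparent derive along.

#[local] Opaque derive along.

Section FirstVariation.
Context {R : realType}.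
Notation V6 := 'rV[R]_(3 + 3).
Let ex : R * R := (1, 0).
Let ey : R * R := (0, 1).

Lemma along_alongV (A : set (R * R)) (r s : R * R -> R * R) (g : R * R -> V6) u :
  open A -> smooth_field A s -> smooth_on A g -> A u ->
  along r (along s g) u =
   along r (fun x => (s x).1) u *: 'D_ex g u +
   (s u).1 *: ((r u).1 *: 'D_ex ('D_ex g) u + (r u).2 *: 'D_ey ('D_ex g) u) +
   (along r (fun x => (s x).2) u *: 'D_ey g u +
   (s u).2 *: ((r u).1 *: 'D_ex ('D_ey g) u + (r u).2 *: 'D_ey ('D_ey g) u)).
Proof.
move=> oA [s1 s2] sg Au; have sx := sm_derive ex sg; have sy := sm_derive ey sg.
apply: etrans (along_eq oA r (fun x Ax => alongVE oA s sg Ax) Au) _.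
apply: etrans (alongD r (sm_scale oA s1 sx) (sm_scale oA s2 sy) Au) _.
apply: etrans (congr2 +%R (along_scale r s1 sx Au) (along_scale r s2 sy Au)) _.
exact: (congr2 (fun p q => _ + _ *: p + (_ + _ *: q)) (alongVE oA r sx Au) (alongVE oA r sy Au)).
Qed.

(** The coordinates of the bracket of the fields determine w1 and w2;
    substituting them gives the divergence in the frame. *)
Lemma divergence_algebra (P11 P12 P21 P22 a1 a2 b1 b2 c1 c2 d1 d2 y1 y2 y11 y12 y21 y22
    w1 w2 : R) : let J := P11 * P22 - P12 * P21 in J != 0 ->
  P11 * c1 + P12 * c2 - (P21 * a1 + P22 * a2) = - (w1 * P11 + w2 * P21) ->
  P11 * d1 + P12 * d2 - (P21 * b1 + P22 * b2) = - (w1 * P12 + w2 * P22) ->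
  let J1 := a1 * P22 + P11 * d1 - (b1 * P21 + P12 * c1) in
  let J2 := a2 * P22 + P11 * d2 - (b2 * P21 + P12 * c2) in
  - J^-1 ^+ 2 * J1 * (P11 * y1 + P21 * y2) +
    J^-1 * (a1 * y1 + P11 * y11 + (c1 * y2 + P21 * y21)) +
  (- J^-1 ^+ 2 * J2 * (P12 * y1 + P22 * y2) +
    J^-1 * (b2 * y1 + P12 * y12 + (d2 * y2 + P22 * y22))) =
  J^-1 * (P11 * y11 + P12 * y12 + (P21 * y21 + P22 * y22) + (w2 * y1 - w1 * y2)).
Proof.
move=> J Jn R1 R2 J1 J2.
have w2E : w2 = (P12 * (P11 * c1 + P12 * c2 - (P21 * a1 + P22 * a2)) -
  P11 * (P11 * d1 + P12 * d2 - (P21 * b1 + P22 * b2))) / J.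
  by rewrite R1 R2 /J; move: Jn; rewrite /J => n; field.
have w1E : w1 = (P21 * (P11 * d1 + P12 * d2 - (P21 * b1 + P22 * b2)) -
  P22 * (P11 * c1 + P12 * c2 - (P21 * a1 + P22 * a2))) / J.
  by rewrite R1 R2 /J; move: Jn; rewrite /J => n; field.
rewrite w1E w2E /J1 /J2; move: Jn; rewrite /J => n; by field.
Qed.

Variables (A : set (R * R)) (f e1 e2 : R * R -> V6).
Variables (p1 p2 : R * R -> R * R) (w1 w2 a b c d h : R * R -> R).
Hypothesis M : moving_frame A f e1 e2 p1 p2 w1 w2 a b c d.
Let J u := (p1 u).1 * (p2 u).2 - (p1 u).2 * (p2 u).1.
Hypothesis J_gt0 : forall u, A u -> 0 < J u.
Hypothesis sh : smooth_on A h.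
Hypothesis ach : forall u, A u -> a u + c u = h u.
Hypothesis bd0 : forall u, A u -> b u + d u = 0.
Notation sm := (smooth_on A).

Let oA := mf_open M.
Let sf := mf_f M.
Let H := mean_vector e1 h.
Let Z1 := stress1 e1 e2 p1 a b h.
Let Z2 := stress2 e1 e2 p2 b c h.
Let sH : sm H := sm_mean_vector M sh.
Let sZ1 : sm Z1 := sm_stress1 M sh.
Let sZ2 : sm Z2 := sm_stress2 M sh.

(** The divergence theorem needs coordinates, the structure equations need the
    frame. *)
Lemma along_divergence y1 y2 u : sm y1 -> sm y2 -> A u ->
  'D_ex (fun x => (J x)^-1 * ((p1 x).1 * y1 x + (p2 x).1 * y2 x)) u +
  'D_ey (fun x => (J x)^-1 * ((p1 x).2 * y1 x + (p2 x).2 * y2 x)) u =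
  (J u)^-1 * (along p1 y1 u + along p2 y2 u + (w2 u * y1 u - w1 u * y2 u)).
Proof.
move=> sy1 sy2 Au; have [s11 s12] := mf_p1 M; have [s21 s22] := mf_p2 M.
have Jn x : A x -> J x != 0 by move=> Ax; exact: lt0r_neq0 (J_gt0 Ax).
have sJ : sm J by exact: (sm_add oA (sm_mul oA s11 s22) (sm_opp oA (sm_mul oA s12 s21))).
have DJ e : along (fun=> e) J u = along (fun=> e) (fun x => (p1 x).1) u * (p2 u).2 +
    (p1 u).1 * along (fun=> e) (fun x => (p2 x).2) u -
    (along (fun=> e) (fun x => (p1 x).2) u * (p2 u).1 +
     (p1 u).2 * along (fun=> e) (fun x => (p2 x).1) u).
  apply: etrans (alongD (fun=> e) (sm_mul oA s11 s22) (sm_opp oA (sm_mul oA s12 s21)) Au) _.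
  apply: etrans (congr2 +%R (alongM (fun=> e) s11 s22 Au)
    (along_opp (fun=> e) (sm_mul oA s12 s21) Au)) _.
  exact: (congr1 (fun x => _ - x) (alongM (fun=> e) s12 s21 Au)).
have DX e (q1 q2 : R * R -> R) : sm q1 -> sm q2 ->
    along (fun=> e) (fun x => (J x)^-1 * (q1 x * y1 x + q2 x * y2 x)) u =
    - (J u)^-1 ^+ 2 * along (fun=> e) J u * (q1 u * y1 u + q2 u * y2 u) + (J u)^-1 *
    (along (fun=> e) q1 u * y1 u + q1 u * along (fun=> e) y1 u +
     (along (fun=> e) q2 u * y2 u + q2 u * along (fun=> e) y2 u)).
  move=> sq1 sq2; have m1 := sm_mul oA sq1 sy1; have m2 := sm_mul oA sq2 sy2.
  apply: etrans (alongM (fun=> e) (sm_inv oA Jn sJ) (sm_add oA m1 m2) Au) _.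
  apply: (congr2 (fun p q => p * _ + _ * q)); first exact: (alongV (fun=> e) sJ Au (Jn u Au)).
  apply: etrans (alongD (fun=> e) m1 m2 Au) _.
  exact: (congr2 +%R (alongM (fun=> e) sq1 sy1 Au) (alongM (fun=> e) sq2 sy2 Au)).
have Dx := DX ex _ _ s11 s21; have Dy := DX ey _ _ s12 s22.
have L := mf_lie M Au.
have L1 := congr1 fst L; have L2 := congr1 snd L.
have E r (g : R * R -> R) : sm g -> along r g u = (r u).1 * along (fun=> ex) g u + (r u).2 * along (fun=> ey) g u.
  by move=> sg; exact: (alongE oA r sg Au).
have {}L1 := etrans (congr2 (fun x y => x - y) (esym (E p1 _ s21)) (esym (E p2 _ s11))) L1.
have {}L2 := etrans (congr2 (fun x y => x - y) (esym (E p1 _ s22)) (esym (E p2 _ s12))) L2.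
have K := divergence_algebra (y1 u) (y2 u) (along (fun=> ex) y1 u) (along (fun=> ey) y1 u)
  (along (fun=> ex) y2 u) (along (fun=> ey) y2 u) (Jn u Au) L1 L2.
rewrite [in RHS](E p1 _ sy1) [in RHS](E p2 _ sy2).
apply: etrans (congr2 +%R Dx Dy) _.
apply: etrans (congr2 (fun p q => - (J u)^-1 ^+ 2 * p * _ + _ + (- (J u)^-1 ^+ 2 * q * _ + _))
  (DJ ex) (DJ ey)) _.
exact: K.
Qed.

Variable V : R * R -> V6.
Hypothesis sV : sm V.

Let X1V := along p1 V.
Let X2V := along p2 V.

Definition flux1 u := 2^-1 * dot (along p1 V u) (mean_vector e1 h u) -
  dot (V u) (stress1 e1 e2 p1 a b h u).
Definition flux2 u := 2^-1 * dot (along p2 V u) (mean_vector e1 h u) -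
  dot (V u) (stress2 e1 e2 p2 b c h u).

Let sflux p (Z : R * R -> V6) : smooth_field A p -> sm Z ->
  sm (fun u => 2^-1 * dot (along p V u) (H u) - dot (V u) (Z u)).
Proof.
move=> sp sZ; have sX := sm_alongV oA sp sV.
exact: (sm_add oA (sm_mul oA (sm_cst A _) (sm_dot oA sX sH)) (sm_opp oA (sm_dot oA sV sZ))).
Qed.

Lemma sm_flux1 : sm flux1. Proof. exact: (sflux (mf_p1 M) sZ1). Qed.
Lemma sm_flux2 : sm flux2. Proof. exact: (sflux (mf_p2 M) sZ2). Qed.

Let along_flux p (Z : R * R -> V6) u : smooth_field A p -> sm Z -> A u ->
  along p (fun u => 2^-1 * dot (along p V u) (H u) - dot (V u) (Z u)) u =
  2^-1 * (dot (along p (along p V) u) (H u) + dot (along p V u) (along p H u)) -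
  (dot (along p V u) (Z u) + dot (V u) (along p Z u)).
Proof.
move=> sp sZ Au; have sX := sm_alongV oA sp sV; have d1 := sm_dot oA sX sH.
have d2 := sm_dot oA sV sZ.
apply: etrans (alongD p (sm_mul oA (sm_cst A _) d1) (sm_opp oA d2) Au) _.
apply: (congr2 +%R).
  apply: etrans (along_half p d1 Au) _; exact: (congr1 (fun x => _ * x) (along_dot p sX sH Au)).
apply: etrans (along_opp p d2 Au) _; exact: (congr1 -%R (along_dot p sV sZ Au)).
Qed.

(** The product rule, read from right to left: the terms with derivatives of V
    are the divergence of the two fluxes, up to the pairing of V with the
    Euler-Lagrange field. *)
Lemma second_variation_flux u : A u ->
  2^-1 * dot (along p1 X1V u + along p2 X2V u + w2 u *: X1V u - w1 u *: X2V u) (H u) +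
  dot (V u) (H u) -
  (dot (X1V u) (e1 u) * (h u * a u - (4^-1 * h u ^+ 2 + 1)) + dot (X1V u) (e2 u) * (h u * b u) +
   dot (X2V u) (e1 u) * (h u * b u) +
   dot (X2V u) (e2 u) * (h u * c u - (4^-1 * h u ^+ 2 + 1))) =
  along p1 flux1 u + along p2 flux2 u + (w2 u * flux1 u - w1 u * flux2 u) +
  dot (V u) (willmore_field e1 e2 p1 p2 w1 w2 a b c h u).
Proof.
move=> Au.
have F1 : along p1 flux1 u = _ := along_flux (mf_p1 M) sZ1 Au.
have F2 : along p2 flux2 u = _ := along_flux (mf_p2 M) sZ2 Au.
have key (x11 x22 x1 x2 v Hu h1 h2 z1 z2 dz1 dz2 k1 k2 : V6) (A1 B C k v1 v2 fl1 fl2 : R) :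
  fl1 = 2^-1 * (dot x11 Hu + dot x1 h1) - (dot x1 z1 + dot v dz1) ->
  fl2 = 2^-1 * (dot x22 Hu + dot x2 h2) - (dot x2 z2 + dot v dz2) ->
  z1 = 2^-1 *: h1 + (A1 - k) *: k1 + B *: k2 -> z2 = 2^-1 *: h2 + B *: k1 + (C - k) *: k2 ->
  2^-1 * dot (x11 + x22 + v2 *: x1 - v1 *: x2) Hu + dot v Hu -
  (dot x1 k1 * (A1 - k) + dot x1 k2 * B + dot x2 k1 * B + dot x2 k2 * (C - k)) =
  fl1 + fl2 + (v2 * (2^-1 * dot x1 Hu - dot v z1) - v1 * (2^-1 * dot x2 Hu - dot v z2)) +
  dot v (dz1 + dz2 + (v2 *: z1 - v1 *: z2) + Hu).
  move=> -> -> z1E z2E.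
  have d1 w : dot w z1 = 2^-1 * dot w h1 + (A1 - k) * dot w k1 + B * dot w k2.
    by rewrite z1E !dotDr !dotZr.
  have d2 w : dot w z2 = 2^-1 * dot w h2 + B * dot w k1 + (C - k) * dot w k2.
    by rewrite z2E !dotDr !dotZr.
  by rewrite !(dotDl, dotNl, dotZl) !(dotDr, dotNr, dotZr) !d1 !d2; ring.
exact: (key _ _ _ _ _ _ _ _ _ _ _ _ _ _ _ _ _ _ _ _ _ _ F1 F2 (erefl _) (erefl _)).
Qed.

Lemma density_var_divergence u : A u ->
  [/\ 0 < gram ('D_ex f u) ('D_ey f u), Num.sqrt (gram ('D_ex f u) ('D_ey f u)) = (J u)^-1,
   mean_formula (f u) ('D_ex f u) ('D_ey f u) ('D_ex ('D_ex f) u) ('D_ex ('D_ey f) u)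
    ('D_ey ('D_ex f) u) ('D_ey ('D_ey f) u) = mean_vector e1 h u,
   [/\ dot (f u) (mean_vector e1 h u) = 0, dot ('D_ex f u) (mean_vector e1 h u) = 0 &
     dot ('D_ey f u) (mean_vector e1 h u) = 0] &
  density_var (f u) ('D_ex f u) ('D_ey f u) ('D_ex ('D_ex f) u) ('D_ex ('D_ey f) u)
    ('D_ey ('D_ex f) u) ('D_ey ('D_ey f) u) (V u) ('D_ex V u) ('D_ey V u)
    ('D_ex ('D_ex V) u) ('D_ex ('D_ey V) u) ('D_ey ('D_ex V) u) ('D_ey ('D_ey V) u)
    (mean_vector e1 h u) =
  'D_ex (fun x => (J x)^-1 * ((p1 x).1 * flux1 x + (p2 x).1 * flux2 x)) u +
  'D_ey (fun x => (J x)^-1 * ((p1 x).2 * flux1 x + (p2 x).2 * flux2 x)) u +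
  (J u)^-1 * dot (V u) (willmore_field e1 e2 p1 p2 w1 w2 a b c h u)].
Proof.
move=> Au.
have DV := along_divergence sm_flux1 sm_flux2 Au.
have SV := second_variation_flux Au.
have [S11 _ S12 S22] := mf_structure M Au.
have E1 : e1 u = (p1 u).1 *: 'D_ex f u + (p1 u).2 *: 'D_ey f u.
  exact: (etrans (esym (mf_along1 M u)) (alongVE oA p1 sf Au)).
have E2 : e2 u = (p2 u).1 *: 'D_ex f u + (p2 u).2 *: 'D_ey f u.
  exact: (etrans (esym (mf_along2 M u)) (alongVE oA p2 sf Au)).
have sw := schwarzV oA ey ex sf Au.
have swV := schwarzV oA ey ex sV Au.
have e1f : e1 = along p1 f by apply/funext => x; exact: esym (mf_along1 M x).
have e2f : e2 = along p2 f by apply/funext => x; exact: esym (mf_along2 M x).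
have T11 := esym (along_alongV p1 oA (mf_p1 M) sf Au).
have T12 := esym (along_alongV p1 oA (mf_p2 M) sf Au).
have T22 := esym (along_alongV p2 oA (mf_p2 M) sf Au).
have U11 := along_alongV p1 oA (mf_p1 M) sV Au.
have U22 := along_alongV p2 oA (mf_p2 M) sV Au.
have {}T11 := etrans T11 (etrans (congr1 (fun g => along p1 g u) (esym e1f)) S11).
have {}T12 := etrans T12 (etrans (congr1 (fun g => along p1 g u) (esym e2f)) S12).
have {}T22 := etrans T22 (etrans (congr1 (fun g => along p2 g u) (esym e2f)) S22).
have W1 : X1V u = _ := alongVE oA p1 sV Au.
have W2 : X2V u = _ := alongVE oA p2 sV Au.
have Fr := mf_frame M Au; have J0 := J_gt0 Au.
have ac := ach Au; have bd := bd0 Au.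
have [K1 K2 K3 K4 K5] := density_var_moving (V u) Fr J0 ac bd E1 E2 sw T11 T12 T22 U11 U22 W1 W2.
split; [exact: K1|exact: K2|exact: K3|exact: K4|].
apply: etrans K5 _; apply: etrans (congr1 (fun x => (J u)^-1 * x) SV) _.
apply: etrans (mulrDr _ _ _) _; exact: (congr1 (fun x => x + _) (esym DV)).
Qed.

End FirstVariation.

#[local] Transparent derive along.

(** * Compactly supported deformations in the sphere *)

Section Lift.
Context {R : realType}.
Notation V6 := 'rV[R]_(3 + 3).
Notation V3 := (R * (R * R))%type.
Let ex : R * R := (1, 0).
Let ey : R * R := (0, 1).
Let et : V3 := (1, 0).

(** The set of pairs of a parameter t and a point u of the chart with u in A;
    t is unrestricted as the deformations below exist for all time. *)
Definition cylinder (A : set (R * R)) : set V3 := [set x | A x.2].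

Lemma open_cylinder A : open A -> open (cylinder A).
Proof. by move=> oA; apply: open_comp => // x _; exact: cvg_snd. Qed.

Lemma derive_snd (W : normedModType R) (g : R * R -> W) (v : V3) :
  'D_v (fun x : V3 => g x.2) = fun x => 'D_(v.2) g x.2.
Proof. by []. Qed.

Lemma Ck_snd (W : normedModType R) k A (g : R * R -> W) :
  Ck k A g -> Ck k (cylinder A) (fun x => g x.2).
Proof.
elim: k g => [|k IH] g [cg dg]; split.
- move=> x Ax; apply: (@continuous_comp _ _ _ (fun x : V3 => x.2) g); first exact: cvg_snd.
  exact: cg.
- by [].
- move=> x Ax; apply: (@continuous_comp _ _ _ (fun x : V3 => x.2) g); first exact: cvg_snd.
  exact: cg.
- move=> v; have [dgv Cg] := dg v.2; split; first by move=> x Ax; exact: (dgv x.2 Ax).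
  exact: (eq_ind _ (Ck k (cylinder A)) (IH _ Cg) _ (esym (derive_snd g v))).
Qed.

Lemma sm_snd (W : normedModType R) A (g : R * R -> W) :
  smooth_on A g -> smooth_on (cylinder A) (fun x => g x.2).
Proof. by move=> sg k; exact: Ck_snd. Qed.

Lemma is_derive_fst (x v : V3) : is_derive x v (fun x : V3 => x.1) v.1.
Proof.
apply: is_derive_quotient.
apply: (@cvg_trans _ ((fun=> v.1) @ (0 : R)^')); last exact: cvg_cst.
apply: near_eq_cvg; near=> h.
rewrite /= addrK -![_ *: _]/(_ * _) mulKf//; near: h; exact: nbhs_dnbhs_neq.
Unshelve. all: by end_near. Qed.

Lemma sm_fst (B : set V3) : smooth_on B (fun x => x.1).
Proof.
have cf : forall x : V3, B x -> {for x, continuous (fun x : V3 => x.1)}.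
  by move=> x _; exact: cvg_fst.
case=> [|k]; first exact: (conj cf I).
refine (conj cf _) => v; split; first by move=> x _; exact: (@ex_derive _ _ _ _ _ _ _ (is_derive_fst x v)).
have e : 'D_v (fun x : V3 => x.1) = fun=> v.1.
  by apply/funext => x; exact: (@derive_val _ _ _ _ _ _ _ (is_derive_fst x v)).
exact: (eq_ind _ (Ck k B) (Ck_cst k B (v.1 : R)) _ (esym e)).
Qed.

Lemma derive_time (W : normedModType R) (g : R * R -> W) (x : V3) :
  is_derive x et (fun x : V3 => g x.2) 0.
Proof.
apply: is_derive_quotient; rewrite (_ : (fun h : R => _) = fun=> 0); first exact: cvg_cst.
by apply/funext => h; rewrite /= scaler0 add0r subrr scaler0.
Qed.

End Lift.

#[local] Opaque derive along.

Section SmoothDensity.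
Context {R : realType} {V : normedModType R} (B : set V) (oB : open B).
Notation V6 := 'rV[R]_(3 + 3).
Notation sm := (smooth_on B).
Variables (f f1 f2 f11 f12 f21 f22 : V -> V6).
Hypotheses (sf : sm f) (s1 : sm f1) (s2 : sm f2).
Hypotheses (s11 : sm f11) (s12 : sm f12) (s21 : sm f21) (s22 : sm f22).

Lemma sm_gram : sm (fun x => gram (f1 x) (f2 x)).
Proof.
have s := sm_dot oB s1 s2.
apply: (sm_eq oB (f := fun x => dot (f1 x) (f1 x) * dot (f2 x) (f2 x) -
  dot (f1 x) (f2 x) * dot (f1 x) (f2 x))); first by move=> x _; rewrite /gram expr2.
exact: (sm_add oB (sm_mul oB (sm_dot oB s1 s1) (sm_dot oB s2 s2)) (sm_opp oB (sm_mul oB s s))).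
Qed.

Hypothesis G0 : forall x, B x -> 0 < gram (f1 x) (f2 x).

Lemma sm_density_along : sm (density_along f f1 f2 f11 f12 f21 f22).
Proof.
have si : sm (fun x => (gram (f1 x) (f2 x))^-1).
  by apply: (sm_inv oB _ sm_gram) => x Bx; exact: lt0r_neq0 (G0 Bx).
have s12' := sm_dot oB s1 s2; have s22' := sm_dot oB s2 s2; have s11' := sm_dot oB s1 s1.
have sN : sm (fun x => raw_trace (f1 x) (f2 x) (f11 x) (f12 x) (f21 x) (f22 x)).
  apply: (sm_scale oB si); apply: (sm_add oB); last exact: (sm_scale oB s11' s22).
  apply: (sm_add oB (sm_scale oB s22' s11)); apply: (sm_opp oB).
  exact: (sm_scale oB s12' (sm_add oB s12 s21)).
have n1 := sm_dot oB sN s1; have n2 := sm_dot oB sN s2.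
have sH : sm (mean_along f f1 f2 f11 f12 f21 f22).
  apply: (sm_add oB); last first.
    apply: (sm_opp oB); apply: (sm_scale oB _ s2); apply: (sm_mul oB si).
    exact: (sm_add oB (sm_mul oB s11' n2) (sm_opp oB (sm_mul oB s12' n1))).
  apply: (sm_add oB); last first.
    apply: (sm_opp oB); apply: (sm_scale oB _ s1); apply: (sm_mul oB si).
    exact: (sm_add oB (sm_mul oB s22' n1) (sm_opp oB (sm_mul oB s12' n2))).
  apply: (sm_add oB sN); apply: (sm_opp oB); exact: (sm_scale oB (sm_dot oB sN sf) sf).
apply: (sm_mul oB); last exact: (sm_sqrt oB G0 sm_gram).
exact: (sm_add oB (sm_mul oB (sm_cst B _) (sm_dot oB sH sH)) (sm_cst B _)).
Qed.

End SmoothDensity.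

Section Deformation.
Context {R : realType}.
Notation V6 := 'rV[R]_(3 + 3).
Notation V3 := (R * (R * R))%type.
Let et : V3 := (1, 0).
Variables (A : set (R * R)) (oA : open A) (f : R * R -> V6) (phi : R * R -> R) (w : V6).
Hypotheses (sf : smooth_on A f) (sphi : smooth_on A phi).

Definition sphere_part (x : V6) : V6 := w - dot w x *: x.

(** Moves x in the direction of the part of w tangent to the sphere and
    normalizes, so that the deformed surface stays in the sphere; s is the
    value of the cut-off function. *)
Definition push_point (t s : R) (x : V6) : V6 :=
  (Num.sqrt (1 + (t * s) * (t * s) * dot (sphere_part x) (sphere_part x)))^-1 *:
  (x + (t * s) *: sphere_part x).

Definition deformation (x : V3) : V6 := push_point x.1 (phi x.2) (f x.2).

Let N_gt0 t s x : 0 < 1 + (t * s) * (t * s) * dot (sphere_part x) (sphere_part x).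
Proof. by rewrite ltr_wpDr// mulr_ge0 ?dot_ge0// -expr2 sqr_ge0. Qed.

Lemma enorm_push_point t s x : enorm x = 1 -> enorm (push_point t s x) = 1.
Proof.
move=> x1; have xx : dot x x = 1 by rewrite -enorm_sq x1 expr1n.
rewrite /enorm /push_point; set N := 1 + _.
have N0 : 0 < N by exact: N_gt0.
rewrite dotZl dotZr.
have xw : dot x (sphere_part x) = 0 by rewrite /sphere_part dotBr dotZr xx mulr1 dotC subrr.
have -> : dot (x + (t * s) *: sphere_part x) (x + (t * s) *: sphere_part x) = N.
  move: xw @N N0; move: (sphere_part x) => p xp N _.
  by rewrite !(dotDl, dotDr, dotZl, dotZr) xx (dotC p x) xp /N; ring.
have s0 : Num.sqrt N != 0 by rewrite gt_eqF// sqrtr_gt0.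
rewrite [X in _ * (_ * X)](_ : N = Num.sqrt N * Num.sqrt N); last by rewrite -expr2 sqr_sqrtr// ltW.
by rewrite mulKf// mulVf// sqrtr1.
Qed.

Lemma push_point0l s x : push_point 0 s x = x.
Proof. by rewrite /push_point !mul0r addr0 sqrtr1 invr1 !scale0r addr0 scale1r. Qed.

Lemma push_point0r t x : push_point t 0 x = x.
Proof. by rewrite /push_point mulr0 !mul0r addr0 sqrtr1 invr1 !scale0r addr0 scale1r. Qed.

Lemma sm_sphere_part : smooth_on A (fun u => sphere_part (f u)).
Proof.
apply: (sm_add oA (sm_cst A w)); apply: (sm_opp oA).
exact: (sm_scale oA (sm_dot oA (sm_cst A w) sf) sf).
Qed.

Lemma sm_deformation : smooth_on (cylinder A) deformation.
Proof.
have oC := open_cylinder oA; have sw := sm_snd sm_sphere_part.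
have sp := sm_mul oC (sm_fst (cylinder A)) (sm_snd sphi).
apply: (sm_scale oC); last exact: (sm_add oC (sm_snd sf) (sm_scale oC sp sw)).
have sN := sm_add oC (sm_cst (cylinder A) (1 : R)) (sm_mul oC (sm_mul oC sp sp) (sm_dot oC sw sw)).
apply: (sm_inv oC (f := fun x => Num.sqrt _)); last exact: (sm_sqrt oC _ sN).
by move=> x _; rewrite gt_eqF// sqrtr_gt0; exact: N_gt0.
Qed.

Lemma derive_deformation u :
  is_derive ((0, u) : V3) et deformation (phi u *: sphere_part (f u)).
Proof.
set x : V3 := (0, u).
have D1 := is_derive_fst x et; have D2 := derive_time phi x.
have D3 := derive_time f x; have D4 := derive_time (fun u => sphere_part (f u)) x.
have D5 := derive_time (fun u => dot (sphere_part (f u)) (sphere_part (f u))) x.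
have P := is_derive_mulR D1 D2.
have Nd := is_derive_addW (is_derive_cstR x et 1) (is_derive_mulR (is_derive_mulR P P) D5).
pose N (y : V3) : R := 1 + y.1 * phi y.2 * (y.1 * phi y.2) *
  dot (sphere_part (f y.2)) (sphere_part (f y.2)).
have N0 : 0 < N x by exact: N_gt0.
have Sd := is_derive_sqrtR (f := N) N0 Nd.
have S0 : Num.sqrt (N x) != 0 by rewrite gt_eqF// sqrtr_gt0.
have E := is_derive_scale (is_derive_invR (f := fun y => Num.sqrt (N y)) S0 Sd) (is_derive_addW D3 (is_derive_scale P D4)).
apply: (is_derive_cast E); rewrite /N /x /=.
by rewrite !(mul0r, mulr0, addr0, add0r, mul1r, scale0r, scaler0) sqrtr1 invr1 scale1r.
Qed.

End Deformation.

#[local] Transparent derive along.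

#[local] Opaque derive along.

(** The tube lemma for a compact rectangle. *)
Lemma rect_tube (R : realType) (O : set (R * (R * R))) a1 b1 a2 b2 : open O ->
  (forall u, rect a1 b1 a2 b2 u -> O (0, u)) ->
  \forall t \near (0 : R), forall u, rect a1 b1 a2 b2 u -> O (t, u).
Proof.
move=> oO QO.
have /compact_near_coveringP/(_ _ (nbhs (0 : R)) (fun t u => O (t, u)) _) := @compact_rect R a1 b1 a2 b2.
apply => u Qu; have [[U1 U2] /= [n1 n2] UO] := open_nbhs_nbhs (conj oO (QO u Qu)).
by exists (U2, U1) => // -[u' t] /= [v1 v2]; exact: (UO (t, u')).
Qed.

Lemma congr7 (T U : Type) (F : T -> T -> T -> T -> T -> T -> T -> U) x1 x2 x3 x4 x5 x6 x7
    y1 y2 y3 y4 y5 y6 y7 : x1 = y1 -> x2 = y2 -> x3 = y3 -> x4 = y4 -> x5 = y5 -> x6 = y6 ->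
  x7 = y7 -> F x1 x2 x3 x4 x5 x6 x7 = F y1 y2 y3 y4 y5 y6 y7.
Proof. by move=> -> -> -> -> -> -> ->. Qed.

Lemma sm_willmore_field (R : realType) (A : set (R * R)) (f e1 e2 : R * R -> 'rV[R]_(3 + 3))
    (p1 p2 : R * R -> R * R) (w1 w2 a b c d h : R * R -> R) :
  moving_frame A f e1 e2 p1 p2 w1 w2 a b c d -> smooth_on A h ->
  smooth_on A (willmore_field e1 e2 p1 p2 w1 w2 a b c h).
Proof.
move=> M sh; have oA := mf_open M; have s1 := sm_stress1 M sh; have s2 := sm_stress2 M sh.
apply: (sm_add oA); last exact: (sm_mean_vector M sh).
apply: (sm_add oA).
  exact: (sm_add oA (sm_alongV oA (mf_p1 M) s1) (sm_alongV oA (mf_p2 M) s2)).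
exact: (sm_add oA (sm_scale oA (mf_w2 M) s1) (sm_opp oA (sm_scale oA (mf_w1 M) s2))).
Qed.

Section EnergyDerivative.
Context {R : realType}.
Notation V6 := 'rV[R]_(3 + 3).
Notation V3 := (R * (R * R))%type.
Let ex : R * R := (1, 0).
Let ey : R * R := (0, 1).
Let et : V3 := (1, 0).
Let lx : V3 := (0, ex).
Let ly : V3 := (0, ey).
Variables (A : set (R * R)) (f e1 e2 : R * R -> V6).
Variables (p1 p2 : R * R -> R * R) (w1 w2 a b c d h : R * R -> R).
Hypothesis M : moving_frame A f e1 e2 p1 p2 w1 w2 a b c d.
Let J u := (p1 u).1 * (p2 u).2 - (p1 u).2 * (p2 u).1.
Hypothesis J_gt0 : forall u, A u -> 0 < J u.
Hypothesis sh : smooth_on A h.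
Hypothesis ach : forall u, A u -> a u + c u = h u.
Hypothesis bd0 : forall u, A u -> b u + d u = 0.
Let oA := mf_open M.
Let sf := mf_f M.
Variables (phi : R * R -> R) (w : V6).
Hypothesis sphi : smooth_on A phi.

Let V u := phi u *: sphere_part w (f u).
Let sV : smooth_on A V := sm_scale oA sphi (sm_sphere_part oA w sf).
Let C := cylinder A.
Let oC : open C := open_cylinder oA.
Let K : V3 -> V6 := deformation f phi w.
Let sK : smooth_on C K := sm_deformation oA w sf sphi.
Let Kx := 'D_lx K.
Let Ky := 'D_ly K.
Let sKx : smooth_on C Kx := sm_derive lx sK.
Let sKy : smooth_on C Ky := sm_derive ly sK.

Let K0 : (fun u => K (0, u)) = f.
Proof. by apply/funext => u; exact: push_point0l. Qed.

Let restrict (g : V3 -> V6) (g0 : R * R -> V6) v : (fun u => g (0, u)) = g0 ->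
  (fun u => 'D_((0, v) : V3) g (0, u)) = 'D_v g0.
Proof. by move=> E; exact: (etrans (esym (slice_derive g 0 v)) (congr1 (fun g => 'D_v g) E)). Qed.

Let Kx0 : (fun u => Kx (0, u)) = 'D_ex f := restrict ex K0.
Let Ky0 : (fun u => Ky (0, u)) = 'D_ey f := restrict ey K0.

Let Kt0 : (fun u => 'D_et K (0, u)) = V.
Proof.
apply/funext => u.
exact: (@derive_val _ _ _ _ _ _ _ (derive_deformation f phi w u)).
Qed.

(* Symmetry of mixed derivatives moves the parameter derivative inside; on the
   slice t = 0 it is then a known field, which may be differentiated in the chart. *)
Let restrict_time (g : V3 -> V6) (g0 : R * R -> V6) v u : smooth_on C g ->
  (forall u, A u -> 'D_et g (0, u) = g0 u) -> A u ->
  'D_et ('D_((0, v) : V3) g) (0, u) = 'D_v g0 u.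
Proof.
move=> sg E Au; have Cu : C (0, u) by exact: Au.
apply: etrans (schwarzV oC et (0, v) sg Cu) _.
apply: etrans (esym (congr1 (fun k => k u) (slice_derive ('D_et g) 0 v))) _.
exact: (along_eq oA (fun=> v) E Au).
Qed.

Let at0 {T : Type} (g g' : R * R -> T) u : g = g' -> g u = g' u.
Proof. by move=> ->. Qed.

Let Tx u : A u -> 'D_et Kx (0, u) = 'D_ex V u := restrict_time ex sK (fun u _ => at0 u Kt0).
Let Ty u : A u -> 'D_et Ky (0, u) = 'D_ey V u := restrict_time ey sK (fun u _ => at0 u Kt0).

Let O : set V3 := [set x | C x /\ 0 < gram (Kx x) (Ky x)].
Let oO : open O.
Proof.
rewrite openE => x [Cx gx]; rewrite /interior.
have cg := sm_continuous (sm_gram oC sKx sKy) Cx.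
have N1 : \forall y \near x, C y by exact: (open_nbhs_nbhs (conj oC Cx)).
have N2 : \forall y \near x, 0 < gram (Kx y) (Ky y) by exact: (cvgr_gt _ cg _ gx).
exact: filterI N1 N2.
Qed.

Let W := density_along K Kx Ky ('D_lx Kx) ('D_lx Ky) ('D_ly Kx) ('D_ly Ky).
Let sW : smooth_on O W.
Proof.
have OC : O `<=` C by move=> x [].
have s (g : V3 -> V6) : smooth_on C g -> smooth_on O g by move=> sg k; exact: (Ck_subset OC (sg k)).
apply: (sm_density_along oO (s _ sK) (s _ sKx) (s _ sKy) (s _ (sm_derive lx sKx))
  (s _ (sm_derive lx sKy)) (s _ (sm_derive ly sKx)) (s _ (sm_derive ly sKy))).
by move=> x [].
Qed.

Let O0 u : A u -> O (0, u).
Proof.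
move=> Au; split; first exact: Au.
have [g0 _ _ _ _] := density_var_divergence M J_gt0 sh ach bd0 sV Au.
by rewrite (at0 u Kx0) (at0 u Ky0).
Qed.

Let E := willmore_field e1 e2 p1 p2 w1 w2 a b c h.
Let F1 := flux1 e1 e2 p1 a b h V.
Let F2 := flux2 e1 e2 p2 b c h V.
Let X u := (J u)^-1 * ((p1 u).1 * F1 u + (p2 u).1 * F2 u).
Let Y u := (J u)^-1 * ((p1 u).2 * F1 u + (p2 u).2 * F2 u).

Let DW u : A u -> 'D_et W (0, u) = 'D_ex X u + 'D_ey Y u + (J u)^-1 * dot (V u) (E u).
Proof.
move=> Au; have Cu : C (0, u) by exact: Au.
have [g0 gs mE orth KD] := density_var_divergence M J_gt0 sh ach bd0 sV Au.
pose D (g : V3 -> V6) (sg : smooth_on C g) := sm_is_derive et sg Cu.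
have r1 := at0 u K0; have r2 := at0 u Kx0; have r3 := at0 u Ky0.
have r4 := at0 u (restrict ex Kx0); have r5 := at0 u (restrict ex Ky0).
have r6 := at0 u (restrict ey Kx0); have r7 := at0 u (restrict ey Ky0).
have HE : mean_along K Kx Ky ('D_lx Kx) ('D_lx Ky) ('D_ly Kx) ('D_ly Ky) (0, u) =
    mean_vector e1 h u.
  exact: (etrans (congr7 (@mean_formula R) r1 r2 r3 r4 r5 r6 r7) mE).
have G0 : 0 < gram (Kx (0, u)) (Ky (0, u)) by exact: (O0 Au).2.
have [k1 k2 k3] := orth.
have q1 : dot (K (0, u)) (mean_along K Kx Ky ('D_lx Kx) ('D_lx Ky) ('D_ly Kx) ('D_ly Ky) (0, u)) = 0.
  exact: (etrans (congr2 (@dot R) r1 HE) k1).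
have q2 : dot (Kx (0, u)) (mean_along K Kx Ky ('D_lx Kx) ('D_lx Ky) ('D_ly Kx) ('D_ly Ky) (0, u)) = 0.
  exact: (etrans (congr2 (@dot R) r2 HE) k2).
have q3 : dot (Ky (0, u)) (mean_along K Kx Ky ('D_lx Kx) ('D_lx Ky) ('D_ly Kx) ('D_ly Ky) (0, u)) = 0.
  exact: (etrans (congr2 (@dot R) r3 HE) k3).
have DD := is_derive_density (D _ sK) (D _ sKx) (D _ sKy) (D _ (sm_derive lx sKx))
  (D _ (sm_derive lx sKy)) (D _ (sm_derive ly sKx)) (D _ (sm_derive ly sKy)) G0 q1 q2 q3.
apply: etrans (@derive_val _ _ _ _ _ _ _ DD) _.
apply: etrans KD.
have t1 := at0 u Kt0; have t2 := Tx Au; have t3 := Ty Au.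
have t4 := restrict_time ex sKx (fun u Au => Tx Au) Au.
have t5 := restrict_time ex sKy (fun u Au => Ty Au) Au.
have t6 := restrict_time ey sKx (fun u Au => Tx Au) Au.
have t7 := restrict_time ey sKy (fun u Au => Ty Au) Au.
apply: etrans (congr1 (fun F => F _ _ _ _ _ _ _ _) (congr7 (@density_var R) r1 r2 r3 r4 r5 r6 r7)) _.
exact: (etrans (congr1 (fun F => F _) (congr7 (@density_var R _ _ _ _ _ _ _) t1 t2 t3 t4 t5 t6 t7)) (congr1 _ HE)).
Qed.

Variables (a1 b1 a2 b2 : R).
Hypotheses (ab1 : a1 < b1) (ab2 : a2 < b2).
Notation Q := (rect a1 b1 a2 b2).
Hypothesis QA : Q `<=` A.
Hypothesis flat : forall u, Q u -> phi u = 0 -> forall v, 'D_v phi u = 0.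

Let flux_eq0 u : Q u -> phi u = 0 -> F1 u = 0 /\ F2 u = 0.
Proof.
move=> Qu p0; have Au := QA Qu.
have V0 : V u = 0 by rewrite /V p0 scale0r.
have aV p : along p V u = 0.
  apply: etrans (along_scale p sphi (sm_sphere_part oA w sf) Au) _.
  have e : along p phi u = 0 by exact: (flat Qu p0 (p u)).
  by rewrite e p0 !scale0r addr0.
have z (Z1 Z2 x y : V6) : x = 0 -> y = 0 -> 2^-1 * dot x Z1 - dot y Z2 = 0.
  by move=> -> ->; rewrite !dot0l mulr0 subr0.
by split; exact: (z _ _ _ _ (aV _) V0).
Qed.

(** Differentiate under the integral and replace the variation of the density
    by a divergence plus the pairing with E. The divergence integrates to
    zero, because on the edges the cut-off function vanishes together with its
    gradient, and hence so do V and its first derivatives. *)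
Lemma chart_energy_derivative : (forall u, Q u -> u.1 = a1 \/ u.1 = b1 \/ u.2 = a2 \/ u.2 = b2 -> phi u = 0) ->
  is_derive (0 : R) (1 : R)
   (fun t => \int[leb2 R]_(u in Q) willmore_density (fun u => deformation f phi w (t, u)) u)
   (\int[leb2 R]_(u in Q) ((J u)^-1 * dot (phi u *: sphere_part w (f u)) (E u))).
Proof.
move=> edge.
have sJ : smooth_on A J.
  have [s11 s12] := mf_p1 M; have [s21 s22] := mf_p2 M.
  exact: (sm_add oA (sm_mul oA s11 s22) (sm_opp oA (sm_mul oA s12 s21))).
have sJi : smooth_on A (fun u => (J u)^-1).
  by apply: (sm_inv oA _ sJ) => u Au; exact: lt0r_neq0 (J_gt0 Au).
have sF1 : smooth_on A F1 := sm_flux1 M sh sV.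
have sF2 : smooth_on A F2 := sm_flux2 M sh sV.
have sX : smooth_on A X.
  exact: (sm_mul oA sJi (sm_add oA (sm_mul oA (mf_p1 M).1 sF1) (sm_mul oA (mf_p2 M).1 sF2))).
have sY : smooth_on A Y.
  exact: (sm_mul oA sJi (sm_add oA (sm_mul oA (mf_p1 M).2 sF1) (sm_mul oA (mf_p2 M).2 sF2))).
have sE : smooth_on A E := sm_willmore_field M sh.
have sm : smooth_on A (fun u => (J u)^-1 * dot (V u) (E u)) := sm_mul oA sJi (sm_dot oA sV sE).
have int (g : R * R -> R) : smooth_on A g -> (leb2 R).-integrable Q (EFin \o g).
  by move=> sg; apply: integrable_rect => u Qu; exact: (sm_continuous sg (QA Qu)).
have sDX := sm_derive ex sX; have sDY := sm_derive ey sY.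
have mQ : measurable (Q : set (measurableTypeR R * measurableTypeR R)) by exact: measurable_rect.
have I1 := is_derive_under_integral oO (sW 1) (fun u Qu => O0 (QA Qu)).
have zX u : Q u -> u.1 = a1 \/ u.1 = b1 \/ u.2 = a2 \/ u.2 = b2 -> X u = 0 /\ Y u = 0.
  move=> Qu /(edge u Qu) p0; have [z1 z2] := flux_eq0 Qu p0.
  by rewrite /X /Y z1 z2 !mulr0 addr0 mulr0.
have iX : \int[leb2 R]_(u in Q) 'D_ex X u = 0.
  apply: (integral_derive1 ab1 oA QA (sX 1)) => y yab.
    by have [] := zX (a1, y) (conj (introT andP (conj (lexx a1) (ltW ab1))) yab) (or_introl (erefl a1)).
  by have [] := zX (b1, y) (conj (introT andP (conj (ltW ab1) (lexx b1))) yab) (or_intror (or_introl (erefl b1))).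
have iY : \int[leb2 R]_(u in Q) 'D_ey Y u = 0.
  apply: (integral_derive2 ab2 oA QA (sY 1)) => x xab.
    by have [] := zX (x, a2) (conj xab (introT andP (conj (lexx a2) (ltW ab2)))) (or_intror (or_intror (or_introl (erefl a2)))).
  by have [] := zX (x, b2) (conj xab (introT andP (conj (ltW ab2) (lexx b2)))) (or_intror (or_intror (or_intror (erefl b2)))).
have I2 : \int[leb2 R]_(u in Q) 'D_et W (0, u) = \int[leb2 R]_(u in Q) ((J u)^-1 * dot (V u) (E u)).
  have I : \int[leb2 R]_(u in Q) 'D_et W (0, u) =
      \int[leb2 R]_(u in Q) ('D_ex X u + 'D_ey Y u + (J u)^-1 * dot (V u) (E u)).
    by apply: eq_Rintegral => u; rewrite inE => Qu; exact: DW (QA Qu).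
  apply: etrans I _.
  apply: etrans (RintegralD mQ (int _ (sm_add oA sDX sDY)) (int _ sm)) _.
  apply: etrans (congr1 (fun x => x + _) (etrans (RintegralD mQ (int _ sDX) (int _ sDY)) (congr2 +%R iX iY))) _.
  by rewrite addr0 add0r.
have I3 : is_derive (0 : R) (1 : R) (fun t => \int[leb2 R]_(u in Q) W (t, u))
   (\int[leb2 R]_(u in Q) ((J u)^-1 * dot (V u) (E u))) := is_derive_cast I1 I2.
apply: (near_eq_is_derive _ I3).
apply: filterS (rect_tube oO (fun u Qu => O0 (QA Qu))) => t QO.
apply: eq_Rintegral => u; rewrite inE => Qu.
have [Cu gu] := QO u Qu.
have s (v : R * R) : 'D_v (fun u => K (t, u)) = fun u => 'D_((0, v) : V3) K (t, u) := slice_derive K t v.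
have ss (v v' : R * R) : 'D_v' ('D_v (fun u => K (t, u))) u = 'D_((0, v') : V3) ('D_((0, v) : V3) K) (t, u).
  exact: (etrans (congr1 (fun g => 'D_v' g u) (s v)) (at0 u (slice_derive _ t v'))).
have [mE dE] := mean_curvatureE (f := fun u => K (t, u)) (u := u)
  (at0 u (s ex)) (at0 u (s ey)) (ss ex ex) (ss ey ex) (ss ex ey) (ss ey ey) (lt0r_neq0 gu).
rewrite /willmore_density /area_density enorm_sq.
exact: (congr2 (fun m g => (4^-1 * dot m m + 1) * Num.sqrt g) (esym mE) (esym dE)).
Qed.

End EnergyDerivative.

#[local] Transparent derive along.

Section PairMaps.
Context {R : realType} {V : normedModType R} (A : set V) (oA : open A).

Lemma Ck_id k : Ck k A (id : V -> V).
Proof.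
have ci x : A x -> {for x, continuous (id : V -> V)} by move=> _; exact: cvg_id.
case: k => [|k]; first exact: (conj ci I).
refine (conj ci _) => v; split; first by move=> x _; exact: derivable_id.
have e : 'D_v (id : V -> V) = fun=> v by apply/funext => x; exact: derive_id.
exact: (eq_ind _ (Ck k A) (Ck_cst k A v) _ (esym e)).
Qed.

Lemma derivable_pair (g : V -> R * R) x v : derivable g x v ->
  is_derive x v (fun y => (g y).1) ('D_v g x).1 /\
  is_derive x v (fun y => (g y).2) ('D_v g x).2.
Proof.
move=> dg; have L : (fun h : R => h^-1 *: (g (h *: v + x) - g x)) @ 0^' --> 'D_v g x := dg.
split; apply: is_derive_quotient.
  exact: (cvg_comp _ _ L (@cvg_fst _ _ (nbhs ('D_v g x).1) (nbhs ('D_v g x).2) _)).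
exact: (cvg_comp _ _ L (@cvg_snd _ _ (nbhs ('D_v g x).1) (nbhs ('D_v g x).2) _)).
Qed.

Lemma Ck_pair k (g : V -> R * R) : Ck k A g ->
  Ck k A (fun x => (g x).1) /\ Ck k A (fun x => (g x).2).
Proof.
elim: k g => [|k IH] g Cg; have cg x (Ax : A x) := Ck_continuous Cg Ax.
  have c1 x : A x -> {for x, continuous (fun y => (g y).1)}.
    by move=> Ax; apply: (@continuous_comp _ _ _ g fst); [exact: cg|exact: cvg_fst].
  have c2 x : A x -> {for x, continuous (fun y => (g y).2)}.
    by move=> Ax; apply: (@continuous_comp _ _ _ g snd); [exact: cg|exact: cvg_snd].
  exact: (conj (conj c1 I) (conj c2 I)).
have [C1 C2] := IH g (CkS Cg).
have D v x (Ax : A x) := derivable_pair (Ck_derivable v Cg Ax).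
split; split => [x Ax|v]; [exact: (Ck_continuous C1 Ax)| |exact: (Ck_continuous C2 Ax)|].
  split; first by move=> x Ax; exact: (@ex_derive _ _ _ _ _ _ _ (D v x Ax).1).
  apply: (Ck_eq oA _ (IH _ (Ck_derive v Cg)).1) => x Ax.
  exact: esym (@derive_val _ _ _ _ _ _ _ (D v x Ax).1).
split; first by move=> x Ax; exact: (@ex_derive _ _ _ _ _ _ _ (D v x Ax).2).
apply: (Ck_eq oA _ (IH _ (Ck_derive v Cg)).2) => x Ax.
exact: esym (@derive_val _ _ _ _ _ _ _ (D v x Ax).2).
Qed.

End PairMaps.

Section Bump.
Context {R : realType} (a1 b1 a2 b2 : R).

Definition hill (u : R * R) : R := flat_exp 0 (u.1 - a1) * flat_exp 0 (b1 - u.1) *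
  (flat_exp 0 (u.2 - a2) * flat_exp 0 (b2 - u.2)).
(** A square, so that its gradient vanishes wherever the function does. *)
Definition bump (u : R * R) : R := hill u * hill u.

Lemma sm_hill (V : normedModType R) (A : set V) (t : V -> R * R) : open A -> smooth_on A t ->
  smooth_on A (fun x => hill (t x)).
Proof.
move=> oA st; have s1 : smooth_on A (fun x => (t x).1) by move=> k; exact: (Ck_pair oA (st k)).1.
have s2 : smooth_on A (fun x => (t x).2) by move=> k; exact: (Ck_pair oA (st k)).2.
have fl (g : V -> R) : smooth_on A g -> smooth_on A (fun x => flat_exp 0 (g x)).
  by move=> sg k; exact: (Ck_comp1 oA (fun x _ => I) (sg k) (Ck_flat_exp k 0)).
have sB (g : V -> R) k : smooth_on A g -> smooth_on A (fun x => g x - k).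
  by move=> sg; exact: (sm_add oA sg (sm_cst A _)).
have sC (g : V -> R) k : smooth_on A g -> smooth_on A (fun x => k - g x).
  by move=> sg; exact: (sm_add oA (sm_cst A _) (sm_opp oA sg)).
exact: (sm_mul oA (sm_mul oA (fl _ (sB _ _ s1)) (fl _ (sC _ _ s1)))
  (sm_mul oA (fl _ (sB _ _ s2)) (fl _ (sC _ _ s2)))).
Qed.

Lemma sm_bump (V : normedModType R) (A : set V) (t : V -> R * R) : open A -> smooth_on A t ->
  smooth_on A (fun x => bump (t x)).
Proof. by move=> oA st; exact: (sm_mul oA (sm_hill oA st) (sm_hill oA st)). Qed.

Lemma bump_ge0 u : 0 <= bump u. Proof. by rewrite /bump -expr2 sqr_ge0. Qed.

Lemma bump_gt0 u : a1 < u.1 < b1 -> a2 < u.2 < b2 -> 0 < bump u.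
Proof.
move=> /andP[x1 x2] /andP[x3 x4].
by rewrite /bump mulr_gt0// /hill !mulr_gt0// flat_exp_gt0// subr_gt0.
Qed.

Lemma bump_eq0 u : u.1 <= a1 \/ b1 <= u.1 \/ u.2 <= a2 \/ b2 <= u.2 -> bump u = 0.
Proof.
move=> H; rewrite /bump (_ : hill u = 0) ?mulr0// /hill.
have z x y : x <= y -> flat_exp 0 (x - y) = 0.
  by move=> xy; rewrite flat_exp_eq0// subr_le0.
by case: H => [/z ->|[/z ->|[/z ->|/z ->]]]; rewrite !(mulr0, mul0r).
Qed.

Lemma derive_bump u v : bump u = 0 -> 'D_v bump u = 0.
Proof.
move=> /eqP; rewrite mulf_eq0 orbb => /eqP h0.
have sh : smooth_on setT hill by apply: (sm_hill openT) => k; exact: Ck_id.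
apply: etrans (alongM (fun=> v) sh sh I : _ = _) _.
by rewrite h0 mulr0 mul0r addr0.
Qed.

End Bump.

#[local] Opaque derive along.

Section LocalDensity.
Context {R : realType}.
Implicit Types f g : R * R -> 'rV[R]_(3 + 3).

(** The density depends on the germ of the map only. *)
Lemma willmore_density_eq (A : set (R * R)) f g u : open A -> (forall x, A x -> f x = g x) ->
  A u -> willmore_density f u = willmore_density g u.
Proof.
move=> oA fg Au.
have e1 (i : 'I_2) x : A x -> partial i f x = partial i g x.
  by move=> Ax; exact: (along_eq oA (fun=> axis i) fg Ax).
have e2 (i j : 'I_2) : partial i (partial j f) u = partial i (partial j g) u.
  exact: (along_eq oA (fun=> axis i) (e1 j) Au).
have eM : induced_metric f u = induced_metric g u.
  apply/matrixP => i j; apply: etrans (mxE _ _ _ _) _; apply: etrans _ (esym (mxE _ _ _ _)).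
  exact: (congr2 (@dot R) (e1 i u Au) (e1 j u Au)).
have eT w : tangent_part f u w = tangent_part g u w.
  rewrite /tangent_part eM; apply: eq_bigr => i _; apply: eq_bigr => j _.
  exact: (congr2 (fun x y => (_ * dot w x) *: y) (e1 i u Au) (e1 j u Au)).
have eH : mean_curvature f u = mean_curvature g u.
  rewrite /mean_curvature eM; apply: eq_bigr => i _; apply: eq_bigr => j _.
  apply: congr1; rewrite /second_form eT.
  exact: (congr2 (fun x y => x - dot x y *: y - tangent_part g u x) (e2 i j) (fg u Au)).
by rewrite /willmore_density /area_density eM eH.
Qed.

End LocalDensity.

#[local] Transparent derive along.

(** * The Euler-Lagrange equation on the surface *)

#[local] Opaque derive along.

Section Charts.
Context {R : realType} {S : smooth_surface R}.
Implicit Types (c : chart S) (x : S) (u : R * R).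

Lemma cinvK c u : cimg c u -> cmap c (cinv c u) = u.
Proof. by move=> [x dx <-]; rewrite cmapK. Qed.

Lemma cinv_dom c u : cimg c u -> cdom c (cinv c u).
Proof. by move=> [x dx <-]; rewrite cmapK. Qed.

Lemma cimg_map c x : cdom c x -> cimg c (cmap c x).
Proof. by move=> dx; exists x. Qed.

Lemma open_cinv c (O : set S) : open O -> open (cimg c `&` cinv c @^-1` O).
Proof.
move=> oO; rewrite openE => u [Cu Ou]; rewrite /interior.
have n1 : \forall y \near u, cimg c y := open_nbhs_nbhs (conj (@cimg_open _ S c) Cu).
have n2 : \forall y \near u, O (cinv c y).
  exact: (cinv_continuous Cu (open_nbhs_nbhs (conj oO Ou))).
exact: filterI n1 n2.
Qed.

Lemma compact_cinv c (Q : set (R * R)) : compact Q -> Q `<=` cimg c -> compact (cinv c @` Q).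
Proof.
move=> cQ QC; apply: continuous_compact => //.
apply: continuous_in_subspaceT => u; rewrite inE => Qu.
exact: cinv_continuous (QC u Qu).
Qed.

Definition extend_chart c (g : R * R -> R) (x : S) : R :=
  if `[< cdom c x >] then g (cmap c x) else 0.

Lemma extend_chartE c g u : cimg c u -> extend_chart c g (cinv c u) = g u.
Proof.
move=> Cu; rewrite /extend_chart; case: asboolP => [_|[]]; last exact: cinv_dom.
by rewrite cinvK.
Qed.

Lemma extend_chart_out c g (Q : set (R * R)) x : (forall u, ~ Q u -> g u = 0) ->
  ~ (cinv c @` Q) x -> extend_chart c g x = 0.
Proof.
move=> g0 nx; rewrite /extend_chart; case: asboolP => // dx.
by apply: g0 => Qx; apply: nx; exists (cmap c x) => //; exact: cmapK.
Qed.

(** Near a point of another chart, the extension by zero is either the bump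
    function composed with a transition map or zero, the latter because the
    support is compact, hence closed. *)
Lemma sm_extend_bump c a1 b1 a2 b2 : rect a1 b1 a2 b2 `<=` cimg c ->
  forall c', smooth_on (cimg c') (extend_chart c (bump a1 b1 a2 b2) \o cinv c').
Proof.
move=> QC c'; set Q := rect _ _ _ _ in QC *.
have cK : closed (cinv c @` Q).
  apply: compact_closed; first exact: surface_hausdorff.
  by apply: (compact_cinv _ QC); exact: compact_rect.
have oU1 := open_cinv (c := c') (cdom_open c).
have oU2 := open_cinv (c := c') (closed_openC cK).
have b0 u : ~ Q u -> bump a1 b1 a2 b2 u = 0.
  move=> nQ; apply: bump_eq0.
  have [h1|h1] := leP u.1 a1; first by left.
  have [h2|h2] := leP b1 u.1; first by right; left.
  have [h3|h3] := leP u.2 a2; first by do 2 right; left.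
  have [h4|h4] := leP b2 u.2; first by do 3 right.
  by case: nQ; split; rewrite !ltW.
have s1 : smooth_on (cimg c' `&` cinv c' @^-1` cdom c) (extend_chart c (bump a1 b1 a2 b2) \o cinv c').
  apply: (sm_eq oU1 _ (sm_bump a1 b1 a2 b2 oU1 (@transition_smooth _ S c' c))) => u [Cu du].
  by rewrite /= /extend_chart asboolT.
have s2 : smooth_on (cimg c' `&` cinv c' @^-1` (~` (cinv c @` Q))) (extend_chart c (bump a1 b1 a2 b2) \o cinv c').
  apply: (sm_eq oU2 _ (sm_cst _ (0 : R))) => u [Cu du].
  exact: esym (extend_chart_out b0 du).
move=> k; apply: Ck_subset (Ck_setU (s1 k) (s2 k)) => u Cu.
have [dx|dx] := pselect (cdom c (cinv c' u)); [left|right]; split => //.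
by move=> -[v Qv e]; apply: dx; rewrite -e; exact: cinv_dom (QC v Qv).
Qed.

Lemma cmap_cinv c (Q : set (R * R)) : Q `<=` cimg c -> cmap c @` (cinv c @` Q) = Q.
Proof.
move=> QC; rewrite eqEsubset; split => [_ [_ [u Qu <-] <-]|u Qu].
  by rewrite cinvK//; exact: QC.
by exists (cinv c u); [exists u|rewrite cinvK//; exact: QC].
Qed.

(** A support that lies in one chart is its own decomposition, so the energy
    is one integral in that chart. *)
Lemma single_piece c (Q : set (R * R)) :
  Q `<=` cimg c -> measurable (Q : set (measurableTypeR R * measurableTypeR R)) ->
  exists P : chart_partition (cinv c @` Q), forall G : S -> 'rV[R]_(3 + 3),
    willmore_energy P G = \int[leb2 R]_(u in Q) willmore_density (G \o cinv c) u.
Proof.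
move=> QC mQ; have E := cmap_cinv QC.
have cov : \bigcup_(k in [set: 'I_1]) (cinv c @` Q) = cinv c @` Q.
  by rewrite eqEsubset; split => [x [_ _ Qx]|x Qx] //; exists ord0.
have dis : trivIset setT (fun _ : 'I_1 => cinv c @` Q).
  by move=> i j _ _ _; rewrite !ord1.
have dom (k : 'I_1) : cinv c @` Q `<=` cdom c by move=> _ [u Qu <-]; exact: cinv_dom (QC u Qu).
have mes (k : 'I_1) : measurable (cmap c @` (cinv c @` Q) : set (measurableTypeR R * measurableTypeR R)) by rewrite E.
exists (ChartPartition (cp_chart := fun=> c) cov dis dom mes) => G.
by rewrite /willmore_energy big_ord1 /= E.
Qed.

End Charts.

Section EulerLagrange.
Context {R : realType} {S : smooth_surface R} (F : S -> 'rV[R]_(3 + 3)).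
Notation V6 := 'rV[R]_(3 + 3).
Hypotheses (imm : sphere_immersion F) (wil : willmore F).
Variables (c : chart S) (A : set (R * R)) (e1 e2 : R * R -> V6).
Variables (p1 p2 : R * R -> R * R) (w1 w2 a b cc d h : R * R -> R).
Let f := F \o cinv c.
Hypothesis AC : A `<=` cimg c.
Hypothesis M : moving_frame A f e1 e2 p1 p2 w1 w2 a b cc d.
Let J u := (p1 u).1 * (p2 u).2 - (p1 u).2 * (p2 u).1.
Hypothesis J_gt0 : forall u, A u -> 0 < J u.
Hypothesis sh : smooth_on A h.
Hypothesis ach : forall u, A u -> a u + cc u = h u.
Hypothesis bd0 : forall u, A u -> b u + d u = 0.
Let oA := mf_open M.
Let E := willmore_field e1 e2 p1 p2 w1 w2 a b cc h.

Lemma energy_variation_eq0 a1 b1 a2 b2 w : a1 < b1 -> a2 < b2 -> rect a1 b1 a2 b2 `<=` A ->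
  \int[leb2 R]_(u in rect a1 b1 a2 b2)
    ((J u)^-1 * dot (bump a1 b1 a2 b2 u *: sphere_part w (f u)) (E u)) = 0.
Proof.
move=> ab1 ab2 QA; have QC : rect a1 b1 a2 b2 `<=` cimg c by move=> u /QA /AC.
have [nF sF _] := imm.
set phi := bump a1 b1 a2 b2; set Q := rect a1 b1 a2 b2.
have sphi : smooth_on A phi by apply: (sm_bump _ _ _ _ oA) => k; exact: Ck_id.
have edge u : Q u -> u.1 = a1 \/ u.1 = b1 \/ u.2 = a2 \/ u.2 = b2 -> phi u = 0.
  move=> _ H; apply: bump_eq0.
  case: H => [->|[->|[->|->]]]; [left|right; left|do 2 right; left|do 3 right]; exact: lexx.
have D := chart_energy_derivative M J_gt0 sh ach bd0 w sphi ab1 ab2 QA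
  (fun u _ p0 v => derive_bump v p0) edge.
have [P EP] := single_piece QC (@measurable_rect R a1 b1 a2 b2).
pose Phi := extend_chart c phi.
pose G (t : R) (x : S) : V6 := push_point w t (Phi x) (F x).
have var : sphere_variation F (cinv c @` Q) 1 G.
  split.
  - by apply/funext => x; exact: push_point0l.
  - by move=> t x _; exact: enorm_push_point (nF x).
  - move=> t x _ nx; rewrite /G (_ : Phi x = 0); first exact: push_point0r.
    apply: (extend_chart_out _ nx) => u nQ; apply: bump_eq0.
    have [h1|h1] := leP u.1 a1; first by left.
    have [h2|h2] := leP b1 u.1; first by right; left.
    have [h3|h3] := leP u.2 a2; first by do 2 right; left.
    have [h4|h4] := leP b2 u.2; first by do 3 right.
    by case: nQ; split; rewrite !ltW.
  - move=> c' k.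
    apply: Ck_subset (sm_deformation (@cimg_open _ S c') w (sF c') (sm_extend_bump QC c') k).
    by move=> x [].
have cK : compact (cinv c @` Q) by apply: (compact_cinv _ QC); exact: compact_rect.
have D0 := wil cK ltr01 var P.
have e : (fun t => willmore_energy P (G t)) =
    (fun t => \int[leb2 R]_(u in Q) willmore_density (fun u => deformation f phi w (t, u)) u).
  apply/funext => t; apply: etrans (EP (G t)) _; apply: eq_Rintegral => u; rewrite inE => Qu.
  apply: (willmore_density_eq oA _ (QA u Qu)) => v Av.
  by rewrite /G /= /Phi (extend_chartE _ (AC Av)).
have D1 := eq_ind _ (fun k => is_derive (0 : R) (1 : R) k 0) D0 _ e.
exact: (etrans (esym (@derive_val _ _ _ _ _ _ _ D)) (@derive_val _ _ _ _ _ _ _ D1)).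
Qed.

Let not_positive z w : A z -> ~ 0 < dot (sphere_part w (f z)) (E z).
Proof.
move=> Az pos; pose m u := (J u)^-1 * dot (sphere_part w (f u)) (E u).
have [s11 s12] := mf_p1 M; have [s21 s22] := mf_p2 M.
have sJ : smooth_on A J.
  exact: (sm_add oA (sm_mul oA s11 s22) (sm_opp oA (sm_mul oA s12 s21))).
have sJi : smooth_on A (fun u => (J u)^-1).
  by apply: (sm_inv oA _ sJ) => u Au; exact: lt0r_neq0 (J_gt0 Au).
have sm : smooth_on A m := sm_mul oA sJi
  (sm_dot oA (sm_sphere_part oA w (mf_f M)) (sm_willmore_field M sh)).
have mz : 0 < m z by rewrite mulr_gt0// invr_gt0; exact: J_gt0.
have oB : open [set u | A u /\ 0 < m u].
  rewrite openE => x [Ax mx]; rewrite /interior.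
  have n1 : \forall y \near x, A y := open_nbhs_nbhs (conj oA Ax).
  have n2 : \forall y \near x, 0 < m y by exact: (cvgr_gt _ (sm_continuous sm Ax) _ mx).
  exact: filterI n1 n2.
have [r r0 QB] := rect_inside oB (conj Az mz).
have QA : rect (z.1 - r) (z.1 + r) (z.2 - r) (z.2 + r) `<=` A by move=> u /QB [].
have in1 (x : R) : x - r < x < x + r by rewrite ltrBlDr !ltrDl r0.
have lt1 (x : R) : x - r < x + r by have /andP[] := in1 x; exact: lt_trans.
have I0 := energy_variation_eq0 w (lt1 z.1) (lt1 z.2) QA.
pose phi := bump (z.1 - r) (z.1 + r) (z.2 - r) (z.2 + r).
have sphi : smooth_on A phi by apply: (sm_bump _ _ _ _ oA) => k; exact: Ck_id.
have pos' : 0 < \int[leb2 R]_(u in rect (z.1 - r) (z.1 + r) (z.2 - r) (z.2 + r)) (phi u * m u).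
  apply: (Rintegral_gt0 (in1 z.1) (in1 z.2)).
  - by move=> u /QA Au; exact: (sm_continuous (sm_mul oA sphi sm) Au).
  - by move=> u /QB[_ mu]; rewrite mulr_ge0 ?bump_ge0// ltW.
  - by rewrite mulr_gt0//; exact: bump_gt0.
suff e : \int[leb2 R]_(u in rect (z.1 - r) (z.1 + r) (z.2 - r) (z.2 + r)) (phi u * m u) = 0.
  by rewrite e ltxx in pos'.
rewrite -[RHS]I0; apply: eq_Rintegral => u _.
rewrite dotZl /m; exact: mulrCA.
Qed.

(** Otherwise the pairing would have a sign on a small rectangle, and so would
    the first variation for a bump function supported there. *)
Lemma euler_lagrange z w : A z -> dot w (f z) = 0 -> dot w (E z) = 0.
Proof.
move=> Az wf; have sp v : dot v (f z) = 0 -> sphere_part v (f z) = v.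
  by move=> v0; rewrite /sphere_part v0 scale0r subr0.
have [n|p|//] := ltgtP (dot w (E z)) 0.
  case: (@not_positive z (- w) Az).
  by rewrite sp ?dotNl ?wf ?oppr0// oppr_gt0.
by case: (@not_positive z w Az); rewrite sp.
Qed.

End EulerLagrange.

#[local] Transparent derive along.

(** * The frame adapted to the mean curvature *)

Section Cometric.
Context {R : realType}.

(** The norm, for the metric g on the tangent space, of the covector (n1, n2).
    *)
Definition conorm (g11 g12 g22 n1 n2 : R) : R :=
  (g22 * n1 ^+ 2 - 2 * g12 * n1 * n2 + g11 * n2 ^+ 2) / (g11 * g22 - g12 ^+ 2).

Lemma conorm_definite (g11 g12 g22 n1 n2 : R) : 0 <= g11 -> 0 < g11 * g22 - g12 ^+ 2 ->
  0 <= conorm g11 g12 g22 n1 n2 /\ (conorm g11 g12 g22 n1 n2 = 0 -> n1 = 0 /\ n2 = 0).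
Proof.
move=> g0 G0; have {}g0 : 0 < g11.
  rewrite lt_neqAle g0 andbT; apply/eqP => z; move: G0.
  by rewrite -z mul0r sub0r oppr_gt0 ltNge sqr_ge0.
have E : g11 * (g11 * g22 - g12 ^+ 2) * conorm g11 g12 g22 n1 n2 =
    (g11 * n2 - g12 * n1) ^+ 2 + (g11 * g22 - g12 ^+ 2) * n1 ^+ 2.
  by rewrite /conorm; field; exact: lt0r_neq0.
have k0 : 0 < g11 * (g11 * g22 - g12 ^+ 2) by rewrite mulr_gt0.
have q1 : 0 <= (g11 * n2 - g12 * n1) ^+ 2 by exact: sqr_ge0.
have q2 : 0 <= (g11 * g22 - g12 ^+ 2) * n1 ^+ 2 by rewrite mulr_ge0 ?sqr_ge0// ltW.
split; first by rewrite -(pmulr_rge0 _ k0) E addr_ge0.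
move=> c0; move: E; rewrite c0 mulr0 => /esym/eqP; rewrite paddr_eq0//.
rewrite sqrf_eq0 mulf_eq0 (gt_eqF G0) sqrf_eq0 /= => /andP[e /eqP n10].
by move: e; rewrite n10 mulr0 subr0 mulf_eq0 (gt_eqF g0) => /eqP.
Qed.

(** The first field is the covector (n1, n2) raised by the metric and divided
    by its norm h, the second is the first turned by a right angle; th is the
    area density. *)
Lemma adapted_coordinates (g11 g12 g22 n1 n2 h th : R) :
  let G := g11 * g22 - g12 ^+ 2 in
  h != 0 -> th != 0 -> G = th ^+ 2 -> conorm g11 g12 g22 n1 n2 = h ^+ 2 ->
  let p11 := (h * G)^-1 * (g22 * n1 - g12 * n2) in
  let p12 := (h * G)^-1 * (g11 * n2 - g12 * n1) in
  let p21 := (h * th)^-1 * - n2 in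
  let p22 := (h * th)^-1 * n1 in
  [/\ p11 ^+ 2 * g11 + 2 * p11 * p12 * g12 + p12 ^+ 2 * g22 = 1,
      p11 * p21 * g11 + (p11 * p22 + p12 * p21) * g12 + p12 * p22 * g22 = 0 &
      p21 ^+ 2 * g11 + 2 * p21 * p22 * g12 + p22 ^+ 2 * g22 = 1] /\
  [/\ p11 ^+ 2 + p21 ^+ 2 = G^-1 * g22, p11 * p12 + p21 * p22 = - (G^-1 * g12) &
      p12 ^+ 2 + p22 ^+ 2 = G^-1 * g11] /\
  [/\ p11 * n1 + p12 * n2 = h, p21 * n1 + p22 * n2 = 0 & p11 * p22 - p12 * p21 = th^-1].
Proof.
move=> G h0 t0 GE cE p11 p12 p21 p22.
have G0 : G != 0 by rewrite GE expf_neq0.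
have QE : g22 * n1 ^+ 2 - 2 * g12 * n1 * n2 + g11 * n2 ^+ 2 = h ^+ 2 * G.
  by rewrite -cE /conorm -/G mulfVK.
have D0 : g11 * g22 - g12 ^+ 2 != 0 by [].
pose Q := g22 * n1 ^+ 2 - 2 * g12 * n1 * n2 + g11 * n2 ^+ 2.
have one (x : R) : x = Q / (h ^+ 2 * G) -> x = 1.
  by move=> ->; rewrite /Q QE divff// mulf_neq0// expf_neq0.
have q21 : p21 ^+ 2 = n2 ^+ 2 / (h ^+ 2 * G) by rewrite /p21 GE; field; rewrite h0 t0.
have q22 : p22 ^+ 2 = n1 ^+ 2 / (h ^+ 2 * G) by rewrite /p22 GE; field; rewrite h0 t0.
have qm : p21 * p22 = - (n1 * n2) / (h ^+ 2 * G) by rewrite /p21 /p22 GE; field; rewrite h0 t0.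
have gQ (x y : R) : x = y * (Q / (h ^+ 2 * G)) -> x = y by rewrite /Q QE divff ?mulr1// mulf_neq0// expf_neq0.
split; [split|split; split].
- by apply: one; rewrite /p11 /p12 /Q /G; field; rewrite h0 D0.
- by rewrite /p11 /p12 /p21 /p22 /G; field; rewrite h0 D0 t0.
- by apply: one; rewrite q21 q22 -(mulrA 2) qm /Q /G; field; rewrite h0 D0.
- by apply: gQ; rewrite q21 /p11 /Q /G; field; rewrite h0 D0.
- by apply: gQ; rewrite qm /p11 /p12 /Q /G; field; rewrite h0 D0.
- by apply: gQ; rewrite q22 /p12 /Q /G; field; rewrite h0 D0.
- by apply: gQ; rewrite /p11 /p12 /Q /G; field; rewrite h0 D0.
- by rewrite /p21 /p22; field; rewrite h0 t0.
- by apply: gQ; rewrite /p11 /p12 /p21 /p22 /Q /G; field; rewrite h0 D0 t0.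
Qed.

End Cometric.

Section LegendrianJet.
Context {R : realType}.
Notation V6 := 'rV[R]_(3 + 3).

(** What the first derivatives of a Legendrian immersion satisfy at one point.
    *)
Definition legendrian_jet (f f1 f2 : V6) : Prop :=
  [/\ dot f f = 1, dot f f1 = 0 & dot f f2 = 0] /\
  [/\ dot f1 (muli f) = 0, dot f2 (muli f) = 0 & dot f1 (muli f2) = 0] /\
  0 < gram f1 f2.

Lemma adapted_legendrian_frame (f f1 f2 : V6) (n1 n2 h th : R) :
  let g11 := dot f1 f1 in let g12 := dot f1 f2 in let g22 := dot f2 f2 in
  legendrian_jet f f1 f2 -> h != 0 -> th != 0 -> gram f1 f2 = th ^+ 2 ->
  conorm g11 g12 g22 n1 n2 = h ^+ 2 ->
  legendrian_frame f
    (((h * gram f1 f2)^-1 * (g22 * n1 - g12 * n2)) *: f1 +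
     ((h * gram f1 f2)^-1 * (g11 * n2 - g12 * n1)) *: f2)
    (((h * th)^-1 * - n2) *: f1 + ((h * th)^-1 * n1) *: f2).
Proof.
move=> g11 g12 g22 [[ff F1 F2] [[I1 I2 I12] _]] h0 t0 GE cE.
have [[k1 k2 k3] [_ _]] := adapted_coordinates (g11 := g11) (g12 := g12) (g22 := g22) h0 t0 GE cE.
rewrite /gram -/g11 -/g12 -/g22.
move: k1 k2 k3.
set p11 := (h * _)^-1 * (g22 * n1 - _); set p12 := (h * _)^-1 * (g11 * n2 - _).
set p21 := _ * - n2; set p22 := _ * n1 => k1 k2 k3.
have F1' : dot f (muli f1) = 0 by rewrite -[LHS]opprK -dot_muli dotC I1 oppr0.
have F2' : dot f (muli f2) = 0 by rewrite -[LHS]opprK -dot_muli dotC I2 oppr0.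
have I21 : dot f2 (muli f1) = 0 by rewrite -[LHS]opprK -dot_muli dotC I12 oppr0.
have g21 : dot f2 f1 = g12 by rewrite dotC.
split; [split|split; split]; rewrite ?muliD ?muliZ ?(dotDl, dotZl) ?(dotDr, dotZr)
  -?/g11 -?/g12 -?/g22 ?g21 ?F1 ?F2 ?F1' ?F2' ?I12 ?I21 ?dot_muliv ?mulr0 ?addr0//.
- by rewrite -[RHS]k1; ring.
- by rewrite -[RHS]k3; ring.
- by rewrite -[RHS]k2; ring.
- by rewrite !mulr0 addr0.
Qed.

(** In a Legendrian frame, H has components only along i e1 and i e2. *)
Lemma mean_formula_eq0 (f f1 f2 f11 f12 f21 f22 : V6) : legendrian_jet f f1 f2 ->
  let N := raw_trace f1 f2 f11 f12 f21 f22 in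
  dot N (muli f) = 0 -> dot N (muli f1) = 0 -> dot N (muli f2) = 0 ->
  mean_formula f f1 f2 f11 f12 f21 f22 = 0.
Proof.
move=> L N N0 N1 N2; rewrite /mean_formula -/N; move: (N) N0 N1 N2 => {}N N0 N1 N2.
have [[ff F1 F2] [[I1 I2 I12] G0]] := L.
have Gn := lt0r_neq0 G0.
have g22 : 0 < dot f2 f2.
  rewrite lt_neqAle dot_ge0 andbT; apply/eqP => z.
  have [f20 _] : f2 = 0 /\ True by split => //; apply: dot_eq0.
  by move: G0; rewrite /gram f20 !dot0r mulr0 expr0n/= subr0 ltxx.
have cE : conorm (dot f1 f1) (dot f1 f2) (dot f2 f2) 1 0 = Num.sqrt (dot f2 f2 / gram f1 f2) ^+ 2.
  rewrite sqr_sqrtr; last by rewrite divr_ge0// ltW.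
  by rewrite /conorm /gram; congr (_ / _); ring.
have GE : gram f1 f2 = Num.sqrt (gram f1 f2) ^+ 2 by rewrite sqr_sqrtr// ltW.
have h0 : Num.sqrt (dot f2 f2 / gram f1 f2) != 0 by rewrite gt_eqF// sqrtr_gt0 divr_gt0.
have t0 : Num.sqrt (gram f1 f2) != 0 by rewrite gt_eqF// sqrtr_gt0.
have := adapted_legendrian_frame L h0 t0 GE cE.
set x1 := _ * _; set x2 := _ * (_ * 0 - _); set y1 := _ * - 0; set y2 := _ * 1 => fr.
set v := normal_part f f1 f2 N.
have F1' : dot f (muli f1) = 0 by rewrite -[LHS]opprK -dot_muli dotC I1 oppr0.
have F2' : dot f (muli f2) = 0 by rewrite -[LHS]opprK -dot_muli dotC I2 oppr0.
have I21 : dot f2 (muli f1) = 0 by rewrite -[LHS]opprK -dot_muli dotC I12 oppr0.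
have v0 : dot v f = 0.
  by rewrite /v /normal_part !dotBl !dotZl ff (dotC f1 f) (dotC f2 f) F1 F2; ring.
have g21 := dotC f2 f1.
have v1 : dot v f1 = 0.
  rewrite /v /normal_part !dotBl !dotZl F1 g21.
  move: Gn; rewrite /gram; move: (dot N f1) (dot N f2) (dot N f) (dot f1 f1) (dot f1 f2) (dot f2 f2).
  by move=> *; field.
have v2 : dot v f2 = 0.
  rewrite /v /normal_part !dotBl !dotZl F2.
  move: Gn; rewrite /gram; move: (dot N f1) (dot N f2) (dot N f) (dot f1 f1) (dot f1 f2) (dot f2 f2).
  by move=> *; field.
have vi0 : dot v (muli f) = 0.
  by rewrite /v /normal_part !dotBl !dotZl N0 dot_muliv I1 I2; ring.
have vi1 : dot v (muli f1) = 0.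
  by rewrite /v /normal_part !dotBl !dotZl N1 F1' dot_muliv I21; ring.
have vi2 : dot v (muli f2) = 0.
  by rewrite /v /normal_part !dotBl !dotZl N2 F2' dot_muliv I12; ring.
have z (k1 k2 : R) : dot v (k1 *: f1 + k2 *: f2) = 0 /\ dot v (muli (k1 *: f1 + k2 *: f2)) = 0.
  by rewrite muliD !muliZ !dotDr !dotZr v1 v2 vi1 vi2 !mulr0 addr0.
by apply: (frame_ext fr); rewrite dot0l ?v0 ?vi0 ?(z _ _).1 ?(z _ _).2.
Qed.

End LegendrianJet.

#[local] Opaque derive along.

Section AdaptedFrame.
Context {R : realType}.
Notation V6 := 'rV[R]_(3 + 3).
Let ex : R * R := (1, 0).
Let ey : R * R := (0, 1).

Definition chart_trace (f : R * R -> V6) u := raw_trace ('D_((1, 0) : R * R) f u)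
  ('D_((0, 1) : R * R) f u) ('D_((1, 0) : R * R) ('D_((1, 0) : R * R) f) u)
  ('D_((1, 0) : R * R) ('D_((0, 1) : R * R) f) u)
  ('D_((0, 1) : R * R) ('D_((1, 0) : R * R) f) u)
  ('D_((0, 1) : R * R) ('D_((0, 1) : R * R) f) u).

(** The 1-form with value <H, i df(v)> at v. *)
Definition maslov (v : R * R) (f : R * R -> V6) u := dot (chart_trace f u) (muli ('D_v f u)).

Definition chart_conorm (f : R * R -> V6) u n1 n2 :=
  conorm (dot ('D_((1, 0) : R * R) f u) ('D_((1, 0) : R * R) f u))
   (dot ('D_((1, 0) : R * R) f u) ('D_((0, 1) : R * R) f u))
   (dot ('D_((0, 1) : R * R) f u) ('D_((0, 1) : R * R) f u)) n1 n2.

(** This is |H|^2, as H lies in the span of i times the tangent plane. *)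
Definition mean_sq (f : R * R -> V6) u := chart_conorm f u (maslov (1, 0) f u) (maslov (0, 1) f u).

Variables (U : set (R * R)) (f : R * R -> V6).
Hypotheses (oU : open U) (sf : smooth_on U f).
Hypothesis ff : forall u, U u -> dot (f u) (f u) = 1.
Hypothesis imm : forall u v, U u -> 'D_v f u = 0 -> v = 0.
Hypothesis leg0 : forall u v, U u -> dot ('D_v f u) (muli (f u)) = 0.
Hypothesis leg : forall u v w, U u -> dot ('D_v f u) (muli ('D_w f u)) = 0.

Let fx := 'D_ex f.
Let fy := 'D_ey f.
Let sfx : smooth_on U fx := sm_derive ex sf.
Let sfy : smooth_on U fy := sm_derive ey sf.

(** If the Gram determinant vanished, the vector (<fy, fy>, - <fx, fy>) would
    be in the kernel of the differential. *)
Lemma gram_gt0 u : U u -> 0 < gram (fx u) (fy u).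
Proof.
move=> Uu; rewrite ltNge; apply/negP => G0.
have E : 'D_((dot (fy u) (fy u), - dot (fx u) (fy u)) : R * R) f u =
    dot (fy u) (fy u) *: fx u - dot (fx u) (fy u) *: fy u.
  apply: etrans (derive_planeV _ oU Uu (sf 1)) _; exact: (congr1 (fun x => _ + x) (scaleNr _ _)).
have key (p q : V6) : gram p q <= 0 -> dot q q *: p - dot p q *: q = 0.
  move=> G; apply: dot_eq0; apply/eqP; rewrite eq_le dot_ge0 andbT.
  rewrite (_ : dot _ _ = dot q q * gram p q); first by rewrite mulr_ge0_le0// dot_ge0.
  by rewrite /gram !(dotDl, dotNl, dotZl) !(dotDr, dotNr, dotZr) (dotC q p); ring.
have z := imm Uu (etrans E (key _ _ G0)).
have q0 : fy u = 0 by apply: dot_eq0; exact: (congr1 fst z).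
have /(congr1 snd)/= /eqP := imm Uu (q0 : 'D_ey f u = 0).
by rewrite oner_eq0.
Qed.

Let dconst (g k : R * R -> V6) (r : R) v u : smooth_on U g -> smooth_on U k ->
  (forall x, U x -> dot (g x) (k x) = r) -> U u ->
  dot ('D_v g u) (k u) + dot (g u) ('D_v k u) = 0.
Proof.
move=> sg sk gk Uu; apply: etrans (esym (along_dot (fun=> v) sg sk Uu)) _.
exact: (etrans (along_eq oU (fun=> v) gk Uu) (along_cst (fun=> v) r u)).
Qed.

Let orth u v : U u -> dot (f u) ('D_v f u) = 0.
Proof.
move=> Uu; have key (p q : V6) : dot q p + dot p q = 0 -> dot p q = 0.
  by move=> /eqP; rewrite (dotC q p) -mulr2n mulrn_eq0 => /eqP.
exact: (key _ _ (dconst v sf sf ff Uu)).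
Qed.

Let leg2 u v w : U u -> dot ('D_v ('D_w f) u) (muli (f u)) = 0.
Proof.
move=> Uu; have E := dconst v (sm_derive w sf) (sm_muli oU sf) (fun x Ux => leg0 w Ux) Uu.
have L := leg w v Uu.
have T : dot ('D_w f u) ('D_v (fun x => muli (f x)) u) = 0.
  exact: (etrans (congr1 (dot ('D_w f u)) (along_muli (fun=> v) sf Uu)) L).
exact: (etrans (esym (addr0 _)) (etrans (congr1 (fun x => _ + x) (esym T)) E)).
Qed.

Lemma chart_jet u : U u -> legendrian_jet (f u) (fx u) (fy u).
Proof.
move=> Uu; split; first by split; [exact: ff|exact: orth|exact: orth].
split; last exact: gram_gt0.
by split; [exact: leg0|exact: leg0|exact: leg].
Qed.

(** H has no component along i f: the derivative of <f_j, i f> = 0 gives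
    <f_ij, i f> = - <f_j, i f_i> = 0. *)
Lemma chart_trace_muli u : U u -> dot (chart_trace f u) (muli (f u)) = 0.
Proof.
move=> Uu; have key (k g11 g12 g22 : R) (x y z t m : V6) : dot x m = 0 -> dot y m = 0 ->
    dot z m = 0 -> dot t m = 0 -> dot (k *: (g22 *: x - g12 *: (y + z) + g11 *: t)) m = 0.
  move=> h1 h2 h3 h4.
  by rewrite dotZl !(dotDl, dotNl, dotZl) h1 h2 h3 h4 !(addr0, mulr0, oppr0).
exact: (key _ _ _ _ _ _ _ _ _ (leg2 ex ex Uu) (leg2 ex ey Uu) (leg2 ey ex Uu) (leg2 ey ey Uu)).
Qed.

Lemma sm_chart_trace : smooth_on U (chart_trace f).
Proof.
have s12 := sm_dot oU sfx sfy; have s22 := sm_dot oU sfy sfy; have s11 := sm_dot oU sfx sfx.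
have si : smooth_on U (fun x => (gram (fx x) (fy x))^-1).
  by apply: (sm_inv oU _ (sm_gram oU sfx sfy)) => x Ux; exact: lt0r_neq0 (gram_gt0 Ux).
apply: (sm_scale oU si); apply: (sm_add oU); last exact: (sm_scale oU s11 (sm_derive ey sfy)).
apply: (sm_add oU (sm_scale oU s22 (sm_derive ex sfx))); apply: (sm_opp oU).
exact: (sm_scale oU s12 (sm_add oU (sm_derive ex sfy) (sm_derive ey sfx))).
Qed.

Lemma sm_maslov v : smooth_on U (maslov v f).
Proof. exact: (sm_dot oU sm_chart_trace (sm_muli oU (sm_derive v sf))). Qed.

Lemma sm_chart_conorm n1 n2 : smooth_on U n1 -> smooth_on U n2 ->
  smooth_on U (fun u => chart_conorm f u (n1 u) (n2 u)).
Proof.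
move=> s1 s2.
have s12 := sm_dot oU sfx sfy; have s22 := sm_dot oU sfy sfy; have s11 := sm_dot oU sfx sfx.
have si : smooth_on U (fun x => (gram (fx x) (fy x))^-1).
  by apply: (sm_inv oU _ (sm_gram oU sfx sfy)) => x Ux; exact: lt0r_neq0 (gram_gt0 Ux).
have sN := sm_add oU (sm_add oU (sm_mul oU s22 (sm_mul oU s1 s1))
  (sm_opp oU (sm_mul oU (sm_mul oU (sm_mul oU (sm_cst U (2 : R)) s12) s1) s2))) (sm_mul oU s11 (sm_mul oU s2 s2)).
have key (g11 g12 g22 m1 m2 : R) : (g22 * (m1 * m1) - 2 * g12 * m1 * m2 + g11 * (m2 * m2)) *
    (g11 * g22 - g12 ^+ 2)^-1 = conorm g11 g12 g22 m1 m2 by rewrite /conorm !expr2.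
by apply: (sm_eq oU _ (sm_mul oU sN si)) => u Uu; exact: key.
Qed.

Lemma sm_mean_sq : smooth_on U (mean_sq f).
Proof. exact: (sm_chart_conorm (sm_maslov _) (sm_maslov _)). Qed.

Lemma chart_conorm_ge0 u n1 n2 : U u -> 0 <= chart_conorm f u n1 n2 /\
  (chart_conorm f u n1 n2 = 0 -> n1 = 0 /\ n2 = 0).
Proof. by move=> Uu; exact: (conorm_definite n1 n2 (dot_ge0 (fx u)) (gram_gt0 Uu)). Qed.

Lemma mean_curvature_eq0 u : U u -> mean_sq f u = 0 -> mean_curvature f u = 0.
Proof.
move=> Uu /(chart_conorm_ge0 _ _ Uu).2[n1 n2].
have E (T : Type) (x : T) := erefl x.
have [mE _] := mean_curvatureE (f := f) (u := u) (E _ _) (E _ _) (E _ _) (E _ _) (E _ _) (E _ _)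
  (lt0r_neq0 (gram_gt0 Uu)).
apply: etrans mE _; exact: (mean_formula_eq0 (chart_jet Uu) (chart_trace_muli Uu) n1 n2).
Qed.

Let n1 := maslov ex f.
Let n2 := maslov ey f.
Let G u := gram (fx u) (fy u).
Let th u := Num.sqrt (G u).

(** The part of the chart domain where H does not vanish. *)
Definition bent : set (R * R) := [set u | U u /\ 0 < mean_sq f u].
Definition mean_norm u := Num.sqrt (mean_sq f u).
Let h := mean_norm.

Definition adapted1 u : R * R :=
  ((h u * G u)^-1 * (dot (fy u) (fy u) * n1 u - dot (fx u) (fy u) * n2 u),
   (h u * G u)^-1 * (dot (fx u) (fx u) * n2 u - dot (fx u) (fy u) * n1 u)).
Definition adapted2 u : R * R := ((h u * th u)^-1 * - n2 u, (h u * th u)^-1 * n1 u).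
Let p1 := adapted1.
Let p2 := adapted2.

Lemma open_bent : open bent.
Proof.
rewrite openE => u [Uu mu]; rewrite /interior.
have k1 : \forall y \near u, U y := open_nbhs_nbhs (conj oU Uu).
have k2 : \forall y \near u, 0 < mean_sq f y by exact: (cvgr_gt _ (sm_continuous sm_mean_sq Uu) _ mu).
exact: filterI k1 k2.
Qed.

Let oA := open_bent.

Let sub (W : normedModType R) (g : R * R -> W) : smooth_on U g -> smooth_on bent g.
Proof. by move=> sg k; apply: Ck_subset (sg k) => u []. Qed.

Let h_gt0 u : bent u -> 0 < h u.
Proof. by move=> [_ m0]; rewrite sqrtr_gt0. Qed.

Let G_gt0 u : bent u -> 0 < G u.
Proof. by move=> [Uu _]; exact: gram_gt0. Qed.

Let th_gt0 u : bent u -> 0 < th u.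
Proof. by move=> /G_gt0 g0; rewrite sqrtr_gt0. Qed.

Lemma sm_mean_norm : smooth_on bent mean_norm.
Proof. by apply: (sm_sqrt oA _ (sub sm_mean_sq)) => u []. Qed.

Let sG : smooth_on bent G := sub (sm_gram oU sfx sfy).

Let sp1 : smooth_field bent p1.
Proof.
have si : smooth_on bent (fun u => (h u * G u)^-1).
  apply: (sm_inv oA _ (sm_mul oA sm_mean_norm sG)) => u Au.
  by rewrite mulf_neq0// gt_eqF// ?h_gt0 ?G_gt0.
have s11 := sub (sm_dot oU sfx sfx); have s12 := sub (sm_dot oU sfx sfy).
have s22 := sub (sm_dot oU sfy sfy); have m1 := sub (sm_maslov ex); have m2 := sub (sm_maslov ey).
split; apply: (sm_mul oA si).
  exact: (sm_add oA (sm_mul oA s22 m1) (sm_opp oA (sm_mul oA s12 m2))).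
exact: (sm_add oA (sm_mul oA s11 m2) (sm_opp oA (sm_mul oA s12 m1))).
Qed.

Let sp2 : smooth_field bent p2.
Proof.
have si : smooth_on bent (fun u => (h u * th u)^-1).
  apply: (sm_inv oA _ (sm_mul oA sm_mean_norm (sm_sqrt oA G_gt0 sG))) => u Au.
  by rewrite mulf_neq0// gt_eqF// ?h_gt0 ?th_gt0.
have m1 := sub (sm_maslov ex); have m2 := sub (sm_maslov ey).
by split; apply: (sm_mul oA si); [exact: (sm_opp oA m2)|exact: m1].
Qed.

Let GE u : bent u -> G u = th u ^+ 2.
Proof. by move=> Au; rewrite sqr_sqrtr// ltW// G_gt0. Qed.

Let hE u : bent u -> chart_conorm f u (n1 u) (n2 u) = h u ^+ 2.
Proof. by move=> [_ /ltW m0]; rewrite sqr_sqrtr. Qed.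

Let coords u (Au : bent u) :=
  adapted_coordinates (lt0r_neq0 (h_gt0 Au)) (lt0r_neq0 (th_gt0 Au)) (GE Au) (hE Au).

Let alongf p u : bent u -> along p f u = (p u).1 *: fx u + (p u).2 *: fy u.
Proof. by move=> Au; exact: (alongVE oA p (sub sf) Au). Qed.

Lemma adapted_frame u : bent u -> legendrian_frame (f u) (along p1 f u) (along p2 f u).
Proof.
move=> Au; have L := adapted_legendrian_frame (chart_jet Au.1) (lt0r_neq0 (h_gt0 Au))
  (lt0r_neq0 (th_gt0 Au)) (GE Au) (hE Au).
exact: (eq_ind_r (fun k => legendrian_frame _ k _) (eq_ind_r (legendrian_frame _ _) L (alongf p2 Au)) (alongf p1 Au)).
Qed.

Lemma adapted_cometric u : bent u ->
  [/\ (p1 u).1 ^+ 2 + (p2 u).1 ^+ 2 = (G u)^-1 * dot (fy u) (fy u),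
      (p1 u).1 * (p1 u).2 + (p2 u).1 * (p2 u).2 = - ((G u)^-1 * dot (fx u) (fy u)) &
      (p1 u).2 ^+ 2 + (p2 u).2 ^+ 2 = (G u)^-1 * dot (fx u) (fx u)].
Proof. by move=> Au; have [_ [k _]] := coords Au; exact: k. Qed.

Lemma adapted_orientation u : bent u -> 0 < (p1 u).1 * (p2 u).2 - (p1 u).2 * (p2 u).1.
Proof.
move=> Au; have [_ [_ [_ _ k]]] := coords Au.
exact: (eq_ind_r (fun x => 0 < x) (etrans (invr_gt0 _) (th_gt0 Au)) k).
Qed.

(* The frame is orthonormal, so that summing over it is the contraction with the
   inverse metric; the tangent terms vanish against i times a tangent vector. *)
Let trace_muli u k1 k2 : bent u ->
  dot (along p1 (along p1 f) u + along p2 (along p2 f) u) (muli (k1 *: fx u + k2 *: fy u)) =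
  k1 * n1 u + k2 * n2 u.
Proof.
move=> Au; have s := sub sf; have [c1 c2 c3] := adapted_cometric Au.
have E1 := along_alongV p1 oA sp1 s Au; have E2 := along_alongV p2 oA sp2 s Au.
have key (tx ty fxx fxy fyx fyy m x1 x2 : V6) (a1 a2 b1 b2 P11 P12 P21 P22 g11 g12 g22 D : R) :
    dot tx m = 0 -> dot ty m = 0 ->
    P11 ^+ 2 + P21 ^+ 2 = D * g22 -> P11 * P12 + P21 * P22 = - (D * g12) -> P12 ^+ 2 + P22 ^+ 2 = D * g11 ->
    x1 = a1 *: tx + P11 *: (P11 *: fxx + P12 *: fyx) + (a2 *: ty + P12 *: (P11 *: fxy + P12 *: fyy)) ->
    x2 = b1 *: tx + P21 *: (P21 *: fxx + P22 *: fyx) + (b2 *: ty + P22 *: (P21 *: fxy + P22 *: fyy)) ->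
    dot (x1 + x2) m = dot (D *: (g22 *: fxx - g12 *: (fxy + fyx) + g11 *: fyy)) m.
  move=> h1 h2 d1 d2 d3 -> ->.
  rewrite !(dotDl, dotZl, dotNl) h1 h2.
  move: (dot fxx m) (dot fxy m) (dot fyx m) (dot fyy m) => b11 b12 b21 b22.
  rewrite (_ : _ + _ = (P11 ^+ 2 + P21 ^+ 2) * b11 + (P11 * P12 + P21 * P22) * (b12 + b21) +
    (P12 ^+ 2 + P22 ^+ 2) * b22); last by ring.
  by rewrite d1 d2 d3; ring.
have lin (m g1 g2 : V6) : dot m (muli (k1 *: g1 + k2 *: g2)) = k1 * dot m (muli g1) + k2 * dot m (muli g2).
  by rewrite muliD !muliZ dotDr !dotZr.
have z v : dot ('D_v f u) (muli (k1 *: fx u + k2 *: fy u)) = 0.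
  apply: etrans (lin _ _ _) _.
  exact: (etrans (congr2 (fun x y => k1 * x + k2 * y) (leg v ex Au.1) (leg v ey Au.1))
    (etrans (congr2 +%R (mulr0 k1) (mulr0 k2)) (addr0 0))).
have X := key _ _ _ _ _ _ _ _ _ _ _ _ _ _ _ _ _ _ _ _ _ (z ex) (z ey) c1 c2 c3 E1 E2.
apply: etrans X _; exact: (lin (chart_trace f u) (fx u) (fy u)).
Qed.

(** a + c and b + d are the components of H along i e1 and i e2. *)
Lemma adapted_moving_frame : exists w1 w2 a b c d : R * R -> R,
  [/\ moving_frame bent f (along p1 f) (along p2 f) p1 p2 w1 w2 a b c d,
    forall u, bent u -> a u + c u = mean_norm u & forall u, bent u -> b u + d u = 0].
Proof.
have M := moving_frame_of_fields oA (sub sf) sp1 sp2 (fun u v Au => imm Au.1)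
  (fun u v w Au => leg v w Au.1) adapted_frame.
do 6 eexists; split; first exact: M.
  move=> u Au; have [_ [_ [k _ _]]] := coords Au.
  have T := trace_muli (p1 u).1 (p1 u).2 Au.
  have [_ _ _ S] := mf_structure M Au; have Fr := adapted_frame Au.
  have key (e1 e2 x1 x2 f0 m : V6) (r r' w c d : R) : legendrian_frame f0 e1 e2 ->
      x2 = - f0 - w *: e1 + c *: muli e1 + d *: muli e2 -> e1 = m ->
      dot (x1 + x2) (muli m) = r -> r = r' -> dot x1 (muli e1) + c = r'.
    move=> [[_ q1 q2] [[f1 f2 f12] [i1 i2 i12]]] E <- <- <-.
    rewrite dotDl E !(dotDl, dotNl, dotZl) i1 dot_muliv !dot_muli2 q1 (dotC e2) f12; ring.
  exact: (key _ _ _ _ _ _ _ _ _ _ _ Fr S (alongf p1 Au) T k).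
move=> u Au; have [_ [_ [_ k _]]] := coords Au.
have T := trace_muli (p2 u).1 (p2 u).2 Au.
have key (e2 x1 x2 m : V6) (r r' : R) : e2 = m ->
    dot (x1 + x2) (muli m) = r -> r = r' -> dot x1 (muli e2) + dot x2 (muli e2) = r'.
  by move=> -> <- <-; rewrite dotDl.
exact: (key _ _ _ _ _ _ (alongf p2 Au) T k).
Qed.

End AdaptedFrame.

#[local] Transparent derive along.

(** * Independence of the chart *)

Section Invariance.
Context {R : realType}.
Notation V6 := 'rV[R]_(3 + 3).

Lemma conorm_invariant (g11 g12 g22 n1 n2 t11 t12 t21 t22 : R) :
  let h11 := t11 ^+ 2 * g11 + 2 * t11 * t12 * g12 + t12 ^+ 2 * g22 in
  let h12 := t11 * t21 * g11 + (t11 * t22 + t12 * t21) * g12 + t12 * t22 * g22 in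
  let h22 := t21 ^+ 2 * g11 + 2 * t21 * t22 * g12 + t22 ^+ 2 * g22 in
  g11 * g22 - g12 ^+ 2 != 0 -> h11 * h22 - h12 ^+ 2 != 0 ->
  conorm h11 h12 h22 (t11 * n1 + t12 * n2) (t21 * n1 + t22 * n2) = conorm g11 g12 g22 n1 n2.
Proof.
move=> h11 h12 h22 G0 H0; rewrite /conorm.
have HE : h11 * h22 - h12 ^+ 2 = (t11 * t22 - t12 * t21) ^+ 2 * (g11 * g22 - g12 ^+ 2).
  by rewrite /h11 /h12 /h22; ring.
rewrite HE; rewrite HE mulf_eq0 expf_eq0/= negb_or in H0; case/andP: H0 => D0 _.
by rewrite /h11 /h12 /h22; field; rewrite D0 G0.
Qed.

(** Second derivatives of the transition map only contribute tangent vectors,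
    on which m vanishes. *)
Lemma trace_invariant (g1 g2 m x11 x12 x21 x22 c11 c12 c21 c22 d11 d12 d21 d22 : V6)
    (t11 t12 t21 t22 : R) (y11 y12 y21 y22 : V6) :
  let h1 := t11 *: g1 + t12 *: g2 in let h2 := t21 *: g1 + t22 *: g2 in
  gram g1 g2 != 0 -> gram h1 h2 != 0 -> dot g1 m = 0 -> dot g2 m = 0 ->
  dot y11 m = t11 * (t11 * dot x11 m + t12 * dot x21 m) + t12 * (t11 * dot x12 m + t12 * dot x22 m) ->
  dot y12 m = t21 * (t11 * dot x11 m + t12 * dot x21 m) + t22 * (t11 * dot x12 m + t12 * dot x22 m) ->
  dot y21 m = t11 * (t21 * dot x11 m + t22 * dot x21 m) + t12 * (t21 * dot x12 m + t22 * dot x22 m) ->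
  dot y22 m = t21 * (t21 * dot x11 m + t22 * dot x21 m) + t22 * (t21 * dot x12 m + t22 * dot x22 m) ->
  dot (raw_trace h1 h2 y11 y12 y21 y22) m = dot (raw_trace g1 g2 x11 x12 x21 x22) m.
Proof.
move=> h1 h2 G0 H0 z1 z2 E11 E12 E21 E22.
have L (k a b c : R) (x y z t : V6) : dot (k *: (a *: x - b *: (y + z) + c *: t)) m =
    k * (a * dot x m - b * (dot y m + dot z m) + c * dot t m).
  by rewrite dotZl !(dotDl, dotNl, dotZl).
rewrite /raw_trace !L E11 E12 E21 E22.
have h11 : dot h1 h1 = t11 ^+ 2 * dot g1 g1 + 2 * t11 * t12 * dot g1 g2 + t12 ^+ 2 * dot g2 g2.
  by rewrite !(dotDl, dotDr, dotZl, dotZr) (dotC g2 g1); ring.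
have h12 : dot h1 h2 = t11 * t21 * dot g1 g1 + (t11 * t22 + t12 * t21) * dot g1 g2 + t12 * t22 * dot g2 g2.
  by rewrite !(dotDl, dotDr, dotZl, dotZr) (dotC g2 g1); ring.
have h22 : dot h2 h2 = t21 ^+ 2 * dot g1 g1 + 2 * t21 * t22 * dot g1 g2 + t22 ^+ 2 * dot g2 g2.
  by rewrite !(dotDl, dotDr, dotZl, dotZr) (dotC g2 g1); ring.
have HE : gram h1 h2 = (t11 * t22 - t12 * t21) ^+ 2 * gram g1 g2.
  by rewrite /gram h11 h12 h22; ring.
rewrite HE h11 h12 h22; rewrite HE mulf_eq0 expf_eq0/= negb_or in H0; case/andP: H0 => D0 _.
move: G0; rewrite /gram; move: (dot g1 g1) (dot g1 g2) (dot g2 g2) (dot x11 m) (dot x12 m)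
  (dot x21 m) (dot x22 m) => G11 G12 G22 b1 b2 b3 b4 G0.
by field; rewrite D0 G0.
Qed.

#[local] Opaque derive along.

Let ex : R * R := (1, 0).
Let ey : R * R := (0, 1).

Variables (W U : set (R * R)) (tau : R * R -> R * R) (f f' : R * R -> V6).
Hypotheses (oW : open W) (oU : open U) (st : smooth_on W tau) (WU : forall u, W u -> U (tau u)).
Hypotheses (sf : smooth_on U f) (ff' : forall u, W u -> f (tau u) = f' u).
Hypothesis G0 : forall u, U u -> 0 < gram ('D_ex f u) ('D_ey f u).
Hypothesis G0' : forall u, W u -> 0 < gram ('D_ex f' u) ('D_ey f' u).
Hypothesis leg : forall u v w, U u -> dot ('D_v f u) (muli ('D_w f u)) = 0.

Let chain (g : R * R -> V6) v u : smooth_on U g -> W u ->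
  is_derive u v (fun x => g (tau x)) (('D_v tau u).1 *: 'D_ex g (tau u) + ('D_v tau u).2 *: 'D_ey g (tau u)).
Proof.
move=> sg Wu; have [D E] := derive_comp_plane oU (WU Wu) (sg 1) (Ck_derivable v (st 1) Wu).
have E2 := derive_planeV ('D_v tau u) oU (WU Wu) (sg 1).
exact: DeriveDef D (etrans E E2).
Qed.

Let first v u : W u ->
  'D_v f' u = ('D_v tau u).1 *: 'D_ex f (tau u) + ('D_v tau u).2 *: 'D_ey f (tau u).
Proof.
move=> Wu; apply: etrans (along_eq oW (fun=> v) (fun x Wx => esym (ff' Wx)) Wu) _.
exact: (@derive_val _ _ _ _ _ _ _ (chain v sf Wu)).
Qed.

Let second v w u (m : V6) : W u -> dot ('D_ex f (tau u)) m = 0 -> dot ('D_ey f (tau u)) m = 0 ->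
  dot ('D_w ('D_v f') u) m =
  ('D_v tau u).1 * (('D_w tau u).1 * dot ('D_ex ('D_ex f) (tau u)) m +
     ('D_w tau u).2 * dot ('D_ey ('D_ex f) (tau u)) m) +
  ('D_v tau u).2 * (('D_w tau u).1 * dot ('D_ex ('D_ey f) (tau u)) m +
     ('D_w tau u).2 * dot ('D_ey ('D_ey f) (tau u)) m).
Proof.
move=> Wu z1 z2.
have E1 := along_eq oW (fun=> w) (fun x Wx => first v Wx) Wu.
have [T1 T2] := Ck_pair oW (st 2).
have [D1 D2] := derivable_pair (Ck_derivable w (Ck_derive v (st 2)) Wu).
have c1 := chain w (sm_derive ex sf) Wu; have c2 := chain w (sm_derive ey sf) Wu.
have E2 := @derive_val _ _ _ _ _ _ _ (is_derive_addW (is_derive_scale D1 c1) (is_derive_scale D2 c2)).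
have key (x g1 g2 y11 y21 y12 y22 : V6) (a b c d e k : R) : dot g1 m = 0 -> dot g2 m = 0 ->
    x = a *: g1 + b *: (c *: y11 + d *: y21) + (e *: g2 + k *: (c *: y12 + d *: y22)) ->
    dot x m = b * (c * dot y11 m + d * dot y21 m) + k * (c * dot y12 m + d * dot y22 m).
  by move=> h1 h2 ->; rewrite !(dotDl, dotZl) h1 h2 !mulr0 !add0r.
exact: (key _ _ _ _ _ _ _ _ _ _ _ _ _ z1 z2 (etrans E1 E2)).
Qed.

Let metric u : W u ->
  [/\ dot ('D_ex f' u) ('D_ex f' u) = ('D_ex tau u).1 ^+ 2 * dot ('D_ex f (tau u)) ('D_ex f (tau u)) +
    2 * ('D_ex tau u).1 * ('D_ex tau u).2 * dot ('D_ex f (tau u)) ('D_ey f (tau u)) +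
    ('D_ex tau u).2 ^+ 2 * dot ('D_ey f (tau u)) ('D_ey f (tau u)),
  dot ('D_ex f' u) ('D_ey f' u) =
    ('D_ex tau u).1 * ('D_ey tau u).1 * dot ('D_ex f (tau u)) ('D_ex f (tau u)) +
    (('D_ex tau u).1 * ('D_ey tau u).2 + ('D_ex tau u).2 * ('D_ey tau u).1) *
      dot ('D_ex f (tau u)) ('D_ey f (tau u)) +
    ('D_ex tau u).2 * ('D_ey tau u).2 * dot ('D_ey f (tau u)) ('D_ey f (tau u)) &
  dot ('D_ey f' u) ('D_ey f' u) = ('D_ey tau u).1 ^+ 2 * dot ('D_ex f (tau u)) ('D_ex f (tau u)) +
    2 * ('D_ey tau u).1 * ('D_ey tau u).2 * dot ('D_ex f (tau u)) ('D_ey f (tau u)) +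
    ('D_ey tau u).2 ^+ 2 * dot ('D_ey f (tau u)) ('D_ey f (tau u))].
Proof.
move=> Wu.
have key (x y g1 g2 : V6) (a b c d : R) : x = a *: g1 + b *: g2 -> y = c *: g1 + d *: g2 ->
    [/\ dot x x = a ^+ 2 * dot g1 g1 + 2 * a * b * dot g1 g2 + b ^+ 2 * dot g2 g2,
    dot x y = a * c * dot g1 g1 + (a * d + b * c) * dot g1 g2 + b * d * dot g2 g2 &
    dot y y = c ^+ 2 * dot g1 g1 + 2 * c * d * dot g1 g2 + d ^+ 2 * dot g2 g2].
  move=> -> ->; split; rewrite !(dotDl, dotZl) !(dotDr, dotZr) (dotC g2 g1); ring.
exact: (key _ _ _ _ _ _ _ _ (first ex Wu) (first ey Wu)).
Qed.

Lemma chart_conorm_invariant u m1 m2 n1 n2 : W u ->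
  m1 = ('D_ex tau u).1 * n1 + ('D_ex tau u).2 * n2 ->
  m2 = ('D_ey tau u).1 * n1 + ('D_ey tau u).2 * n2 ->
  chart_conorm f' u m1 m2 = chart_conorm f (tau u) n1 n2.
Proof.
move=> Wu E1 E2; have [M11 M12 M22] := metric Wu.
have key (h11 h12 h22 g11 g12 g22 a b c d : R) : g11 * g22 - g12 ^+ 2 != 0 ->
    h11 * h22 - h12 ^+ 2 != 0 -> h11 = a ^+ 2 * g11 + 2 * a * b * g12 + b ^+ 2 * g22 ->
    h12 = a * c * g11 + (a * d + b * c) * g12 + b * d * g22 ->
    h22 = c ^+ 2 * g11 + 2 * c * d * g12 + d ^+ 2 * g22 ->
    m1 = a * n1 + b * n2 -> m2 = c * n1 + d * n2 ->
    conorm h11 h12 h22 m1 m2 = conorm g11 g12 g22 n1 n2.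
  by move=> k1 k2 e11 e12 e22 -> ->; rewrite e11 e12 e22 in k2 *; exact: conorm_invariant.
exact: (key _ _ _ _ _ _ _ _ _ _ (lt0r_neq0 (G0 (WU Wu))) (lt0r_neq0 (G0' Wu)) M11 M12 M22 E1 E2).
Qed.

Lemma maslov_invariant u v : W u ->
  maslov v f' u = ('D_v tau u).1 * maslov ex f (tau u) + ('D_v tau u).2 * maslov ey f (tau u).
Proof.
move=> Wu; have Uu := WU Wu.
set m := muli (('D_v tau u).1 *: 'D_ex f (tau u) + ('D_v tau u).2 *: 'D_ey f (tau u)).
have lin (x g1 g2 : V6) (a b : R) : dot x (muli (a *: g1 + b *: g2)) = a * dot x (muli g1) + b * dot x (muli g2).
  by rewrite muliD !muliZ dotDr !dotZr.
have mE (x : V6) : dot x m = ('D_v tau u).1 * dot x (muli ('D_ex f (tau u))) +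
    ('D_v tau u).2 * dot x (muli ('D_ey f (tau u))) := lin x _ _ _ _.
have z w : dot ('D_w f (tau u)) m = 0.
  apply: etrans (mE _) _.
  exact: (etrans (congr2 (fun x y => ('D_v tau u).1 * x + ('D_v tau u).2 * y) (leg w ex Uu) (leg w ey Uu))
    (etrans (congr2 +%R (mulr0 _) (mulr0 _)) (addr0 0))).
have zx := z ex; have zy := z ey.
have key (h1 h2 g1 g2 x11 x12 x21 x22 y11 y12 y21 y22 : V6) (t11 t12 t21 t22 : R) :
  h1 = t11 *: g1 + t12 *: g2 -> h2 = t21 *: g1 + t22 *: g2 ->
  gram g1 g2 != 0 -> gram h1 h2 != 0 -> dot g1 m = 0 -> dot g2 m = 0 ->
  dot y11 m = t11 * (t11 * dot x11 m + t12 * dot x21 m) + t12 * (t11 * dot x12 m + t12 * dot x22 m) ->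
  dot y12 m = t21 * (t11 * dot x11 m + t12 * dot x21 m) + t22 * (t11 * dot x12 m + t12 * dot x22 m) ->
  dot y21 m = t11 * (t21 * dot x11 m + t22 * dot x21 m) + t12 * (t21 * dot x12 m + t22 * dot x22 m) ->
  dot y22 m = t21 * (t21 * dot x11 m + t22 * dot x21 m) + t22 * (t21 * dot x12 m + t22 * dot x22 m) ->
  dot (raw_trace h1 h2 y11 y12 y21 y22) m = dot (raw_trace g1 g2 x11 x12 x21 x22) m.
  by move=> -> ->; exact: trace_invariant.
have T := key _ _ _ _ _ _ _ _ _ _ _ _ _ _ _ _ (first ex Wu) (first ey Wu)
  (lt0r_neq0 (G0 Uu)) (lt0r_neq0 (G0' Wu)) zx zy (second ex ex Wu zx zy) (second ey ex Wu zx zy)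
  (second ex ey Wu zx zy) (second ey ey Wu zx zy).
apply: etrans (congr1 (fun x => dot (chart_trace f' u) (muli x)) (first v Wu)) _.
exact: (etrans T (mE _)).
Qed.

Lemma mean_sq_invariant u : W u -> mean_sq f' u = mean_sq f (tau u).
Proof. by move=> Wu; exact: (chart_conorm_invariant Wu (maslov_invariant ex Wu) (maslov_invariant ey Wu)). Qed.

(** The norm of a covector is a scalar, and the differential of a function is
    a covector. *)
Lemma gradient_invariant (psi psi' : R * R -> R) u : W u -> Ck 1 U psi ->
  (forall x, W x -> psi (tau x) = psi' x) ->
  chart_conorm f' u ('D_ex psi' u) ('D_ey psi' u) =
  chart_conorm f (tau u) ('D_ex psi (tau u)) ('D_ey psi (tau u)).
Proof.
move=> Wu sp pp.
have E v : 'D_v psi' u = ('D_v tau u).1 * 'D_ex psi (tau u) + ('D_v tau u).2 * 'D_ey psi (tau u).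
  apply: etrans (along_eq oW (fun=> v) (fun x Wx => esym (pp x Wx)) Wu) _.
  have [D1 D2] := derivable_pair (Ck_derivable v (st 1) Wu).
  exact: (@derive_val _ _ _ _ _ _ _ (is_derive_comp2 oU (WU Wu) sp D1 D2)).
exact: (chart_conorm_invariant Wu (E ex) (E ey)).
Qed.

End Invariance.

#[local] Transparent derive along.

(** * Distance estimates by segments in a chart *)

#[local] Opaque derive.

Section Lines.
Context {R : realType} {V : normedModType R}.

Lemma line_continuous (v z : V) : continuous (fun t : R => t *: v + z).
Proof.
move=> t; apply: cvgD; last exact: cvg_cst.
by apply: cvgZ; [exact: cvg_id|exact: cvg_cst].
Qed.

#[local] Transparent derive.
Lemma derive_on_line (W : normedModType R) (g : V -> W) (v z : V) (r : R) :
  'D_r (fun t : R => g (t *: v + z)) = fun t => 'D_(r *: v) g (t *: v + z).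
Proof.
apply/funext => t; rewrite /derive.
suff -> : (fun h : R => h^-1 *: (((fun t : R => g (t *: v + z)) \o shift t) (h *: r) - g (t *: v + z))) =
  (fun h : R => h^-1 *: ((g \o shift (t *: v + z)) (h *: (r *: v)) - g (t *: v + z))) by [].
by apply/funext => h /=; rewrite scalerDl addrA scalerA.
Qed.
#[local] Opaque derive.

Lemma Ck_line (W : normedModType R) k (B : set V) (g : V -> W) (v z : V) :
  Ck k B g -> Ck k [set t : R | B (t *: v + z)] (fun t : R => g (t *: v + z)).
Proof.
elim: k g => [|k IH] g Cg.
  split=> // t Bt; apply: (@continuous_comp _ _ _ (fun t : R => t *: v + z) g).
    exact: line_continuous.
  exact: (Ck_continuous Cg Bt).
split=> [t Bt|r].
  apply: (@continuous_comp _ _ _ (fun t : R => t *: v + z) g); first exact: line_continuous.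
  exact: (Ck_continuous Cg Bt).
split; last exact: (eq_ind _ (Ck k _) (IH _ (Ck_derive (r *: v) Cg)) _ (esym (derive_on_line g v z r))).
move=> t Bt; have D := Ck_derivable (r *: v) Cg Bt.
have E : (fun h : R => h^-1 *: (g ((h *: r + t) *: v + z) - g (t *: v + z))) =
    (fun h : R => h^-1 *: (g (h *: (r *: v) + (t *: v + z)) - g (t *: v + z))).
  by apply/funext => h /=; rewrite scalerDl addrA scalerA.
exact: (eq_ind_r (fun k => cvg (k @ 0^')) D E).
Qed.

Lemma open_line (B : set V) (v z : V) : open B -> open [set t : R | B (t *: v + z)].
Proof. by move=> oB; apply: open_comp => // t _; exact: line_continuous. Qed.

End Lines.

Section Enorm.
Context {R : realType}.
Notation V6 := 'rV[R]_(3 + 3).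

Lemma enorm_le (x : V6) (L : R) : 0 <= L -> dot x x <= L ^+ 2 -> enorm x <= L.
Proof. by move=> L0 xL; rewrite -(ger0_norm L0) -sqrtr_sqr ler_wsqrtr. Qed.

Lemma enormN (x : V6) : enorm (- x) = enorm x.
Proof. by rewrite /enorm dotNl dotNr opprK. Qed.

Lemma enormZ (a : R) (x : V6) : 0 <= a -> enorm (a *: x) = a * enorm x.
Proof.
move=> a0; rewrite /enorm dotZl dotZr mulrA -expr2 sqrtrM ?sqr_ge0//.
by rewrite sqrtr_sqr ger0_norm.
Qed.

Lemma derive_planeZ (A : set (R * R)) (f : R * R -> V6) (x v : R * R) (a : R) : open A -> A x ->
  Ck 1 A f -> 'D_(a *: v) f x = a *: 'D_v f x.
Proof.
move=> oA Ax Cf; have key (p q : V6) (b c d : R) : (b * c) *: p + (b * d) *: q = b *: (c *: p + d *: q).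
  by rewrite scalerDr !scalerA.
apply: etrans (derive_planeV (a *: v) oA Ax Cf) _.
exact: (etrans (key _ _ _ _ _) (congr1 (fun x => a *: x) (esym (derive_planeV v oA Ax Cf)))).
Qed.

End Enorm.

Lemma bounded_near (R : realType) (g1 g2 : R * R -> R) (z : R * R) :
  (forall u, 0 <= g1 u) -> (forall u, 0 <= g2 u) ->
  {for z, continuous g1} -> {for z, continuous g2} ->
  exists B : R, 1 <= B /\ \forall y \near z, g1 y < B /\ g2 y < B.
Proof.
move=> p1 p2 c1 c2; exists (g1 z + g2 z + 1).
split; first by rewrite lerDr addr_ge0.
have n1 : \forall y \near z, g1 y < g1 z + g2 z + 1.
  by apply: (cvgr_lt _ c1); rewrite ltr_pwDr// lerDl.
have n2 : \forall y \near z, g2 y < g1 z + g2 z + 1.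
  by apply: (cvgr_lt _ c2); rewrite ltr_pwDr// lerDr.
exact: filterI n1 n2.
Qed.

Lemma enorm_combination (R : realType) (x p q : 'rV[R]_(3 + 3)) (a b r B : R) : 1 <= B ->
  x = a *: p + b *: q -> dot p p < B -> dot q q < B -> `|a| < r -> `|b| < r ->
  enorm x <= 2 * B * r.
Proof.
move=> B1 -> pB qB ar br.
have r0 : 0 <= r by apply: le_trans (ltW ar).
have B0 : 0 <= B by exact: le_trans B1.
apply: enorm_le; first by rewrite !mulr_ge0.
have le1 : dot (a *: p + b *: q) (a *: p + b *: q) <= 2 * a ^+ 2 * dot p p + 2 * b ^+ 2 * dot q q.
  rewrite -subr_ge0 (_ : _ - _ = dot (a *: p - b *: q) (a *: p - b *: q)); first exact: dot_ge0.
  by rewrite !(dotDl, dotNl, dotZl) !(dotDr, dotNr, dotZr) (dotC q p); ring.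
have sq (k : R) : `|k| < r -> k ^+ 2 <= r ^+ 2.
  by move=> kr; rewrite -(real_normK (num_real k)) ler_pXn2r// ?nnegrE// ltW.
have m (k D : R) : `|k| < r -> 0 <= D -> D < B -> 2 * k ^+ 2 * D <= 2 * r ^+ 2 * B.
  move=> kr D0 DB; apply: ler_pM; [|exact: D0| |exact: ltW].
    by rewrite mulr_ge0// sqr_ge0.
  by rewrite ler_pM2l// sq.
apply: (le_trans le1); apply: (@le_trans _ _ (4 * r ^+ 2 * B)).
  rewrite (_ : 4 * _ * B = 2 * r ^+ 2 * B + 2 * r ^+ 2 * B); last by ring.
  by apply: lerD; apply: m => //; exact: dot_ge0.
rewrite (_ : (2 * B * r) ^+ 2 = 4 * r ^+ 2 * B * B); last by ring.
by rewrite ler_peMr// mulr_ge0// mulr_ge0// sqr_ge0.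
Qed.

Lemma integral_unit_cst (R : realType) (L : R) :
  \int[lebesgue_measure]_(t in `[0, 1]) L = L.
Proof.
have E : lebesgue_measure (`[0, 1]%classic : set R) = 1%E.
  by rewrite lebesgue_measure_itv/= lte_fin ltr01 oppr0 adde0.
rewrite Rintegral_cst; last exact: measurable_itv.
exact: (etrans (congr1 (fun x => L * fine x) E) (mulr1 L)).
Qed.

Section Curves.
Context {R : realType} {S : smooth_surface R} (F : S -> 'rV[R]_(3 + 3)).
Hypothesis sF : forall c : chart S, smooth_on (cimg c) (F \o cinv c).

Lemma joined_trans x y z l l' : joined F x y l -> joined F y z l' -> joined F x z (l + l').
Proof.
move=> H; elim: H z l' => [w|g w k Cg _ IH] z l' H; first by rewrite add0r.
by rewrite -addrA; apply: joined_cons => //; exact: IH.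
Qed.

(** Both directions are recorded, as a Cauchy sequence for the induced
    distance needs both. *)
Definition within_distance x y L :=
  (exists2 l, l <= L & joined F x y l) /\ (exists2 l, l <= L & joined F y x l).

Lemma within_distance_refl x : within_distance x x 0.
Proof. by split; exists 0 => //; exact: joined_nil. Qed.

Lemma within_distance_trans x y z L L' :
  within_distance x y L -> within_distance y z L' -> within_distance x z (L + L').
Proof.
move=> [[l1 h1 j1] [l2 h2 j2]] [[l3 h3 j3] [l4 h4 j4]]; split.
  by exists (l1 + l3); [exact: lerD|exact: joined_trans j1 j3].
by exists (l4 + l2); [rewrite addrC; exact: lerD|exact: joined_trans j4 j2].
Qed.

Lemma within_distance_sym x y L : within_distance x y L -> within_distance y x L.
Proof. by move=> []. Qed.

Lemma induced_dist_lt x y L (e : R) : within_distance x y L -> L < e ->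
  (induced_dist F x y < e%:E)%E.
Proof.
move=> [[l lL j] _] Le; apply: (@le_lt_trans _ _ l%:E); last by rewrite lte_fin; exact: le_lt_trans Le.
by apply: ereal_inf_lbound; exists l.
Qed.

Lemma chart_segment c (z v : R * R) (L : R) :
  (forall t : R, 0 <= t <= 1 -> cimg c (t *: v + z)) ->
  (forall t : R, 0 <= t <= 1 -> enorm ('D_v (F \o cinv c) (t *: v + z)) <= L) ->
  exists2 l, l <= L & joined F (cinv c z) (cinv c (v + z)) l.
Proof.
move=> segC segL; pose g (t : R) := cinv c (t *: v + z).
have g0 : g 0 = cinv c z by rewrite /g scale0r add0r.
have g1 : g 1 = cinv c (v + z) by rewrite /g scale1r.
set A := [set t : R | cimg c (t *: v + z)].
have oA : open A by apply: open_line; exact: cimg_open.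
have in01 (t : R) : `[0, 1]%classic t -> 0 <= t <= 1 by rewrite /= in_itv.
have Cg : C1_curve g.
  exists A; first by split => // t /in01 t01; exact: segC.
  split=> [t At|c'].
    apply: (@continuous_comp _ _ _ (fun t : R => t *: v + z) (cinv c)); first exact: line_continuous.
    exact: cinv_continuous.
  exact: (Ck_line v z (@transition_smooth _ S c c' 1)).
exists (curve_length F g + 0); last first.
  by rewrite -g0 -g1; apply: joined_cons => //; exact: joined_nil.
rewrite addr0 /curve_length.
pose G (t : R) := enorm ('D_v (F \o cinv c) (t *: v + z)).
have E : (fun t => enorm ('D_1 (F \o g) t)) = G.
  have D : 'D_1 (F \o g) = fun t => 'D_v (F \o cinv c) (t *: v + z).
    apply: etrans (derive_on_line (F \o cinv c) v z 1) _.
    exact: (congr1 (fun w => fun t : R => 'D_w (F \o cinv c) (t *: v + z)) (scale1r v)).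
  exact: (congr1 (fun k => fun t : R => enorm (k t)) D).
rewrite E.
have cG t : A t -> {for t, continuous G}.
  move=> At; have C1 := Ck_line v z (sm_derive v (sF c) 0).
  have Cd := Ck_continuous (Ck_dot oA C1 C1) At.
  apply: (@continuous_comp _ _ _ (fun t : R => dot ('D_v (F \o cinv c) (t *: v + z))
    ('D_v (F \o cinv c) (t *: v + z))) Num.sqrt); first exact: Cd.
  exact: sqrt_continuous.
have iG : (lebesgue_measure).-integrable `[0, 1] (EFin \o G).
  apply: continuous_compact_integrable; first exact: segment_compact.
  apply: continuous_in_subspaceT => t; rewrite inE => t01.
  by apply: cG; exact: segC (in01 _ t01).
have iL : (lebesgue_measure).-integrable `[0, 1] (EFin \o (fun=> L : R)).
  apply: continuous_compact_integrable; first exact: segment_compact.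
  by apply: continuous_in_subspaceT => t _; exact: cst_continuous.
have LE := le_Rintegral _ iG iL (fun t t01 => segL t (in01 t t01)).
exact: (eq_ind _ (fun k => _ <= k) (LE (measurable_itv _)) _ (integral_unit_cst L)).
Qed.

(** The reverse segment is the same lemma for the opposite vector. *)
Lemma segment_within c (z v : R * R) (L : R) :
  (forall t : R, 0 <= t <= 1 -> cimg c (t *: v + z)) ->
  (forall t : R, 0 <= t <= 1 -> enorm ('D_v (F \o cinv c) (t *: v + z)) <= L) ->
  within_distance (cinv c z) (cinv c (v + z)) L.
Proof.
move=> segC segL; split; first exact: chart_segment.
have flip (t : R) : t *: ((-1) *: v) + (v + z) = (1 - t) *: v + z.
  by rewrite scalerA mulrN1 scaleNr scalerBl scale1r addrCA addrA.
have t1 (t : R) : 0 <= t <= 1 -> 0 <= 1 - t <= 1.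
  by move=> /andP[a b]; rewrite subr_ge0 b lerBlDr lerDl.
have -> : cinv c z = cinv c ((-1) *: v + (v + z)) by rewrite scaleN1r addKr.
apply: chart_segment => t /t1 t01; rewrite flip; first exact: segC.
have e := derive_planeZ v (-1) (@cimg_open _ S c) (segC _ t01) (sF c 1).
have := segL _ t01.
have -> : enorm ('D_(-1 *: v) (F \o cinv c) ((1 - t) *: v + z)) =
    enorm ('D_v (F \o cinv c) ((1 - t) *: v + z)).
  apply: etrans (congr1 (@enorm R) e) _; rewrite scaleN1r; exact: enormN.
exact.
Qed.

Lemma speed_bound c (z : R * R) : cimg c z -> exists d B : R, [/\ 0 < d, 1 <= B &
  forall w, `|w.1 - z.1| < d -> `|w.2 - z.2| < d -> cimg c w /\ forall (v : R * R) (r : R),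
    `|v.1| < r -> `|v.2| < r -> enorm ('D_v (F \o cinv c) w) <= 2 * B * r].
Proof.
move=> Cz; have oC := @cimg_open _ S c.
pose ex : R * R := (1, 0); pose ey : R * R := (0, 1).
have sx := sm_derive ex (sF c); have sy := sm_derive ey (sF c).
have n0 : \forall y \near z, cimg c y := open_nbhs_nbhs (conj oC Cz).
have [B [B1 n]] := bounded_near (fun u => dot_ge0 _) (fun u => dot_ge0 _)
  (sm_continuous (sm_dot oC sx sx) Cz) (sm_continuous (sm_dot oC sy sy) Cz).
have [d d0 H] := near_box (filterI n0 n).
exists d, B; split; [exact: d0|exact: B1|move=> w w1 w2].
have [Cw [b1 b2]] := H w w1 w2; split; first exact: Cw.
move=> v r v1 v2; have E := derive_planeV v oC Cw (sF c 1).
exact: (enorm_combination B1 E b1 b2 v1 v2).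
Qed.

Lemma within_near_chart c (z : R * R) (e : R) : cimg c z -> 0 < e ->
  \forall y \near z, cimg c y /\ within_distance (cinv c z) (cinv c y) e.
Proof.
move=> Cz e0; have [d [B [d0 B1 H]]] := speed_bound Cz.
have B0 : 0 < 2 * B by rewrite mulr_gt0// (lt_le_trans ltr01).
pose r := Num.min d (e / (2 * B)).
have r0 : 0 < r by rewrite lt_min d0 divr_gt0.
have rd : r <= d by rewrite ge_min lexx.
have rB : 2 * B * r <= e by rewrite mulrC -ler_pdivlMr// ge_min lexx orbT.
apply: (box_near r0) => y y1 y2.
have k (t a b : R) : 0 <= t <= 1 -> `|a - b| < r -> `|t * (a - b) + b - b| < d.
  move=> /andP[t0 t1] ab; rewrite addrK normrM (ger0_norm t0).
  by apply: lt_le_trans rd; apply: le_lt_trans ab; rewrite ler_piMl.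
have seg (t : R) (t01 : 0 <= t <= 1) := H (t *: (y - z) + z) (k _ _ _ t01 y1) (k _ _ _ t01 y2).
have W := segment_within (c := c) (z := z) (v := y - z) (L := e) (fun t t01 => (seg t t01).1)
  (fun t t01 => le_trans ((seg t t01).2 (y - z) r y1 y2) rB).
have yE : (y - z) + z = y by exact: subrK.
split; last exact: (eq_ind _ (fun x => within_distance _ (cinv c x) e) W _ yE).
have := (seg 1 (introT andP (conj ler01 (lexx 1)))).1.
by rewrite scale1r yE.
Qed.

(** The induced distance is continuous for the topology of the surface. *)
Lemma within_near (x : S) (e : R) : 0 < e -> \forall y \near x, within_distance x y e.
Proof.
move=> e0; have [c dx] := cdom_cover x.
have N : \forall y \near x, cimg c (cmap c y) /\
    within_distance (cinv c (cmap c x)) (cinv c (cmap c y)) e.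
  exact: (cmap_continuous dx (within_near_chart (cimg_map dx) e0)).
have D : \forall y \near x, cdom c y := open_nbhs_nbhs (conj (cdom_open c) dx).
apply: filterS (filterI N D) => y [[_ W] dy].
exact: (eq_ind _ (fun a => within_distance a y e) (eq_ind _ (fun b => within_distance _ b e) W _ (cmapK dy)) _ (cmapK dx)).
Qed.

(** By continuity the inequality between speed and slope persists, with a
    margin, along a short segment; the mean value theorem integrates it. *)
Lemma descent_step c (B : set (R * R)) (psi : R * R -> R) (z v : R * R) (k : R) :
  open B -> B `<=` cimg c -> B z -> Ck 1 B psi -> 0 < k ->
  k * enorm ('D_v (F \o cinv c) z) < - 'D_v psi z ->
  exists r L : R, [/\ 0 < r, forall s : R, `|s| <= `|r| -> B (s *: v + z),
    within_distance (cinv c z) (cinv c (r *: v + z)) L, 0 <= L &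
    k * L < psi z - psi (r *: v + z)].
Proof.
move=> oB BC Bz Cpsi k0; have oC := @cimg_open _ S c; have Cz := BC z Bz.
pose f := F \o cinv c.
set a := enorm _ => ab; set b := - 'D_v psi z in ab.
have a0 : 0 <= a by exact: sqrtr_ge0.
pose m := (k * a + b) / 2.
have am : a < m / k by rewrite ltr_pdivlMr// mulrC midf_lt.
have mb : m < b by rewrite midf_lt.
have sv := sm_derive v (sF c).
have c1 : {for z, continuous (fun u => enorm ('D_v f u))}.
  apply: (@continuous_comp _ _ _ (fun u => dot ('D_v f u) ('D_v f u)) Num.sqrt).
    exact: (sm_continuous (sm_dot oC sv sv) Cz).
  exact: sqrt_continuous.
have c2 : {for z, continuous ('D_v psi)} := Ck_continuous (Ck_derive v Cpsi) Bz.
have n0 : \forall y \near z, B y := open_nbhs_nbhs (conj oB Bz).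
have n1 : \forall y \near z, enorm ('D_v f y) < m / k by exact: (cvgr_lt _ c1).
have n2 : \forall y \near z, 'D_v psi y < - m.
  by apply: (cvgr_lt _ c2); rewrite ltrNr.
have l0 : (fun t : R => t *: v + z) @ (0 : R) --> z.
  by have := @line_continuous _ _ v z 0; rewrite /continuous_at scale0r add0r.
have N : \forall t \near (0 : R), B (t *: v + z) /\ enorm ('D_v f (t *: v + z)) < m / k /\
    'D_v psi (t *: v + z) < - m.
  exact: (l0 _ (filterI n0 (filterI n1 n2))).
move: N => /nbhs_ballP[d /= d0 H].
have d2 : 0 < d / 2 by rewrite divr_gt0.
have H' (s : R) : `|s| <= d / 2 -> [/\ B (s *: v + z), enorm ('D_v f (s *: v + z)) < m / k &
    'D_v psi (s *: v + z) < - m].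
  move=> sd; have [|h0 [h1 h2]] := H s; last by split.
  by rewrite -ball_normE /ball_/= sub0r normrN (le_lt_trans sd)// ltr_pdivrMr// mulr_natr mulr2n ltrDl.
have rn : `|d / 2| = d / 2 by rewrite ger0_norm// ltW.
exists (d / 2), (d / 2 * (m / k)); split.
- exact: d2.
- by move=> s; rewrite rn => /H' [].
- have sd (t : R) : 0 <= t <= 1 -> `|t * (d / 2)| <= d / 2.
    move=> /andP[t0 t1]; rewrite (ger0_norm (mulr_ge0 t0 (ltW d2))); exact: (ler_piMl (ltW d2) t1).
  apply: segment_within => t /sd/H' [h0 h1 _]; rewrite scalerA; first exact: BC.
  apply: le_trans (le_trans _ (ler_wpM2l (ltW d2) (ltW h1))); first exact: lexx.
  have e := derive_planeZ v (d / 2) oC (BC _ h0) (sF c 1).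
  have -> : enorm ('D_((d / 2) *: v) (F \o cinv c) ((t * (d / 2)) *: v + z)) =
     d / 2 * enorm ('D_v f ((t * (d / 2)) *: v + z)).
    apply: etrans (congr1 (@enorm R) e) _; exact: (enormZ _ (ltW d2)).
  exact: lexx.
- by rewrite mulr_ge0 ?(ltW d2)// (le_trans a0)// ltW.
- have [q qd E] := MVT_line (x := z) (v := v) Cpsi (fun s (sr : `|s| <= `|d / 2|) => let: And3 h _ _ := H' s (eq_ind _ (fun x => `|s| <= x) sr _ rn) in h).
  have [_ _ h] := H' q (eq_ind _ (fun x => `|q| <= x) qd _ rn).
  have -> : k * (d / 2 * (m / k)) = d / 2 * m by field; exact: lt0r_neq0.
  rewrite -[X in _ < X]opprB E -mulrN ltr_pM2l// ltrNr; exact: h.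
Qed.

End Curves.

#[local] Transparent derive.

(** * Descent on a complete surface *)

Section Descent.
Context {R : realType} {S : smooth_surface R} (F : S -> 'rV[R]_(3 + 3)).
Hypothesis sF : forall c : chart S, smooth_on (cimg c) (F \o cinv c).
Hypothesis complete : complete_induced_metric F.
Variables (u : S -> R) (M : set S) (k : R).
Hypothesis k0 : 0 < k.
Hypothesis u_ge0 : forall x, M x -> 0 <= u x.
Hypothesis M_closed : forall (a : nat -> S) x, (forall n, M (a n)) ->
  (forall n m, (n <= m)%N -> u (a m) <= u (a n)) -> a @ \oo --> x ->
  M x /\ (u \o a) @ \oo --> u x.
Hypothesis M_step : forall x, M x -> exists y L,
  [/\ M y, within_distance F x y L, 0 <= L & k * L < u x - u y].

Let below x y := M y /\ exists L, [/\ within_distance F x y L, 0 <= L & k * L <= u x - u y].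

Let below_refl x : M x -> below x x.
Proof.
move=> Mx; split=> //; exists 0; split => //; last by rewrite mulr0 subrr.
exact: within_distance_refl.
Qed.

Let below_trans x y z : below x y -> below y z -> below x z.
Proof.
move=> [_ [L [W L0 h]]] [Mz [L' [W' L0' h']]]; split=> //; exists (L + L'); split.
- exact: within_distance_trans W W'.
- exact: addr_ge0.
- by rewrite mulrDr (le_trans (lerD h h'))// addrA subrK.
Qed.

(* The current point itself qualifies, for the case that no loss is possible. *)
Let greedy x : exists y, M x -> below x y /\ forall w, below x w -> u y <= (u x + u w) / 2.
Proof.
have [Mx|nM] := pselect (M x); last by exists x.
pose E := [set u w | w in [set w | below x w]].
have lbE : has_lbound E by exists 0 => _ [w [Mw _] <-]; exact: u_ge0.
have iE : has_inf E by split=> //; exists (u x), x => //; exact: below_refl.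
have half (y z w : R) : y <= w -> z <= w -> y <= z -> y <= (z + w) / 2.
  by move=> h1 h2 h3; rewrite ler_pdivlMr// mulr_natr mulr2n lerD.
have inf_le w : below x w -> inf E <= u w by move=> xw; apply: (ge_inf lbE); exists w.
have [xi|ix] := leP (u x) (inf E).
  exists x => _; split; first exact: below_refl.
  move=> w /inf_le iw; rewrite ler_pdivlMr// mulr_natr mulr2n lerD2l; exact: le_trans iw.
have eps0 : 0 < (u x - inf E) / 2 by rewrite divr_gt0// subr_gt0.
have [_ [y xy <-] yi] := inf_adherent eps0 iE.
exists y => _; split => // w /inf_le iw; apply: (le_trans (ltW yi)).
rewrite (_ : inf E + _ = (u x + inf E) / 2); last by field.
by rewrite ler_pM2r ?invr_gt0// lerD2l.
Qed.

(** Follow a greedy sequence: at each stage, take at least half of the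
    possible loss. The total length is bounded by the total loss, so that the
    sequence is Cauchy. The limit admits one more step, which is also possible
    from the late terms of the sequence, and its loss does not tend to zero:
    the greedy choice would have taken half of it. *)
Lemma no_descent x0 : ~ M x0.
Proof.
move=> M0; have [g gP] := choice greedy.
pose a (n : nat) : S := iter n g x0.
have Ma n : M (a n) by elim: n => [//|n IH]; have [[]] := gP _ IH.
have ab n m : (n <= m)%N -> below (a n) (a m).
  elim: m => [|m IH]; first by rewrite leqn0 => /eqP ->; exact: below_refl.
  rewrite leq_eqVlt => /orP[/eqP ->|]; first exact: below_refl.
  by rewrite ltnS => /IH h; apply: below_trans h _; have [] := gP _ (Ma m).
have dec n m : (n <= m)%N -> u (a m) <= u (a n).
  by move=> /ab[_ [L [_ L0 h]]]; rewrite -subr_ge0; apply: le_trans h; rewrite mulr_ge0// ltW.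
have ni : nonincreasing_seq (u \o a) by move=> n m nm; exact: dec.
have cu : cvgn (u \o a).
  by apply: (nonincreasing_is_cvgn ni); exists 0 => _ [n _ <-]; exact: u_ge0.
pose l := limn (u \o a).
have lge n : l <= u (a n) by exact: nonincreasing_cvgn_ge.
have [x ax] : exists x : S, a @ \oo --> x.
  apply: (@complete a) => e e0.
  have ke : l < l + k * e by rewrite ltrDl mulr_gt0.
  have [N _ HN] : \forall n \near \oo, u (a n) < l + k * e by exact: (cvgr_lt _ cu).
  exists N => m n Nm Nn.
  have near_pair i j : (N <= i)%N -> (i <= j)%N -> exists2 L, within_distance F (a i) (a j) L & L < e.
    move=> Ni /ab[_ [L [W _ h]]]; exists L => //.
    rewrite -(ltr_pM2l k0); apply: le_lt_trans h _; rewrite ltrBlDr.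
    by apply: lt_le_trans (HN i Ni) _; rewrite addrC lerD2l.
  have [mn|nm] := leqP m n.
    by have [L W Le] := near_pair _ _ Nm mn; exact: induced_dist_lt W Le.
  have [L W Le] := near_pair _ _ Nn (ltnW nm).
  exact: induced_dist_lt (within_distance_sym W) Le.
have [Mx ux] := M_closed Ma dec ax.
have uxle n : u x <= u (a n).
  have := nonincreasing_cvgn_ge ni cu n.
  by rewrite (cvg_lim _ ux).
have [y [L [My W L0 kL]]] := M_step Mx.
pose d := (u x - u y - k * L) / k.
have d0 : 0 < d by rewrite divr_gt0// subr_gt0.
have yx : u y < u x by rewrite -subr_gt0; apply: le_lt_trans kL; rewrite mulr_ge0// ltW.
have n1 : \forall n \near \oo, within_distance F x (a n) d by exact: (ax _ (within_near sF x d0)).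
have n2 : \forall n \near \oo, u (a n) < u x + (u x - u y).
  by apply: (cvgr_lt _ ux); rewrite ltrDl subr_gt0.
have [N _ HN] := filterI n1 n2.
have [Wn un] := HN N (leqnn N).
have bn : below (a N) y.
  split=> //; exists (d + L); split; last 1 first.
  - by rewrite mulrDr /d mulrC divfK ?gt_eqF// subrK lerD2r.
  - exact: within_distance_trans (within_distance_sym Wn) W.
  - by rewrite addr_ge0// ltW.
have := (gP _ (Ma N)).2 y bn; rewrite leNgt => /negP; apply.
apply: lt_le_trans (uxle N.+1); rewrite ltr_pdivrMr// mulr_natr mulr2n.
by rewrite -ltrBrDr -addrA.
Qed.

End Descent.

(** * The inverse mean curvature in a chart *)

#[local] Opaque derive along.

Section ChartRigidity.
Context {R : realType} {S : smooth_surface R} (F : S -> 'rV[R]_(3 + 3)).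
Hypotheses (imm : sphere_immersion F) (leg : legendrian F) (wil : willmore F).
Notation V6 := 'rV[R]_(3 + 3).
Let ex : R * R := (1, 0).
Let ey : R * R := (0, 1).
Variable c : chart S.
Let f := F \o cinv c.
Let U := cimg c.

Let oU : open U := @cimg_open _ S c.
Let sf : smooth_on U f. Proof. by have [_ s _] := imm; exact: s. Qed.
Let ff u : U u -> dot (f u) (f u) = 1.
Proof. by move=> _; have [n _ _] := imm; rewrite -enorm_sq n expr1n. Qed.
Let im u v : U u -> 'D_v f u = 0 -> v = 0.
Proof. by move=> Uu; have [_ _ i] := imm; exact: i. Qed.
Let leg0 u v : U u -> dot ('D_v f u) (muli (f u)) = 0.
Proof. by move=> Uu; have [[_ l] _] := leg Uu; exact: etrans (dotC _ _) (l v). Qed.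
Let leg1 u v w : U u -> dot ('D_v f u) (muli ('D_w f u)) = 0.
Proof. by move=> Uu; have [_ l] := leg Uu; exact: etrans (dotC _ _) ((l w).2 v). Qed.

Lemma chart_gram_gt0 u : cimg c u -> 0 < gram ('D_ex f u) ('D_ey f u).
Proof. exact: (gram_gt0 oU sf im). Qed.

Lemma chart_legendrian u v w : cimg c u -> dot ('D_v f u) (muli ('D_w f u)) = 0.
Proof. exact: leg1. Qed.

Lemma sm_chart_mean_sq : smooth_on (cimg c) (mean_sq f).
Proof. exact: (sm_mean_sq oU sf im). Qed.

Lemma chart_mean_sq_ge0 u : cimg c u -> 0 <= mean_sq f u.
Proof. by move=> Uu; have [g _] := chart_conorm_ge0 oU sf im (maslov ex f u) (maslov ey f u) Uu. Qed.

Lemma chart_mean_curvature_eq0 u : cimg c u -> mean_sq f u = 0 -> mean_curvature f u = 0.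
Proof. exact: (mean_curvature_eq0 oU sf ff im leg0 leg1). Qed.

Let A := bent U f.
Let oA : open A := open_bent oU sf im.
Let p1 := adapted1 f.
Let p2 := adapted2 f.
Let q u := (mean_norm f u)^-1.

Let q_neq0 u : A u -> q u != 0.
Proof. by move=> [_ m]; rewrite invr_eq0 gt_eqF// sqrtr_gt0. Qed.

Lemma sm_inverse_mean : smooth_on A q.
Proof.
apply: (sm_inv oA _ (sm_mean_norm oU sf im)) => u [_ m].
by rewrite gt_eqF// sqrtr_gt0.
Qed.
Let sq := sm_inverse_mean.

Let rigid : smooth_field A p1 /\ smooth_field A p2 /\ forall u, A u ->
  [/\ along p2 q u = 0, along p1 (along p1 q) u = - q u & along p2 (along p1 q) u = 0].
Proof.
have [w1 [w2 [a [b [cc [d [M ach bd0]]]]]]] := adapted_moving_frame oU sf ff im leg0 leg1.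
have J0 u : A u -> 0 < (p1 u).1 * (p2 u).2 - (p1 u).2 * (p2 u).1.
  by move=> Au; exact: (adapted_orientation oU sf im Au).
have sh : smooth_on A (mean_norm f) := sm_mean_norm oU sf im.
have h0 u : A u -> 0 < mean_norm f u by move=> [_ m]; rewrite sqrtr_gt0.
have AC : A `<=` cimg c by move=> u [].
have EL u (Au : A u) w := euler_lagrange imm wil AC M J0 sh ach bd0 (z := u) (w := w) Au.
split; first exact: (mf_p1 M); split; first exact: (mf_p2 M); move=> u Au.
have EL3 x : A x -> [/\
    dot (willmore_field (along p1 f) (along p2 f) p1 p2 w1 w2 a b cc (mean_norm f) x) (muli (f x)) = 0,
    dot (willmore_field (along p1 f) (along p2 f) p1 p2 w1 w2 a b cc (mean_norm f) x) (muli (along p1 f x)) = 0 &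
    dot (willmore_field (along p1 f) (along p2 f) p1 p2 w1 w2 a b cc (mean_norm f) x) (muli (along p2 f x)) = 0].
  move=> Ax; have [_ [_ [i1 i2 _]]] := mf_frame M Ax.
  split; apply: etrans (dotC _ _) (EL x Ax _ _); apply: etrans (dotC _ _) _.
  - exact: dot_muliv.
  - exact: i1.
  - exact: i2.
have [k1 k2] := inverse_mean_oscillates M sh h0 ach bd0 EL3 Au.
by split; [exact: (along2_inverse_mean M sh h0 ach bd0 EL3 Au)|exact: k1|exact: k2].
Qed.

Let sp1 := rigid.1.
Let sp2 := rigid.2.1.
Let X := along p1 q.
Let sX : smooth_on A X := sm_along oA sp1 sq.

(** The square of the norm of the differential of q is (X1 q)^2 + (X2 q)^2,
    and X2 q = 0. *)
Lemma gradient_sq u : A u -> chart_conorm f u ('D_ex q u) ('D_ey q u) = X u ^+ 2.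
Proof.
move=> Au; have [z _ _] := rigid.2.2 u Au.
have [c1 c2 c3] := adapted_cometric oU sf im Au.
have E1 := alongE oA p1 sq Au; have E2 := alongE oA p2 sq Au.
have key (g11 g12 g22 n1 n2 P11 P12 P21 P22 x y : R) :
    P11 ^+ 2 + P21 ^+ 2 = (g11 * g22 - g12 ^+ 2)^-1 * g22 ->
    P11 * P12 + P21 * P22 = - ((g11 * g22 - g12 ^+ 2)^-1 * g12) ->
    P12 ^+ 2 + P22 ^+ 2 = (g11 * g22 - g12 ^+ 2)^-1 * g11 ->
    x = P11 * n1 + P12 * n2 -> y = P21 * n1 + P22 * n2 -> y = 0 ->
    conorm g11 g12 g22 n1 n2 = x ^+ 2.
  move=> k1 k2 k3 -> yE y0.
  have -> : conorm g11 g12 g22 n1 n2 = (g11 * g22 - g12 ^+ 2)^-1 * g22 * n1 ^+ 2 +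
    2 * - ((g11 * g22 - g12 ^+ 2)^-1 * g12) * n1 * n2 + (g11 * g22 - g12 ^+ 2)^-1 * g11 * n2 ^+ 2.
    by rewrite /conorm; ring.
  rewrite -k1 -k2 -k3 -[RHS]addr0 -(mulr0 y) -[in RHS]y0 yE; ring.
exact: (key _ _ _ _ _ _ _ _ _ _ _ c1 c2 c3 E1 E2 z).
Qed.

Definition chart_energy u := q u ^+ 2 + chart_conorm f u ('D_ex q u) ('D_ey q u).

Let energyE u : A u -> q u * q u + X u * X u = chart_energy u.
Proof. by move=> Au; rewrite /chart_energy -!expr2; apply: congr1; exact: (esym (gradient_sq Au)). Qed.

Lemma sm_chart_energy : smooth_on A chart_energy.
Proof. exact: (sm_eq oA energyE (sm_add oA (sm_mul oA sq sq) (sm_mul oA sX sX))). Qed.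

(** This is the conservation of energy for the oscillator X1 (X1 q) = - q. *)
Lemma derive_chart_energy u v : A u -> 'D_v chart_energy u = 0.
Proof.
move=> Au; have [z1 z2 z3] := rigid.2.2 u Au.
have sE := sm_chart_energy.
have D p : along p chart_energy u = (along p q u * q u + q u * along p q u) +
    (along p X u * X u + X u * along p X u).
  apply: etrans (esym (along_eq oA p energyE Au)) _.
  apply: etrans (alongD p (sm_mul oA sq sq) (sm_mul oA sX sX) Au) _.
  exact: (congr2 +%R (alongM p sq sq Au) (alongM p sX sX Au)).
have D1 : along p1 chart_energy u = 0.
  apply: etrans (D p1) _; have xE : X u = along p1 q u by [].
  have key (x y z t : R) : z = - y -> t = x -> (x * y + y * x) + (z * t + t * z) = 0.
    by move=> -> ->; ring.
  exact: (key _ _ _ _ z2 xE).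
have D2 : along p2 chart_energy u = 0.
  apply: etrans (D p2) _.
  have key (x y z t : R) : x = 0 -> z = 0 -> (x * y + y * x) + (z * t + t * z) = 0.
    by move=> -> ->; ring.
  exact: (key _ _ _ _ z1 z3).
have J0 := adapted_orientation oU sf im Au.
have E1 := etrans (esym (alongE oA p1 sE Au)) D1; have E2 := etrans (esym (alongE oA p2 sE Au)) D2.
have key (P11 P12 P21 P22 x y : R) : 0 < P11 * P22 - P12 * P21 ->
    P11 * x + P12 * y = 0 -> P21 * x + P22 * y = 0 -> x = 0 /\ y = 0.
  move=> J k1 k2; have Jx : (P11 * P22 - P12 * P21) * x = 0.
    rewrite (_ : _ * x = P22 * (P11 * x + P12 * y) - P12 * (P21 * x + P22 * y)); last by ring.
    by rewrite k1 k2; ring.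
  have Jy : (P11 * P22 - P12 * P21) * y = 0.
    rewrite (_ : _ * y = P11 * (P21 * x + P22 * y) - P21 * (P11 * x + P12 * y)); last by ring.
    by rewrite k1 k2; ring.
  by split; apply/eqP; [move/eqP: Jx|move/eqP: Jy]; rewrite mulf_eq0 (gt_eqF J).
have [Ex Ey] := key _ _ _ _ _ _ J0 E1 E2.
apply: etrans (derive_plane v oA Au (sE 1)) _.
have key' (x y a b : R) : x = 0 -> y = 0 -> a * x + b * y = 0 by move=> -> ->; rewrite !mulr0 addr0.
exact: (key' _ _ _ _ Ex Ey).
Qed.

(** A function q > 0 with X1 (X1 q) = - q cannot have X1 q = 0 on an open set.
    *)
Lemma slope_somewhere u : A u -> exists2 z, A z & 0 < chart_conorm f z ('D_ex q z) ('D_ey q z).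
Proof.
move=> Au; have [[z Az Xz]|no] := pselect (exists2 z, A z & X z != 0).
  exists z => //; apply: (eq_ind _ (fun x => 0 < x) _ _ (esym (gradient_sq Az))).
  by rewrite lt_neqAle sqr_ge0 andbT eq_sym expf_neq0.
have X0 x : A x -> X x = 0.
  by move=> Ax; have [//|nx] := eqVneq (X x) 0; case: no; exists x.
have [_ z2 _] := rigid.2.2 u Au.
have Z : along p1 X u = 0 := etrans (along_eq oA p1 X0 Au) (along_cst p1 (0 : R) u).
have /eqP := etrans (esym z2) Z; rewrite oppr_eq0 => /eqP q0.
by have := q_neq0 Au; rewrite q0 eqxx.
Qed.

(** The opposite of the gradient. *)
Lemma descent_direction u : A u ->
  exists v : R * R, 'D_v q u = - chart_conorm f u ('D_ex q u) ('D_ey q u) /\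
    enorm ('D_v f u) = Num.sqrt (chart_conorm f u ('D_ex q u) ('D_ey q u)).
Proof.
move=> Au; have G := gradient_sq Au; exists (- X u *: p1 u).
have sfA : smooth_on A f by move=> k; apply: Ck_subset (sf k) => x [].
have [_ [_ [[_ n1 _] _]]] : True /\ True /\ legendrian_frame (f u) (along p1 f u) (along p2 f u).
  by do 2 (split => //); exact: (adapted_frame oU sf ff im leg0 leg1 Au).
split.
  have E1 := derive_plane (- X u *: p1 u) oA Au (sq 1).
  have E2 : X u = _ := alongE oA p1 sq Au.
  have key (x a b m1 m2 g : R) : g = x ^+ 2 -> x = a * m1 + b * m2 -> - x * a * m1 + - x * b * m2 = - g.
    by move=> -> e; rewrite -!mulrA -mulrDr -e expr2 mulNr.
  exact: (etrans E1 (key _ _ _ _ _ _ G E2)).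
have E3 := derive_planeZ (p1 u) (- X u) oA Au (sfA 1).
have key (x y : V6) (a g : R) : x = a *: y -> dot y y = 1 -> g = (- a) ^+ 2 -> enorm x = Num.sqrt g.
  by move=> -> yy ->; rewrite /enorm dotZl dotZr yy mulr1 sqrrN expr2.
exact: (key _ _ _ _ E3 n1 (etrans G (congr1 (fun x => x ^+ 2) (esym (opprK (X u)))))).
Qed.

End ChartRigidity.

#[local] Transparent derive along.

(** * Vanishing of the mean curvature *)

#[local] Opaque derive along.

Lemma continuous_near_eq (R : realType) (T : topologicalType) (g g' : T -> R) (x : T) :
  (\forall y \near x, g y = g' y) -> {for x, continuous g} -> {for x, continuous g'}.
Proof.
move=> E cg; have e : g x = g' x := nbhs_singleton E.
rewrite /prop_for /continuous_at -e; apply: cvg_trans cg; apply: near_eq_cvg.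
by apply: filterS E => y ->.
Qed.

Lemma inv_sqrt_bound (R : realType) (b k : R) : 0 <= b -> 0 < (Num.sqrt b)^-1 ->
  (Num.sqrt b)^-1 <= k -> k^-1 ^+ 2 <= b.
Proof.
move=> b0 s0 sk; have k0 : 0 < k by exact: lt_le_trans sk.
have : k^-1 <= Num.sqrt b by rewrite invf_ple// ?posrE// -invr_gt0.
have ki : 0 <= k^-1 by rewrite invr_ge0 ltW.
by move=> H; rewrite -[X in _ <= X](sqr_sqrtr b0) !expr2; exact: ler_pM.
Qed.

Section Global.
Context {R : realType} {S : smooth_surface R} (F : S -> 'rV[R]_(3 + 3)).
Hypotheses (imm : sphere_immersion F) (leg : legendrian F) (wil : willmore F).
Let ex : R * R := (1, 0).
Let ey : R * R := (0, 1).

Let f (c : chart S) := F \o cinv c.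
Let sf c : smooth_on (cimg c) (f c). Proof. by have [_ s _] := imm; exact: s. Qed.
Let im c u v : cimg c u -> 'D_v (f c) u = 0 -> v = 0.
Proof. by move=> Uu; have [_ _ i] := imm; exact: i. Qed.
Let bend c := bent (cimg c) (f c).
Let q c u := (mean_norm (f c) u)^-1.
Let oB c : open (bend c) := open_bent (@cimg_open _ S c) (@sf c) (@im c).

Let mean_sq_transition c k u : cimg c u -> cdom k (cinv c u) ->
  mean_sq (f c) u = mean_sq (f k) (cmap k (cinv c u)).
Proof.
move=> Cu du.
have oW := open_cinv (c := c) (cdom_open k).
have WU x : (cimg c `&` cinv c @^-1` cdom k) x -> cimg k (cmap k (cinv c x)).
  by move=> [_ dx]; exact: cimg_map.
have ff' x : (cimg c `&` cinv c @^-1` cdom k) x -> f k (cmap k (cinv c x)) = f c x.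
  by move=> [_ dx]; exact: (congr1 F (cmapK dx)).
exact: (mean_sq_invariant oW (@cimg_open _ S k) (@transition_smooth _ S c k) WU (@sf k) ff'
  (fun x Ux => chart_gram_gt0 imm Ux) (fun x Wx => chart_gram_gt0 imm Wx.1)
  (fun x v w Ux => chart_legendrian leg v w Ux) (conj Cu du)).
Qed.

Let energy_transition c k u : bend c u -> cdom k (cinv c u) ->
  chart_energy F c u = chart_energy F k (cmap k (cinv c u)).
Proof.
move=> Bu du; pose W := bend c `&` (cimg c `&` cinv c @^-1` cdom k).
have oW : open W := openI (oB (c := c)) (open_cinv (cdom_open k)).
have st : smooth_on W (cmap k \o cinv c).
  by move=> m; apply: Ck_subset (@transition_smooth _ S c k m) => x [].
have mE x : W x -> mean_sq (f c) x = mean_sq (f k) (cmap k (cinv c x)).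
  by move=> [_ [Cx dx]]; exact: mean_sq_transition.
have WU x : W x -> bend k (cmap k (cinv c x)).
  move=> Wx; have [[_ m0] [Cx dx]] := Wx; split; first exact: cimg_map.
  exact: (eq_ind _ (fun m => 0 < m) m0 _ (mE x Wx)).
have ff' x : W x -> f k (cmap k (cinv c x)) = f c x.
  by move=> [_ [_ dx]]; exact: (congr1 F (cmapK dx)).
have qq x : W x -> q k (cmap k (cinv c x)) = q c x.
  by move=> Wx; exact: (congr1 (fun m => (Num.sqrt m)^-1) (esym (mE x Wx))).
have Wu : W u by split; [exact: Bu|split; [exact: Bu.1|exact: du]].
have skb : smooth_on (bend k) (f k) by move=> m; apply: Ck_subset (@sf k m) => x [].
have G := gradient_invariant oW (oB (c := k)) st WU skb ff'
  (fun x Ux => chart_gram_gt0 imm Ux.1) (fun x Wx => chart_gram_gt0 imm Wx.1.1)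
  Wu (sm_inverse_mean imm k 1) qq.
exact: (congr2 (fun a b => a ^+ 2 + b) (esym (qq u Wu)) G).
Qed.

Definition chart_at (x : S) : chart S := sval (cid (cdom_cover x)).
Let chart_atP x : cdom (chart_at x) x := svalP (cid (cdom_cover x)).

(** |H|^2 as a function on the surface; the choice of the chart is immaterial
    by the invariance above. *)
Definition bending (x : S) : R := mean_sq (F \o cinv (chart_at x)) (cmap (chart_at x) x).
Definition height (x : S) : R := (Num.sqrt (bending x))^-1.
Definition energy (x : S) : R := chart_energy F (chart_at x) (cmap (chart_at x) x).

Lemma bending_chart c x : cdom c x -> bending x = mean_sq (F \o cinv c) (cmap c x).
Proof.
move=> dx; have e := cmapK dx.
have dk : cdom (chart_at x) (cinv c (cmap c x)) := eq_ind _ (cdom (chart_at x)) (chart_atP x) _ (esym e).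
have T := mean_sq_transition (cimg_map dx) dk.
exact: (esym (etrans T (congr1 (fun y => mean_sq (f (chart_at x)) (cmap (chart_at x) y)) e))).
Qed.

Lemma height_chart c x : cdom c x -> height x = (mean_norm (F \o cinv c) (cmap c x))^-1.
Proof. by move=> dx; exact: (congr1 (fun m => (Num.sqrt m)^-1) (bending_chart dx)). Qed.

Let bend_map c x : cdom c x -> 0 < bending x -> bend c (cmap c x).
Proof.
by move=> dx b0; split; [exact: cimg_map|exact: (eq_ind _ (fun m => 0 < m) b0 _ (bending_chart dx))].
Qed.

Lemma energy_chart c x : cdom c x -> 0 < bending x -> energy x = chart_energy F c (cmap c x).
Proof.
move=> dx b0; have e := cmapK dx.
have dk : cdom (chart_at x) (cinv c (cmap c x)) := eq_ind _ (cdom (chart_at x)) (chart_atP x) _ (esym e).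
have T := energy_transition (bend_map dx b0) dk.
exact: (esym (etrans T (congr1 (fun y => chart_energy F (chart_at x) (cmap (chart_at x) y)) e))).
Qed.

Lemma bending_continuous x : {for x, continuous bending}.
Proof.
set c := chart_at x; have dx : cdom c x := chart_atP x.
have D : \forall y \near x, cdom c y := open_nbhs_nbhs (conj (cdom_open c) dx).
apply: (@continuous_near_eq _ _ (fun y => mean_sq (f c) (cmap c y))).
  by apply: filterS D => y dy; exact: esym (bending_chart dy).
apply: (@continuous_comp _ _ _ (cmap c) (mean_sq (f c))); first exact: cmap_continuous.
exact: (sm_continuous (sm_chart_mean_sq imm c) (cimg_map dx)).
Qed.

Lemma bending_ge0 x : 0 <= bending x.
Proof. exact: (chart_mean_sq_ge0 imm (cimg_map (chart_atP x))). Qed.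

Lemma height_continuous x : 0 < bending x -> {for x, continuous height}.
Proof.
move=> b0; apply: (@continuous_comp _ _ _ (fun y => Num.sqrt (bending y)) (fun r : R => r^-1)).
  apply: (@continuous_comp _ _ _ bending Num.sqrt); first exact: bending_continuous.
  exact: sqrt_continuous.
by apply: inv_continuous; rewrite gt_eqF// sqrtr_gt0.
Qed.

Lemma energy_continuous x : 0 < bending x -> {for x, continuous energy}.
Proof.
move=> b0; set c := chart_at x; have dx : cdom c x := chart_atP x.
have D : \forall y \near x, cdom c y := open_nbhs_nbhs (conj (cdom_open c) dx).
have B : \forall y \near x, 0 < bending y by exact: (cvgr_gt _ (@bending_continuous x) _ b0).
apply: (@continuous_near_eq _ _ (fun y => chart_energy F c (cmap c y))).
  by apply: filterS (filterI D B) => y [dy By]; exact: esym (energy_chart dy By).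
apply: (@continuous_comp _ _ _ (cmap c) (chart_energy F c)); first exact: cmap_continuous.
exact: (sm_continuous (sm_chart_energy imm leg wil c) (bend_map dx b0)).
Qed.

Hypothesis complete : complete_induced_metric F.

Lemma bending_eq0 x : bending x = 0.
Proof.
apply/eqP; apply: contraT => b0.
have {}b0 : 0 < bending x by rewrite lt_neqAle eq_sym b0 bending_ge0.
have height_gt0 y : 0 < bending y -> 0 < height y by move=> By; rewrite invr_gt0 sqrtr_gt0.
have [x1 [g [q1 [g0 q0 Mx1]]]] : exists x1 g q1, [/\ 0 < g, 0 < q1 &
    [/\ 0 < bending x1, energy x1 = q1 ^+ 2 + g & height x1 <= q1]].
  have dx := chart_atP x; set c := chart_at x in dx.
  have [z Bz g0] : exists2 z, bend c z & 0 < chart_conorm (f c) z ('D_ex (q c) z) ('D_ey (q c) z).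
    exact: (slope_somewhere imm leg wil (bend_map dx b0)).
  have Cz : cimg c z := Bz.1.
  have dz := cinv_dom Cz; have ez := cinvK Cz.
  have bz : 0 < bending (cinv c z).
    exact: (eq_ind _ (fun m => 0 < m) Bz.2 _ (esym (etrans (bending_chart dz) (congr1 (mean_sq (f c)) ez)))).
  have hz : height (cinv c z) = q c z := etrans (height_chart dz) (congr1 (q c) ez).
  exists (cinv c z), (chart_conorm (f c) z ('D_ex (q c) z) ('D_ey (q c) z)), (q c z); split.
  - exact: g0.
  - exact: (eq_ind _ (fun m => 0 < m) (height_gt0 _ bz) _ hz).
  - split; [exact: bz| |exact: (eq_ind _ (fun m => m <= _) (lexx _) _ (esym hz))].
    exact: (etrans (energy_chart dz bz) (congr1 (chart_energy F c) ez)).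
pose M := [set y | [/\ 0 < bending y, energy y = q1 ^+ 2 + g & height y <= q1]].
(* On M the slope of the height is at least the square root of g; half of it
   leaves the strict inequality that a step needs. *)
have k0 : 0 < Num.sqrt g / 2 by rewrite divr_gt0// sqrtr_gt0.
have [_ sF _] := imm.
case: (@no_descent R S F sF complete height M (Num.sqrt g / 2) k0 _ _ _ x1 Mx1).
- by move=> y [By _ _]; exact: ltW (height_gt0 y By).
- move=> a y Ma _ ay.
  have cb := cvg_comp _ _ ay (@bending_continuous y).
  have by0 : 0 < bending y.
    have low n : (q1)^-1 ^+ 2 <= bending (a n).
      have [Bn _ hn] := Ma n.
      exact: inv_sqrt_bound (bending_ge0 _) (height_gt0 _ Bn) hn.
    apply: (@lt_le_trans _ _ ((q1)^-1 ^+ 2)); first by rewrite exprn_gt0// invr_gt0.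
    apply: (cvgr_to_ge cb); exact: nearW.
  have ch := cvg_comp _ _ ay (height_continuous by0).
  have ce := cvg_comp _ _ ay (energy_continuous by0).
  split; last exact: ch.
  split; first exact: by0.
    apply: (cvg_unique _ ce); first exact: norm_hausdorff.
    rewrite (_ : _ \o a = fun=> q1 ^+ 2 + g); first exact: cvg_cst.
    by apply/funext => n; have [_ e _] := Ma n.
  apply: (cvgr_to_le ch); apply: nearW => n; by have [_ _] := Ma n.
- move=> y [By Ey hy].
  have dy := chart_atP y; set k := chart_at y in dy; have Bu := bend_map dy By.
  set u := cmap k y in Bu.
  set gu := chart_conorm (f k) u ('D_ex (q k) u) ('D_ey (q k) u).
  have hu : height y = q k u := height_chart dy.
  have gE : q k u ^+ 2 + gu = q1 ^+ 2 + g := etrans (esym (energy_chart dy By)) Ey.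
  have gg : g <= gu.
    have le2 : q k u ^+ 2 <= q1 ^+ 2.
      have key (a b : R) : 0 < a -> a <= b -> a ^+ 2 <= b ^+ 2.
        by move=> /ltW a0 ab; rewrite !expr2; exact: ler_pM.
      exact: (eq_ind _ (fun m => m ^+ 2 <= _) (key _ _ (height_gt0 y By) hy) _ hu).
    have key (a b d e : R) : a + b = d + e -> a <= d -> e <= b by move=> E ad; rewrite -(lerD2l d) -E lerD2r.
    exact: (key _ _ _ _ gE le2).
  have gu0 : 0 < gu by exact: lt_le_trans gg.
  have [v [Dv Df]] : exists v : R * R, 'D_v (q k) u = - gu /\ enorm ('D_v (f k) u) = Num.sqrt gu.
    exact: (descent_direction imm leg wil Bu).
  have slope : Num.sqrt g / 2 * enorm ('D_v (f k) u) < - 'D_v (q k) u.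
    have s0 : 0 < Num.sqrt gu by rewrite sqrtr_gt0.
    have key (y1 y2 : R) : y1 = Num.sqrt gu -> y2 = - gu -> Num.sqrt g / 2 * y1 < - y2.
      move=> -> ->; rewrite opprK -[X in _ < X](sqr_sqrtr (ltW gu0)) expr2 ltr_pM2r//.
      have le : Num.sqrt g <= Num.sqrt gu by rewrite ler_wsqrtr.
      by apply: lt_le_trans le; rewrite ltr_pdivrMr// mulr_natr mulr2n ltrDl sqrtr_gt0.
    exact: key Df Dv.
  have [r [L [r0 inB W L0 kL]]] := descent_step sF (oB (c := k)) (fun u Bu => Bu.1) Bu
    (sm_inverse_mean imm k 1) k0 slope.
  have Bw : bend k (r *: v + u) := inB r (lexx _).
  have dw := cinv_dom Bw.1; have ew := cinvK Bw.1.
  have bw : 0 < bending (cinv k (r *: v + u)).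
    exact: (eq_ind _ (fun m => 0 < m) Bw.2 _ (esym (etrans (bending_chart dw) (congr1 (mean_sq (f k)) ew)))).
  have hw : height (cinv k (r *: v + u)) = q k (r *: v + u) := etrans (height_chart dw) (congr1 (q k) ew).
  have kL' : Num.sqrt g / 2 * L < height y - height (cinv k (r *: v + u)).
    exact: (eq_ind _ (fun m => _ < m) kL _ (esym (congr2 (fun a b => a - b) hu hw))).
  have drop : height (cinv k (r *: v + u)) < height y.
    have key (a b d : R) : 0 <= a -> a < b - d -> d < b.
      by move=> a0 ab; rewrite -subr_gt0; exact: le_lt_trans ab.
    exact: (key _ _ _ (mulr_ge0 (ltW k0) L0) kL').
  exists (cinv k (r *: v + u)), L; split.
  + split; [exact: bw| |exact: (ltW (lt_le_trans drop hy))].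
    apply: etrans (energy_chart dw bw) _.
    apply: etrans (congr1 (chart_energy F k) ew) _.
    apply: etrans _ gE.
    have [s sr E] := MVT_line (sm_chart_energy imm leg wil k 1) inB.
    have Z := derive_chart_energy imm leg wil v (inB s sr).
    have key (y1 y2 a b : R) : y1 - y2 = a * b -> b = 0 -> y1 = y2.
      by move=> e b0'; apply/eqP; rewrite -subr_eq0 e b0' mulr0.
    exact: (key _ _ _ _ E Z).
  + exact: (eq_ind _ (fun x => within_distance F x _ L) W _ (cmapK dy)).
  + exact: L0.
  + exact: kL'.
Qed.

End Global.

Theorem theorem2p5 (R : realType) (S : smooth_surface R)
    (F : S -> 'rV[R]_(3 + 3)) :
  sphere_immersion F -> legendrian F -> willmore F ->
  complete_induced_metric F -> minimal_surface F.
Proof.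
move=> imm leg wil complete c x dx.
apply: (chart_mean_curvature_eq0 imm leg (cimg_map dx)).
exact: (etrans (esym (bending_chart imm leg dx)) (bending_eq0 imm leg wil complete x)).
Qed.
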